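(* Let $G$ be a discrete countable group and $\mu$ a generating probability measure on $G$. For $0<a<1$ put $\mu_a=(1-a)\sum_{n=0}^\infty a^n\mu^{*n}$. Fix an ultrafilter $\mathcal{U}$ on $(\frac12,1)$ converging to $1$ (i.e. $(1-\epsilon,1)\in\mathcal{U}$ for all $0<\epsilon<\frac12$). Then $\mathcal{U}\lim_{RN}(G,\mu_a)$ is a topological model for the Furstenberg-Poisson boundary $\mathcal{B}(G,\mu)$.
   Context: Generating means that the support of $\mu$ generates $G$ as a semigroup. A QI $G$-space is a probability space with a measurable $G$-action for which the measure is quasi-invariant; a factor map between QI $G$-spaces is a measurable, a.e. $G$-equivariant map pushing one measure to the other. A topological model of a QI $G$-space $\mathcal{X}$ is a QI $G$-space $(Y,\nu_Y)$, with $Y$ a compact metrizable space carrying a continuous $G$-action and $\nu_Y$ a Borel probability measure, together with a factor map $\mathcal{X}\to (Y,\nu_Y)$ inducing an isomorphism $L^\infty(Y,\nu_Y)\cong L^\infty(\mathcal{X})$. The Furstenberg-Poisson boundary $\mathcal{B}(G,\mu)$ is the standard probability $G$-space $(B,\nu)$ where $B$ is the space of ergodic components of the time shift on the path space $G^{\mathbb{N}}$ of the right random walk $X_n=X_0s_1\cdots s_n$ ($s_i$ i.i.d. of law $\mu$, $X_0$ of any fully supported initial law), with $G$ acting by left translation on paths, and $\nu$ is the image of the law of the walk started at $X_0=e$; it satisfies $\mu\ast\nu=\nu$. Definition of $\mathcal{U}\lim_{RN}(G,\mu_a)$: $G$ acts on $\ell^\infty(G)=L^\infty(G,\mu_a)$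 by ${}^g\varphi(x)=\varphi(g^{-1}x)$. The measures $\mu_a$, $a\in(\frac12,1)$, are uniformly bounded quasi-invariant: for each $g$ the functions $\ln\frac{dg\mu_a}{d\mu_a}$ are bounded on $G$ uniformly in $a$. Let $V$ be the $C^*$-algebra of uniformly bounded families $(\varphi_a)_{a\in(1/2,1)}$ in $\ell^\infty(G)$, and let $\nu_\mu((\varphi_a)):=\mathcal{U}\lim_a\sum_{x}\varphi_a(x)\mu_a(x)$, a state on $V$. Let $A=V/\{v\in V:\nu_\mu(v^*v)=0\}$, with the induced $G$-action and faithful state $\nu_\mu$. Let $A_{RN}\subset A$ be the ($G$-invariant, separable) $C^*$-subalgebra generated by the classes of the families $\left(\frac{dg\mu_a}{d\mu_a}\right)_a$, $g\in G$. Then $\mathcal{U}\lim_{RN}(G,\mu_a)$ is the Gelfand spectrum of $A_{RN}$, a compact metrizable space with the induced continuous $G$-action, endowed with the Borel probability measure corresponding to $\nu_\mu|_{A_{RN}}$. *)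

(* Defs.v *)
From HB Require Import structures.
From mathcomp Require Import all_boot all_order all_algebra.
From mathcomp Require Import all_classical all_reals all_analysis.
From mathcomp Require Import complex.

Set Implicit Arguments.
Unset Strict Implicit.
Unset Printing Implicit Defensive.

Import Order.TTheory GRing.Theory Num.Theory.
Import numFieldNormedType.Exports.

Local Open Scope classical_set_scope.
Local Open Scope ring_scope.
Local Open Scope complex_scope.

(* [R[i]] carries the topology of its modulus, as any [numFieldType] does. *)
HB.instance Definition _ (R : realType) := NormedModule.copy R[i] (R[i])^o.

Section random_walk.
Context {R : realType} {G : groupType}.
Implicit Types (f mu theta : G -> R) (g x y : G).

Definition is_prob_mass mu :=
  (forall x, 0 <= mu x) /\ (\esum_(x in [set: G]) (mu x)%:E)%E = 1%E.

Definition generating mu := forall H : set G,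
  [set x | 0 < mu x] `<=` H ->
  (forall x y, H x -> H y -> H (x * y)%g) -> H = [set: G].

Definition mass_dirac y : G -> R := fun x => (x == y)%:R.

Definition convolve mu f : G -> R :=
  fun x => fine (\esum_(y in [set: G]) (mu y * f (y^-1 * x)%g)%:E).

Definition convolve_pow mu n : G -> R := iter n (convolve mu) (mass_dirac 1%g).

Definition abel_mean mu (a : R) : G -> R :=
  fun x => (1 - a) * limn (series (fun n => a ^+ n * convolve_pow mu n x)).

(* Absolutely convergent sums over [G]: \esum handles nonnegative terms only. *)
Definition gsum f : R :=
  fine (\esum_(x in [set: G]) (Num.max (f x) 0)%:E)
  - fine (\esum_(x in [set: G]) (Num.max (- f x) 0)%:E).

Definition cgsum (f : G -> R[i]) : R[i] :=
  gsum (fun x => complex.Re (f x)) +i* gsum (fun x => complex.Im (f x)).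

End random_walk.

Section nonsingular_spaces.
Context {R : realType} {G : groupType}.

Definition is_action {X : Type} (act : G -> X -> X) :=
  (forall x, act 1%g x = x) /\
  (forall g h x, act (g * h)%g x = act g (act h x)).

Definition measurable_action d (X : measurableType d) (act : G -> X -> X) :=
  is_action act /\ forall g, measurable_fun [set: X] (act g).

Definition qi_space d (X : measurableType d) (nu : probability X R)
    (act : G -> X -> X) :=
  measurable_action act /\
  forall g (A : set X), measurable A -> nu (act g @^-1` A) = 0%E <-> nu A = 0%E.

Definition factor_map d d' (X : measurableType d) (Y : measurableType d')
    (nuX : probability X R) (actX : G -> X -> X)
    (nuY : probability Y R) (actY : G -> Y -> Y) (p : X -> Y) :=
  [/\ measurable_fun [set: X] p,
      forall g, {ae nuX, forall x, p (actX g x) = actY g (p x)} &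
      forall A : set Y, measurable A -> nuY A = nuX (p @^-1` A)].

Definition Linfty d (X : measurableType d) (nu : probability X R)
    (f : X -> R[i]) :=
  [/\ measurable_fun [set: X] (fun x => complex.Re (f x)),
      measurable_fun [set: X] (fun x => complex.Im (f x)) &
      exists M : R, {ae nu, forall x, `|f x| <= M%:C}].

(* The *-homomorphism h |-> h \o p from L^oo(Y) to L^oo(X), both taken modulo *)
(* almost everywhere equality, is well defined and bijective.                *)
Definition Linfty_iso d d' (X : measurableType d) (Y : measurableType d')
    (nuX : probability X R) (nuY : probability Y R) (p : X -> Y) :=
  [/\ forall h, Linfty nuY h -> Linfty nuX (h \o p),
      forall h k, Linfty nuY h -> Linfty nuY k ->
        {ae nuX, forall x, h (p x) = k (p x)} <-> {ae nuY, forall y, h y = k y}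
    & forall f, Linfty nuX f ->
        exists2 h, Linfty nuY h & {ae nuX, forall x, h (p x) = f x}].

Definition metrizable (T : topologicalType) := exists dist : T -> T -> R,
  [/\ forall x y, dist x y = 0 <-> x = y,
      forall x y, dist x y = dist y x,
      forall x y z, dist x z <= dist x y + dist y z &
      forall x (A : set T),
        nbhs x A <-> exists2 e, 0 < e & [set y | dist x y < e] `<=` A].

Definition borel (T : ptopologicalType) := g_sigma_algebraType (@open T).

Definition topological_model d (X : measurableType d) (nuX : probability X R)
    (actX : G -> X -> X) (Y : ptopologicalType)
    (nuY : probability (borel Y) R) (actY : G -> Y -> Y) :=
  [/\ qi_space nuX actX,
      compact [set: Y] /\ metrizable Y,
      forall g, continuous (actY g),
      qi_space nuY (actY : G -> borel Y -> borel Y) &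
      exists p : X -> borel Y,
        factor_map nuX actX nuY actY p /\ Linfty_iso nuX nuY p].

End nonsingular_spaces.

Section poisson_boundary.
Context {R : realType} {G : groupType}.

Definition gseq : Type := nat -> G.
HB.instance Definition _ := Choice.on gseq.
HB.instance Definition _ := isPointed.Build gseq (fun=> 1%g).

Definition coordinate_sets : set (set gseq) :=
  [set [set w | w nx.1 = nx.2] | nx in [set: nat * G]].

(* [G^nat] with the product of the discrete sigma-algebras ([G] countable). *)
Definition seq_space := g_sigma_algebraType coordinate_sets.

(* The product measure [theta \x mu \x mu \x ...]; its values on cylinders    *)
(* determine it.                                                             *)
Definition increments_law (theta mu : G -> R) (Q : probability seq_space R) :=
  forall n (x : nat -> G),
    Q [set w : seq_space | forall i, (i <= n)%N -> w i = x i] =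
    (theta (x 0%N) * \prod_(i < n) mu (x i.+1))%:E.

Fixpoint walk (s : nat -> G) (n : nat) : G :=
  if n is m.+1 then (walk s m * s m.+1)%g else s 0%N.

Definition walk_law (theta mu : G -> R) (P : probability seq_space R) :=
  exists2 Q : probability seq_space R, increments_law theta mu Q &
    forall A : set seq_space, measurable A ->
      P A = Q [set s : seq_space | A (walk s)].

Definition time_shift (w : nat -> G) : nat -> G := fun n => w n.+1.

Definition left_translate (g : G) (w : nat -> G) : nat -> G :=
  fun n => (g * w n)%g.

Definition standard_borel d (B : measurableType d) :=
  exists (P : completePseudoMetricType R) (f : B -> P),
    [/\ hausdorff_space P, @second_countable P, bijective f &
        forall A : set B, measurable A <->
          exists2 C : set P, <<s open >> C & A = f @^-1` C].

(* [(B, nu)] is the space of ergodic components of the time shift, realized   *)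
(* as a standard Borel space by a map [bnd] from the path space: modulo null  *)
(* sets, the sigma-algebra of shift-invariant events is the preimage under    *)
(* [bnd] of that of [B].  Null sets refer to the walk with initial law theta. *)
Definition poisson_boundary (mu : G -> R) d (B : measurableType d)
    (nu : probability B R) (act : G -> B -> B) :=
  [/\ standard_borel B, measurable_action act &
  exists (theta : G -> R) (Ptheta Pe : probability seq_space R)
         (bnd : seq_space -> B),
  [/\ is_prob_mass theta /\ (forall x, 0 < theta x),
      walk_law theta mu Ptheta, walk_law (mass_dirac 1%g) mu Pe,
      measurable_fun [set: seq_space] bnd &
  [/\ {ae Ptheta, forall w, bnd (time_shift w) = bnd w},
      forall A : set seq_space, measurable A ->
        [set w | A (time_shift w)] = A ->
        exists2 C : set B, measurable C &
          {ae Ptheta, forall w, A w <-> C (bnd w)},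
      forall g, {ae Ptheta, forall w,
        bnd (left_translate g w) = act g (bnd w)} &
      forall C : set B, measurable C -> nu C = Pe (bnd @^-1` C)]]].

End poisson_boundary.
Arguments gseq : clear implicits.
Arguments seq_space : clear implicits.

Section bounded_families.
Context (R : realType) (G : groupType).

Definition abel_param : Type := {a : R | 2^-1 < a < 1}.

Notation fam := (abel_param -> G -> R[i]).

Definition bounded_family : {pred fam} :=
  fun v => `[< exists M : R, forall a x, `|v a x| <= M%:C >].

Fact bounded_family_subring : subring_closed bounded_family.
Proof.
split.
- by apply/asboolP; exists 1 => a x; rewrite normr1.
- move=> u v /asboolP[M uM] /asboolP[N vN]; apply/asboolP; exists (M + N).
  move=> a x; rewrite rmorphD /=.
  by rewrite (le_trans (ler_normB _ _))// lerD.
- move=> u v /asboolP[M uM] /asboolP[N vN]; apply/asboolP; exists (M * N).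
  move=> a x; rewrite rmorphM /=.
  by rewrite [(u * v) a x]/(u a x * v a x) normrM ler_pM.
Qed.

HB.instance Definition _ :=
  GRing.isSubringClosed.Build fam bounded_family bounded_family_subring.

(* The C*-algebra V, with the pointwise ring operations. *)
Record bfam := BFam { bfam_val :> fam; bfamP : bounded_family bfam_val }.

HB.instance Definition _ := [isSub for bfam_val].
HB.instance Definition _ := [Choice of bfam by <:].
HB.instance Definition _ :=
  GRing.SubChoice_isSubComPzRing.Build _ _ bfam (GRing.subringClosedP _).

Fact bounded_scale (k : R[i]) (v : bfam) :
  bounded_family (fun a x => k * v a x).
Proof.
have /asboolP[M vM] := bfamP v; apply/asboolP.
exists (complex.Re `|k| * M) => a x; rewrite normrM rmorphM /=.
by apply: ler_pM => //; rewrite RRe_real// normr_real.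
Qed.

Fact bounded_conj (v : bfam) : bounded_family (fun a x => (v a x)^*%C).
Proof.
have /asboolP[M vM] := bfamP v; apply/asboolP; exists M => a x.
by rewrite norm_conjC.
Qed.

Fact bounded_translate (g : G) (v : bfam) :
  bounded_family (fun a x => v a (g^-1 * x)%g).
Proof.
have /asboolP[M vM] := bfamP v; apply/asboolP; exists M => a x; exact: vM.
Qed.

Definition bscale k v : bfam := BFam (bounded_scale k v).
Definition bconj v : bfam := BFam (bounded_conj v).
Definition btranslate g v : bfam := BFam (bounded_translate g v).

Definition sup_norm (v : bfam) : R :=
  sup [set r | exists a x, r = complex.Re `|v a x|].

End bounded_families.

Section ultralimit.
Context {R : realType} {G : groupType}.
Variables (mu : G -> R) (U : set_system (abel_param R)).

Notation V := (bfam R G).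

Definition state (v : V) : R[i] :=
  lim (cgsum (fun x => v a x * (abel_mean mu (val a) x)%:C) @[a --> U]).

Definition null_family (v : V) := state (bconj v * v) = 0.

Definition null_coset (v : V) : set V := [set u | null_family (u - v)].

(* The quotient A of V by the ideal of null families, as a set of cosets; the *)
(* operations of V descend to it and are computed on representatives.        *)
Definition quot : Type := {C : set V | exists v, C = null_coset v}.

Definition qproj (v : V) : quot := exist _ (null_coset v) (ex_intro _ v erefl).
Definition qrep (c : quot) : V := sval (cid (proj2_sig c)).

Definition qadd c d := qproj (qrep c + qrep d).
Definition qsub c d := qproj (qrep c - qrep d).
Definition qmul c d := qproj (qrep c * qrep d).
Definition qscale k c := qproj (bscale k (qrep c)).
Definition qconj c := qproj (bconj (qrep c)).
Definition qact g c := qproj (btranslate g (qrep c)).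
Definition qstate c := state (qrep c).
Definition qnorm (c : quot) : R := inf [set sup_norm v | v in sval c].

Definition cstar_subalgebra (S : set quot) :=
  [/\ S (qproj 0) /\ (forall c d, S c -> S d -> S (qadd c d)),
      forall c d, S c -> S d -> S (qmul c d),
      forall k c, S c -> S (qscale k c),
      forall c, S c -> S (qconj c) &
      forall c, (forall e, 0 < e -> exists2 d, S d & qnorm (qsub c d) < e) ->
        S c].

(* The density at x of g mu_a with respect to mu_a. *)
Definition rn_family (g : G) : abel_param R -> G -> R[i] := fun a x =>
  (abel_mean mu (val a) (g^-1 * x)%g / abel_mean mu (val a) x)%:C.

(* These families are bounded as soon as [mu] is a generating probability;    *)
(* the representative [v] spares a proof of it here.                         *)
Definition rn_classes : set quot :=
  [set c | exists g (v : V), bfam_val v = rn_family g /\ c = qproj v].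

Definition rn_algebra : set quot :=
  \bigcap_(S in [set S | cstar_subalgebra S /\ rn_classes `<=` S]) S.

(* Nonzero multiplicative linear functionals.  [rn_algebra] being closed under *)
(* the operations, each of the equations on [c], [d], [z] is available.       *)
Definition is_character (chi : rn_algebra -> R[i]) :=
  [/\ forall c d z : rn_algebra, val z = qadd (val c) (val d) ->
        chi z = chi c + chi d,
      forall c d z : rn_algebra, val z = qmul (val c) (val d) ->
        chi z = chi c * chi d,
      forall k (c z : rn_algebra), val z = qscale k (val c) ->
        chi z = k * chi c &
      exists c, chi c != 0].

(* The Gelfand spectrum, with the topology of pointwise convergence. *)
Definition spectrum : topologicalType :=
  [set chi : {ptws rn_algebra -> R[i]} | is_character chi].

(* [(g chi)(c) = chi (g^-1 c)], including that [rn_algebra] is invariant. *)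
Definition is_induced_action (act : G -> spectrum -> spectrum) :=
  forall g (chi : spectrum) (c : rn_algebra), exists2 d : rn_algebra,
    val d = qact g^-1%g (val c) & val (act g chi) c = val chi d.

End ultralimit.
Arguments rn_classes {R G} mu U.
Arguments rn_algebra {R G} mu U.

(* The library's measurable spaces are pointed; the choice of the point is    *)
(* irrelevant to the Borel structure.                                        *)
Definition pointed_at {T : Type} (t : T) : Type := T.
HB.instance Definition _ (T : topologicalType) (t : T) :=
  Topological.copy (pointed_at t) T.
HB.instance Definition _ (T : topologicalType) (t : T) :=
  isPointed.Build (pointed_at t) t.

(* Riesz representation of the state: the integral of the Gelfand transform   *)
(* of [c] is the value of the state at [c].                                  *)
Definition represents_state {R : realType} {G : groupType} (mu : G -> R)
    (U : set_system (abel_param R)) (chi0 : spectrum mu U)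
    (m : probability (borel (pointed_at chi0)) R) :=
  forall c : rn_algebra mu U, qstate (val c) =
    Rintegral m setT (fun chi => complex.Re (val (chi : spectrum mu U) c)) +i*
    Rintegral m setT (fun chi => complex.Im (val (chi : spectrum mu U) c)).

(* Main.v *)
(** For a bounded family u = (u_a), the function P u : x |-> Ulim_a of the mean
    of u_a(x .) against mu_a is harmonic, because mu_a is almost invariant
    under convolution by mu as a -> 1.  Bounded harmonic functions are exactly
    the Poisson integrals x |-> int f(x b) dnu(b), with f unique up to null
    sets; write f = e(u) when P u is the Poisson integral of f.  Now
    e(u r) = e(u) q for all u, where r = (dg mu_a / d mu_a)_a and
    q = dg nu / d nu, since the left side only sees P u; this multiplicativity
    in r persists under sums, products and uniform limits, hence holds for
    every r in A_RN.  So A_RN embeds in L^oo(B) with the state going to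
    integration, and for almost every b the values q_g(b) are the values of a
    character p(b): they lie in the joint essential range, and a character is
    obtained there as a limit along an ultrafilter on pairs (a, x).  The map p
    pushes nu to the measure of the state and is equivariant by the cocycle
    identity.  It is an isomorphism on L^oo because the Poisson integral of f
    at g is the integral of q_g f, where q_g factors through p: a function
    and its conditional expectation on the spectrum thus have the same Poisson
    integral, so they agree. *)

Require Import Defs.
From HB Require Import structures.
From mathcomp Require Import all_boot all_order all_algebra.
From mathcomp Require Import all_classical all_reals all_analysis.
From mathcomp Require Import complex.
From mathcomp Require Import measurable_realfun ring lra.

Set Implicit Arguments.
Unset Strict Implicit.
Unset Printing Implicit Defensive.

Import Order.TTheory GRing.Theory Num.Theory.
Import numFieldNormedType.Exports.

Local Open Scope classical_set_scope.
Local Open Scope ring_scope.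

(** * Summation over the group and Abel means *)

Section bounded_functions.
Context {R : realType}.
Implicit Types (T : Type).

(** The delicate point is e(u r_g) = e(u) q_g. The mean of a family only gives the integral of e
    over B, and there both sides agree: weighting by r_g evaluates P u at g, weighting by q_g
    evaluates the Poisson integral at g. To compare them as functions, the integral has to be
    localized to an arbitrary measurable set C. The harmonic function x |-> nu (x^-1 C), taken as a
    family constant in a, stands in for the indicator of C: multiplying a family by it multiplies e
    by that indicator. Since e is not multiplicative in general, this rests on positivity alone: the
    pieces of u cut out by C and by its complement are squeezed below the two indicators.

    The same localization gives the characters. If C is not null and the q_g are close to numbers
    t_g on C, then some pair (a, x) has all the r_g close to the t_g. The pair can moreover be
    chosen where a prescribed null family is small; without this, a limit of evaluations at pairs
    would not descend to classes modulo null families. *)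

Definition bounded_fct T (f : T -> R) := exists M : R, forall x, `|f x| <= M.

Lemma bounded_fctP T (f : T -> R) : bounded_fct f ->
  exists2 M : R, 0 < M & forall x, - M <= f x <= M.
Proof.
move=> [M fM]; exists (`|M| + 1) => [|x]; first by rewrite ltr_wpDl.
by rewrite -ler_norml (le_trans (fM x))// (le_trans (ler_norm M))// lerDl.
Qed.

Lemma bounded_between T (f : T -> R) (a b : R) :
  (forall x, a <= f x <= b) -> bounded_fct f.
Proof.
move=> fab; exists (`|a| + `|b|) => x; have /andP[af fb] := fab x.
rewrite ler_norml; apply/andP; split.
  rewrite (le_trans _ af)// opprD; have := ler_norm (- a).
  by rewrite normrN; have := normr_ge0 b; lra.
by rewrite (le_trans fb)//; have := ler_norm b; have := normr_ge0 a; lra.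
Qed.

Lemma bounded_cst T (c : R) : bounded_fct (T := T) (fun=> c).
Proof. by exists `|c|. Qed.

Lemma bounded_add T (f g : T -> R) : bounded_fct f -> bounded_fct g ->
  bounded_fct (fun x => f x + g x).
Proof.
move=> [M fM] [N gN]; exists (M + N) => x.
by rewrite (le_trans (ler_normD _ _))// lerD.
Qed.

Lemma bounded_mul T (f g : T -> R) : bounded_fct f -> bounded_fct g ->
  bounded_fct (fun x => f x * g x).
Proof.
move=> [M fM] [N gN]; exists (M * N) => x.
by rewrite normrM ler_pM.
Qed.

Lemma bounded_scale T (c : R) (f : T -> R) : bounded_fct f ->
  bounded_fct (fun x => c * f x).
Proof. by move=> bf; apply: bounded_mul => //; exact: bounded_cst. Qed.

Lemma bounded_opp T (f : T -> R) : bounded_fct f ->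
  bounded_fct (fun x => - f x).
Proof. by move=> [M fM]; exists M => x; rewrite normrN. Qed.

Lemma bounded_sub T (f g : T -> R) : bounded_fct f -> bounded_fct g ->
  bounded_fct (fun x => f x - g x).
Proof. by move=> bf bg; apply: bounded_add => //; exact: bounded_opp. Qed.

Lemma bounded_comp T T' (f : T -> R) (k : T' -> T) : bounded_fct f ->
  bounded_fct (fun x => f (k x)).
Proof. by move=> [M fM]; exists M. Qed.

End bounded_functions.

Section gsum_theory.
Context {R : realType} {G : groupType}.
Implicit Types (f g u v w : G -> R).

Lemma esumZ (T : choiceType) (a : T -> \bar R) (c : R) :
  0 <= c -> (forall x, 0 <= a x)%E ->
  (\esum_(x in [set: T]) (c%:E * a x) = c%:E * \esum_(x in [set: T]) a x)%E.
Proof.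
have le (b : T -> \bar R) (k : R) : 0 <= k -> (forall x, 0 <= b x)%E ->
    (\esum_(x in [set: T]) (k%:E * b x) <= k%:E * \esum_(x in [set: T]) b x)%E.
  move=> k0 b0; apply: ge_ereal_sup => _ [X [finX _] <-].
  rewrite -ge0_mule_fsumr//; apply: lee_wpmul2l; first by rewrite lee_fin.
  by apply: esum_ge; exists X.
rewrite le_eqVlt => /predU1P[<- _|c0 a0].
  by rewrite mul0e esum1// => i _; rewrite mul0e.
apply/eqP; rewrite eq_le; apply/andP; split; first by apply: le => //; exact: ltW.
(* The reverse inequality is [le] for the scalar [c^-1] and the terms [c * a x]. *)
rewrite -lee_pdivlMl//.
rewrite [leLHS](_ : _ = \esum_(x in [set: T]) (c^-1%:E * (c%:E * a x)))%E.
  apply: le; first by rewrite invr_ge0 ltW.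
  by move=> x; apply: mule_ge0 => //; rewrite lee_fin ltW.
by apply: eq_esum => x _; rewrite muleA -EFinM mulVf ?gt_eqF// mul1e.
Qed.

Notation S f := (\esum_(x in [set: G]) (f x)%:E)%E.

Lemma esum_EFin_ge0 u : (forall x, 0 <= u x) -> (0 <= S u)%E.
Proof. by move=> u0; apply: esum_ge0 => x _; rewrite lee_fin. Qed.

(** Any splitting into summable nonnegative functions computes [gsum], not just the one into
    positive and negative parts: p + v = u + q termwise, and the four sums are finite. *)
Lemma gsumE f u v : (forall x, 0 <= u x) -> (forall x, 0 <= v x) ->
  (S u < +oo)%E -> (S v < +oo)%E -> (forall x, f x = u x - v x) ->
  gsum f = fine (S u) - fine (S v).
Proof.
move=> u0 v0 Su Sv fE; rewrite /gsum.
set p := fun x => Num.max (f x) 0; set q := fun x => Num.max (- f x) 0.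
rewrite -/(S p) -/(S q).
have p0 x : 0 <= p x by rewrite le_max lexx orbT.
have q0 x : 0 <= q x by rewrite le_max lexx orbT.
have pu x : p x <= u x by rewrite ge_max u0 fE gerBl v0.
have qv x : q x <= v x by rewrite ge_max v0 fE opprB gerBl u0.
have Sp : (S p < +oo)%E.
  by apply: le_lt_trans Su; apply: le_esum => x _; rewrite lee_fin.
have Sq : (S q < +oo)%E.
  by apply: le_lt_trans Sv; apply: le_esum => x _; rewrite lee_fin.
have fin (k : G -> R) : (forall x, 0 <= k x) -> (S k < +oo)%E -> S k \is a fin_num.
  by move=> k0 ?; rewrite ge0_fin_numE// esum_EFin_ge0.
have : (S p + S v = S u + S q)%E.
  rewrite -!esumD; do ?by move=> *; rewrite lee_fin.
  apply: eq_esum => x _; rewrite -!EFinD; congr EFin.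
  rewrite /p /q; have := fE x.
  by case: (leP (f x) 0) => h; case: (leP (- f x) 0) => h'; lra.
move=> /(congr1 fine); rewrite !fineD ?fin//; lra.
Qed.

Lemma gsum_ge0E f : (forall x, 0 <= f x) -> gsum f = fine (S f).
Proof.
move=> f0; rewrite /gsum [X in _ - fine X]esum1 => [|x _].
  rewrite subr0; congr fine; apply: eq_esum => x _.
  by rewrite max_l.
by rewrite max_r// oppr_le0.
Qed.

Definition avg w f := gsum (fun x => f x * w x).

Variables (w : G -> R) (wP : is_prob_mass w).
Let w0 x : 0 <= w x. Proof. by case: wP. Qed.

Lemma esum_mass_fin (f : G -> R) : (forall x, 0 <= f x) -> bounded_fct f ->
  (S (fun x => f x * w x)%R < +oo)%E.
Proof.
move=> f0 [M fM].
apply: (@le_lt_trans _ _ (\esum_(x in [set: G]) (M%:E * (w x)%:E))%E).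
  apply: le_esum => x _; rewrite -EFinM lee_fin ler_wpM2r//.
  exact: le_trans (ler_norm _) (fM x).
rewrite esumZ; last by move=> x; rewrite lee_fin.
  by case: wP => _ ->; rewrite mule1 ltry.
exact: le_trans (normr_ge0 _) (fM 1%g).
Qed.

Lemma avg_ge0E f : (forall x, 0 <= f x) -> bounded_fct f ->
  ((avg w f)%:E = \esum_(x in [set: G]) (f x * w x)%:E)%E.
Proof.
move=> f0 bf; rewrite /avg gsum_ge0E => [|x]; last exact: mulr_ge0.
rewrite fineK// ge0_fin_numE; first exact: esum_mass_fin.
by apply: esum_EFin_ge0 => x; exact: mulr_ge0.
Qed.

Lemma avg_diff f u v : (forall x, 0 <= u x) -> (forall x, 0 <= v x) ->
  bounded_fct u -> bounded_fct v -> (forall x, f x = u x - v x) ->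
  avg w f = avg w u - avg w v.
Proof.
move=> u0 v0 bu bv fE; rewrite {1}/avg.
rewrite (@gsumE _ (fun x => u x * w x) (fun x => v x * w x)).
- by rewrite /avg !gsum_ge0E// => x; exact: mulr_ge0.
- by move=> x; exact: mulr_ge0.
- by move=> x; exact: mulr_ge0.
- exact: esum_mass_fin.
- exact: esum_mass_fin.
- by move=> x; rewrite fE mulrBl.
Qed.

Lemma avg_cst (c : R) : avg w (fun=> c) = c.
Proof.
have cst (k : R) : 0 <= k -> avg w (fun=> k) = k.
  move=> k0; apply: EFin_inj; rewrite avg_ge0E//; last exact: bounded_cst.
  under eq_esum do rewrite EFinM.
  rewrite (esumZ (a := fun x => (w x)%:E))//.
  by case: wP => _ ->; rewrite mule1.
rewrite (@avg_diff _ (fun=> Num.max c 0) (fun=> Num.max (- c) 0)).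
- rewrite !cst ?le_max ?lexx ?orbT//.
  by case: (leP c 0) => h; case: (leP (- c) 0) => h'; lra.
- by move=> _; rewrite le_max lexx orbT.
- by move=> _; rewrite le_max lexx orbT.
- exact: bounded_cst.
- exact: bounded_cst.
- by move=> _; case: (leP c 0) => h; case: (leP (- c) 0) => h'; lra.
Qed.

Lemma avgD f g : bounded_fct f -> bounded_fct g ->
  avg w (fun x => f x + g x) = avg w f + avg w g.
Proof.
have pos (u v : G -> R) : (forall x, 0 <= u x) -> (forall x, 0 <= v x) ->
    bounded_fct u -> bounded_fct v ->
    avg w (fun x => u x + v x) = avg w u + avg w v.
  move=> u0 v0 bu bv; apply: EFin_inj.
  rewrite [RHS]EFinD (avg_ge0E u0 bu) (avg_ge0E v0 bv) avg_ge0E.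
  - rewrite -esumD; do ?by move=> *; rewrite lee_fin mulr_ge0.
    by apply: eq_esum => x _; rewrite mulrDl EFinD.
  - by move=> x; exact: addr_ge0.
  - exact: bounded_add.
move=> bf bg.
have [M M0 fM] := bounded_fctP bf; have [N N0 gN] := bounded_fctP bg.
have f0 x : 0 <= f x + M by have := fM x; lra.
have g0 x : 0 <= g x + N by have := gN x; lra.
have bfM : bounded_fct (fun x => f x + M).
  by apply: bounded_add => //; exact: bounded_cst.
have bgN : bounded_fct (fun x => g x + N).
  by apply: bounded_add => //; exact: bounded_cst.
(* Shifting by the bounds reduces the claim to nonnegative functions, for which sums in the extended
   reals are additive. *)
rewrite (@avg_diff _ (fun x => (f x + M) + (g x + N)) (fun=> M + N)).
- rewrite pos//.
  rewrite (@avg_diff f (fun x => f x + M) (fun=> M))//.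
  + rewrite (@avg_diff g (fun x => g x + N) (fun=> N))//.
    * by rewrite !avg_cst; lra.
    * by move=> _; exact: ltW.
    * exact: bounded_cst.
    * by move=> x; rewrite addrK.
  + by move=> _; exact: ltW.
  + exact: bounded_cst.
  + by move=> x; rewrite addrK.
- by move=> x; exact: addr_ge0.
- by move=> _; rewrite addr_ge0// ltW.
- exact: bounded_add.
- exact: bounded_cst.
- by move=> x; lra.
Qed.

Lemma avg_ge0 f : (forall x, 0 <= f x) -> 0 <= avg w f.
Proof.
move=> f0; rewrite /avg gsum_ge0E => [|x]; last exact: mulr_ge0.
by rewrite fine_ge0// esum_EFin_ge0// => x; exact: mulr_ge0.
Qed.

Lemma avgN f : bounded_fct f -> avg w (fun x => - f x) = - avg w f.
Proof.
move=> bf; apply/eqP; rewrite -subr_eq0 opprK -avgD//; last exact: bounded_opp.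
by under eq_fun do rewrite addNr; rewrite avg_cst.
Qed.

Lemma avgB f g : bounded_fct f -> bounded_fct g ->
  avg w (fun x => f x - g x) = avg w f - avg w g.
Proof. by move=> bf bg; rewrite avgD ?avgN//; exact: bounded_opp. Qed.

Lemma ler_avg f g : bounded_fct f -> bounded_fct g ->
  (forall x, f x <= g x) -> avg w f <= avg w g.
Proof.
move=> bf bg fg; rewrite -subr_ge0 -avgB//; apply: avg_ge0 => x.
by rewrite subr_ge0.
Qed.

Lemma avgZ (c : R) f : bounded_fct f -> avg w (fun x => c * f x) = c * avg w f.
Proof.
move=> bf.
have pos (k : R) (u : G -> R) : 0 <= k -> (forall x, 0 <= u x) -> bounded_fct u ->
    avg w (fun x => k * u x) = k * avg w u.
  move=> k0 u0 bu; apply: EFin_inj; rewrite EFinM !avg_ge0E//.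
  - rewrite -esumZ//; last by move=> x; rewrite lee_fin mulr_ge0.
    by apply: eq_esum => x _; rewrite -mulrA EFinM.
  - by move=> x; exact: mulr_ge0.
  - exact: bounded_scale.
have pos' (k : R) : 0 <= k -> avg w (fun x => k * f x) = k * avg w f.
  move=> k0; have [M M0 fM] := bounded_fctP bf.
  have bfM : bounded_fct (fun x => f x + M).
    by apply: bounded_add => //; exact: bounded_cst.
  rewrite (_ : (fun x => k * f x) = (fun x => k * (f x + M) - k * M)); last first.
    by apply/funext => x; rewrite mulrDr addrK.
  rewrite avgB//; [|exact: bounded_scale|exact: bounded_cst].
  rewrite avg_cst pos//; last by move=> x; have := fM x; lra.
  by rewrite avgD// ?avg_cst; [rewrite mulrDr addrK|exact: bounded_cst].
case: (leP 0 c) => c0; first exact: pos'.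
rewrite (_ : (fun x => c * f x) = (fun x => - (- c * f x))); last first.
  by apply/funext => x; rewrite mulNr opprK.
by rewrite avgN ?pos' ?mulNr ?opprK// ?oppr_ge0 ?ltW//; exact: bounded_scale.
Qed.

Lemma avg_between f (a b : R) : (forall x, a <= f x <= b) -> a <= avg w f <= b.
Proof.
move=> fab; have bf := bounded_between fab.
rewrite -{1}(avg_cst a) -{1}(avg_cst b) !ler_avg//; try exact: bounded_cst.
  by move=> x; case/andP: (fab x).
by move=> x; case/andP: (fab x).
Qed.

End gsum_theory.

(** * Convolution of probability masses *)

Section convolution.
Context {R : realType} {G : groupType}.
Implicit Types (mu w f : G -> R).
Notation S f := (\esum_(x in [set: G]) (f x)%:E)%E.

Lemma set_bij_setT (T T' : Type) (f : T -> T') : bijective f ->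
  set_bij setT setT f.
Proof.
move=> [g fK gK]; split => //; first by move=> x y _ _ /(can_inj fK).
by move=> y _; exists (g y).
Qed.

Lemma esum_shift (a : G -> \bar R) (g : G) :
  (\esum_(x in [set: G]) a (g * x)%g = \esum_(x in [set: G]) a x)%E.
Proof.
rewrite [RHS](@reindex_esum _ _ _ setT setT (fun x => (g * x)%g))//.
by apply: set_bij_setT; exists (fun x => (g^-1 * x)%g) => x; rewrite ?mulKg ?mulVKg.
Qed.

Lemma esum_swap (T T' : choiceType) (a : T -> T' -> \bar R) :
  (forall x y, 0 <= a x y)%E ->
  (\esum_(x in [set: T]) \esum_(y in [set: T']) a x y =
   \esum_(y in [set: T']) \esum_(x in [set: T]) a x y)%E.
Proof.
move=> a0; rewrite !esum_esum//.
rewrite (@reindex_esum _ _ _ (setT `*`` (fun=> setT)) (setT `*`` (fun=> setT))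
  (fun k : T' * T => (k.2, k.1)))//.
split => //; first by move=> [i1 j1] [i2 j2] /= _ _ [-> ->].
by move=> [i j] _; exists (j, i).
Qed.

Lemma mass_dirac_prob (y : G) : is_prob_mass (mass_dirac y : G -> R).
Proof.
split => [x|]; first by rewrite /mass_dirac ler0n.
rewrite (esumID [set y])// => [|x _]; last by rewrite lee_fin ler0n.
rewrite setTI esum_set1 ?lee_fin ?ler0n// /mass_dirac eqxx.
rewrite esum1 ?adde0// => x [_ /= xy].
by case: eqP => // /xy.
Qed.

Lemma avg_dirac (y : G) f : bounded_fct f -> avg (mass_dirac y) f = f y.
Proof.
have pos (u : G -> R) : (forall x, 0 <= u x) -> bounded_fct u -> avg (mass_dirac y) u = u y.
  move=> u0 bu; apply: EFin_inj; rewrite avg_ge0E//; last exact: mass_dirac_prob.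
  rewrite (esumID [set y])// => [|x _]; last first.
    by rewrite lee_fin mulr_ge0// ler0n.
  rewrite setTI esum_set1 /mass_dirac ?eqxx ?mulr1 ?lee_fin//.
  rewrite esum1 ?adde0// => x [_ /= xy].
  by case: eqP => [/xy//|]; rewrite mulr0.
move=> bf; have [M M0 fM] := bounded_fctP bf.
have := pos (fun x => f x + M) _ _; rewrite avgD ?avg_cst//.
- move=> /(_ _ _)/addIr; apply; first by move=> x; have := fM x; lra.
  by apply: bounded_add => //; exact: bounded_cst.
- exact: mass_dirac_prob.
- exact: mass_dirac_prob.
- exact: bounded_cst.
Qed.

Section prob_mass.
Variables (mu w : G -> R) (muP : is_prob_mass mu) (wP : is_prob_mass w).
Let mu0 x : 0 <= mu x. Proof. by case: muP. Qed.
Let w0 x : 0 <= w x. Proof. by case: wP. Qed.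

Lemma esum_ge_term (f : G -> R) x : (forall y, 0 <= f y) -> ((f x)%:E <= S f)%E.
Proof.
move=> f0; apply: esum_ge; exists [set x]; first by split => //; exact: finite_set1.
by rewrite fsbig_set1.
Qed.

Lemma prob_mass_le1 x : w x <= 1.
Proof.
rewrite -lee_fin; case: wP => _ <-; exact: esum_ge_term.
Qed.

Lemma convolveE x : ((convolve mu w x)%:E =
  \esum_(y in [set: G]) (mu y * w (y^-1 * x)%g)%:E)%E.
Proof.
rewrite /convolve fineK// ge0_fin_numE.
  rewrite (@le_lt_trans _ _ (S mu))//; last by case: muP => _ ->; rewrite ltry.
  by apply: le_esum => y _; rewrite lee_fin ler_piMr ?prob_mass_le1.
by apply: esum_ge0 => y _; rewrite lee_fin mulr_ge0.
Qed.

Lemma convolve_ge0 x : 0 <= convolve mu w x.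
Proof.
by rewrite -lee_fin convolveE esum_ge0// => y _; rewrite lee_fin mulr_ge0.
Qed.

Lemma convolve_ge x y : mu y * w (y^-1 * x)%g <= convolve mu w x.
Proof.
rewrite -lee_fin convolveE.
apply: (esum_ge_term (f := fun y => mu y * w (y^-1 * x)%g)) => z.
exact: mulr_ge0.
Qed.

(** Tonelli, followed by the substitution z -> y z in the inner sum. *)
Lemma esum_convolve (f : G -> R) : (forall x, 0 <= f x) ->
  (\esum_(z in [set: G]) (f z * convolve mu w z)%:E =
   \esum_(y in [set: G]) ((mu y)%:E *
     \esum_(z in [set: G]) (f (y * z)%g * w z)%:E))%E.
Proof.
move=> f0.
under eq_esum => z _.
  rewrite EFinM convolveE -esumZ//; last by move=> y; rewrite lee_fin mulr_ge0.
  over.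
rewrite esum_swap => [|z y]; last by rewrite -EFinM lee_fin !mulr_ge0.
apply: eq_esum => y _; rewrite -esumZ//; last by move=> z; rewrite lee_fin mulr_ge0.
rewrite -(esum_shift _ y); apply: eq_esum => z _.
by rewrite mulKg -!EFinM; congr EFin; ring.
Qed.

Lemma convolve_prob : is_prob_mass (convolve mu w).
Proof.
split => [x|]; first exact: convolve_ge0.
have := @esum_convolve (fun=> 1) (fun=> ler01).
under eq_esum do rewrite mul1r.
move=> ->; under eq_esum => y _.
  under eq_esum do rewrite mul1r.
  case: wP => _ ->; rewrite mule1; over.
by case: muP.
Qed.

Lemma avg_convolve f : bounded_fct f ->
  avg (convolve mu w) f = avg mu (fun y => avg w (fun z => f (y * z)%g)).
Proof.
have cP := convolve_prob.
have pos (u : G -> R) : (forall x, 0 <= u x) -> bounded_fct u ->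
    avg (convolve mu w) u = avg mu (fun y => avg w (fun z => u (y * z)%g)).
  move=> u0 bu; apply: EFin_inj; rewrite avg_ge0E// esum_convolve//.
  rewrite avg_ge0E//.
  - apply: eq_esum => y _; rewrite EFinM avg_ge0E 1?muleC//.
    exact: (bounded_comp (fun z => (y * z)%g)).
  - by move=> y; apply: avg_ge0.
  - have [M M0 uM] := bounded_fctP bu.
    apply: (@bounded_between _ _ _ (-M) M) => y.
    by apply: avg_between.
move=> bf; have [M M0 fM] := bounded_fctP bf.
have := pos (fun x => f x + M) _ _; rewrite avgD ?avg_cst//; last exact: bounded_cst.
have bfy y : bounded_fct (fun z => f (y * z)%g).
  exact: (bounded_comp (fun z => (y * z)%g)).
rewrite (_ : (fun y => avg w (fun z => f (y * z)%g + M)) =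
  (fun y => avg w (fun z => f (y * z)%g) + M)); last first.
  apply/funext => y; rewrite avgD//; last exact: bounded_cst.
  by rewrite avg_cst.
rewrite avgD//; last exact: bounded_cst.
  rewrite avg_cst// => /(_ _ _)/addIr; apply; first by move=> x; have := fM x; lra.
  by apply: bounded_add => //; exact: bounded_cst.
by apply: (@bounded_between _ _ _ (-M) M) => y; apply: avg_between.
Qed.

End prob_mass.
End convolution.

(** * Abel means of the convolution powers *)

Section abel.
Context {R : realType} {G : groupType}.
Variables (mu : G -> R) (muP : is_prob_mass mu) (a : R) (a01 : 0 < a < 1).
Notation S f := (\esum_(x in [set: G]) (f x)%:E)%E.

Lemma convolve_pow_prob n : is_prob_mass (convolve_pow mu n).
Proof.
elim: n => [|n IH]; first exact: mass_dirac_prob.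
exact: convolve_prob.
Qed.

Let a0 : 0 <= a. Proof. by case/andP: a01 => /ltW. Qed.
Let cp0 n x : 0 <= convolve_pow mu n x. Proof. by case: (convolve_pow_prob n). Qed.

Lemma esum_geometric : (\esum_(n in [set: nat]) (a ^+ n)%:E = ((1 - a)^-1)%:E)%E.
Proof.
rewrite -nneseries_esumT; last by move=> n; rewrite lee_fin exprn_ge0.
apply: cvg_lim => //.
have -> : (fun n => \sum_(0 <= i < n) (a ^+ i)%:E)%E =
    EFin \o series (geometric 1 a).
  apply/funext => n; rewrite /series /= -sumEFin.
  by apply: eq_bigr => i _; rewrite mul1r.
apply: cvg_EFin; first by near=> n.
rewrite -[(1 - a)^-1]mul1r; apply: cvg_geometric_series.
by rewrite ger0_norm//; case/andP: a01.
Unshelve. all: end_near. Qed.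

(** [limn] has a meaning only for a convergent series. Domination by the geometric series makes the
    real limit agree with the sum in the extended reals, where sums may be exchanged. *)
Lemma abel_meanE x : ((abel_mean mu a x)%:E = (1 - a)%:E *
  \esum_(n in [set: nat]) (a ^+ n * convolve_pow mu n x)%:E)%E.
Proof.
rewrite /abel_mean EFinM; congr (_ * _)%E.
have t0 n : (0 <= (a ^+ n * convolve_pow mu n x)%:E)%E.
  by rewrite lee_fin mulr_ge0// exprn_ge0.
rewrite -nneseries_esumT//.
have fin : (\esum_(n in [set: nat]) (a ^+ n * convolve_pow mu n x)%:E < +oo)%E.
  rewrite (@le_lt_trans _ _ (\esum_(n in [set: nat]) (a ^+ n)%:E)%E)//.
    apply: le_esum => n _; rewrite lee_fin ler_piMr ?exprn_ge0//.
    exact/prob_mass_le1/convolve_pow_prob.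
  by rewrite esum_geometric ltry.
rewrite -nneseries_esumT// in fin.
rewrite -[RHS](@fineK _ _); last by rewrite ge0_fin_numE// nneseries_ge0.
congr EFin; apply: cvg_lim => //.
rewrite (_ : series _ = fine \o
  (fun n => \sum_(0 <= i < n) (a ^+ i * convolve_pow mu i x)%:E)%E); last first.
  by apply/funext => n /=; rewrite sumEFin.
apply: fine_cvg; rewrite fineK; last by rewrite ge0_fin_numE// nneseries_ge0.
exact: is_cvg_nneseries.
Qed.

Lemma abel_mean_ge0 x : 0 <= abel_mean mu a x.
Proof.
rewrite -lee_fin abel_meanE mule_ge0//.
  by rewrite lee_fin subr_ge0 ltW//; case/andP: a01.
by apply: esum_ge0 => n _; rewrite lee_fin mulr_ge0// exprn_ge0.
Qed.

Lemma abel_mean_prob : is_prob_mass (abel_mean mu a).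
Proof.
split => [x|]; first exact: abel_mean_ge0.
have a1 : 0 < 1 - a by rewrite subr_gt0; case/andP: a01.
under eq_esum do rewrite abel_meanE.
rewrite esumZ; [|exact: ltW|]; last first.
  by move=> x; apply: esum_ge0 => n _; rewrite lee_fin mulr_ge0// exprn_ge0.
rewrite esum_swap; last by move=> x n; rewrite lee_fin mulr_ge0// exprn_ge0.
under eq_esum => n _.
  under eq_esum do rewrite EFinM.
  rewrite esumZ; [|exact: exprn_ge0|by move=> x; rewrite lee_fin].
  case: (convolve_pow_prob n) => _ ->; rewrite mule1; over.
by rewrite esum_geometric -EFinM mulfV ?gt_eqF.
Qed.

(** Split off the term n = 0 and take one factor [mu] out of the others. Positivity, the bounds on
    densities and the almost invariance of the Abel means are all read off from this identity. *)
Lemma abel_mean_rec x : abel_mean mu a x =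
  (1 - a) * mass_dirac 1%g x + a * convolve mu (abel_mean mu a) x.
Proof.
have a1 : 0 <= 1 - a by rewrite subr_ge0 ltW//; case/andP: a01.
have t0 n y : (0 <= (a ^+ n * convolve_pow mu n y)%:E)%E.
  by rewrite lee_fin mulr_ge0// exprn_ge0.
have mu0 y : 0 <= mu y by case: muP.
apply: EFin_inj; rewrite EFinD [in RHS]EFinM [X in (_ + X)%E]EFinM abel_meanE.
rewrite -nneseries_esumT// nneseries_recl//.
rewrite ge0_muleDr//; last by apply: nneseries_ge0 => *; exact: t0.
congr (_ + _)%E; first by rewrite expr0 mul1r.
rewrite convolveE//; last exact: abel_mean_prob.
under [X in (_ = _ * X)%E]eq_esum => y _.
  rewrite EFinM abel_meanE muleCA; over.
rewrite esumZ//; last first.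
  move=> y; rewrite mule_ge0 ?lee_fin// esum_ge0// => *; exact: t0.
rewrite muleCA; congr (_ * _)%E.
under [X in (_ = _ * X)%E]eq_esum => y _.
  rewrite -esumZ//; over.
rewrite esum_swap; last first.
  by move=> y n; apply: mule_ge0; rewrite lee_fin// mulr_ge0// exprn_ge0.
rewrite -esumZ//; last first.
  move=> n; apply: esum_ge0 => y _; apply: mule_ge0; rewrite lee_fin//.
  by rewrite mulr_ge0// exprn_ge0.
rewrite -(nneseries_addn 1)//.
rewrite nneseries_esumT//.
apply: eq_esum => n _; rewrite addn1 [convolve_pow _ _ _]/= EFinM.
rewrite convolveE//; last exact: convolve_pow_prob.
rewrite -!esumZ//; last first.
- by move=> y; apply: mule_ge0; rewrite lee_fin// mulr_ge0// exprn_ge0.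
- by move=> y; rewrite lee_fin mulr_ge0.
- exact: exprn_ge0.
by apply: eq_esum => y _; rewrite -!EFinM exprS; congr EFin; ring.
Qed.

Lemma abel_mean_id_gt0 : 0 < abel_mean mu a 1%g.
Proof.
rewrite abel_mean_rec /mass_dirac eqxx mulr1 ltr_pwDl ?subr_gt0//.
  by case/andP: a01.
rewrite mulr_ge0// convolve_ge0//; exact: abel_mean_prob.
Qed.

Lemma avg_abel_mean (f : G -> R) : bounded_fct f ->
  avg (abel_mean mu a) f =
  (1 - a) * f 1%g + a * avg mu (fun y => avg (abel_mean mu a) (fun z => f (y * z)%g)).
Proof.
have P := abel_mean_prob; have cP := convolve_prob muP P.
have a1 : 0 <= 1 - a by rewrite subr_ge0 ltW//; case/andP: a01.
have mulS (w : G -> R) (u : G -> R) (k : R) : is_prob_mass w ->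
    (forall x, 0 <= u x) -> 0 <= k ->
    (\esum_(x in [set: G]) (u x * (k * w x))%:E =
     k%:E * \esum_(x in [set: G]) (u x * w x)%:E)%E.
  move=> wP u0 k0; rewrite -esumZ//; last first.
    by move=> x; rewrite lee_fin mulr_ge0//; case: wP.
  by apply: eq_esum => x _; rewrite -EFinM; congr EFin; ring.
have pos (u : G -> R) : (forall x, 0 <= u x) -> bounded_fct u ->
    avg (abel_mean mu a) u = (1 - a) * avg (mass_dirac 1%g) u
      + a * avg (convolve mu (abel_mean mu a)) u.
  move=> u0 bu; apply: EFin_inj.
  rewrite [RHS]EFinD [X in (X + _)%E]EFinM [X in (_ + X)%E]EFinM.
  rewrite !avg_ge0E//; last exact: mass_dirac_prob.
  rewrite -!mulS//; last exact: mass_dirac_prob.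
  rewrite -esumD.
  - by apply: eq_esum => x _; rewrite -EFinD -mulrDr -abel_mean_rec.
  - by move=> x _; rewrite lee_fin !mulr_ge0// ler0n.
  - by move=> x _; rewrite lee_fin !mulr_ge0//; case: cP.
move=> bf; rewrite -avg_convolve// -{1}(avg_dirac 1%g bf).
have [M M0 fM] := bounded_fctP bf.
have := pos (fun x => f x + M).
rewrite !avgD ?avg_cst//; do ?[exact: mass_dirac_prob|exact: bounded_cst].
move=> H; have {}H := H _ (bounded_add bf (bounded_cst G M)).
have : avg (abel_mean mu a) f + M = (1 - a) * (avg (mass_dirac 1%g) f + M) +
    a * (avg (convolve mu (abel_mean mu a)) f + M).
  by apply: H => x; have := fM x; lra.
lra.
Qed.

End abel.

Section radon_nikodym_bound.
Context {R : realType} {G : groupType}.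
Variables (mu : G -> R) (muP : is_prob_mass mu) (mu_gen : generating mu).

Lemma abel_param_in (a : abel_param R) : 0 < val a < 1.
Proof. by case/andP: (valP a) => h ->; rewrite andbT (lt_trans _ h). Qed.

(** The elements g that admit a constant form a semigroup, so the support of [mu] is enough. There
    the recursion gives a mu(y) mu_a(y^-1 x) <= mu_a(x), and a > 1/2 yields the constant 2 / mu(y),
    uniform in a. *)
Lemma abel_mean_ratio (g : G) : exists2 K : R, 0 < K &
  forall (a : abel_param R) x,
    abel_mean mu (val a) (g^-1 * x)%g <= K * abel_mean mu (val a) x.
Proof.
pose H := [set g : G | exists2 K : R, 0 < K & forall (a : abel_param R) x,
    abel_mean mu (val a) (g^-1 * x)%g <= K * abel_mean mu (val a) x].
suff : H = setT by move=> HT; have : H g by rewrite HT.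
apply: mu_gen => [y /= my|y z [K K0 yK] [L L0 zL]].
  exists (2 / mu y) => [|a x]; first by rewrite divr_gt0.
  have a01 := abel_param_in a; have aP := abel_mean_prob muP a01.
  have := convolve_ge muP aP x y.
  have := abel_mean_rec muP a01 x.
  have : 0 <= (1 - val a) * mass_dirac 1%g x.
    by rewrite mulr_ge0 ?ler0n// subr_ge0 ltW//; case/andP: a01.
  have h2 : 2^-1 <= val a by rewrite ltW//; case/andP: (valP a).
  have c0 := convolve_ge0 muP aP x.
  move: (abel_mean mu (val a) x) (convolve _ _ x) (mass_dirac _ _) c0
    (abel_mean mu (val a) (y^-1 * x)%g) => A c D c0 B D0 AE Bc.
  rewrite mulrAC ler_pdivlMr// mulrC (le_trans Bc)//.
  by rewrite -(@ler_pM2l _ 2^-1)// mulrA mulVf// mul1r; nra.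
exists (L * K) => [|a x]; first exact: mulr_gt0.
by rewrite invgM -mulgA (le_trans (zL _ _))// -mulrA ler_pM2l.
Qed.

Lemma abel_mean_gt0 (a : abel_param R) x : 0 < abel_mean mu (val a) x.
Proof.
have [K K0 /(_ a x)] := abel_mean_ratio x.
rewrite mulVg => h; rewrite -(pmulr_rgt0 _ K0) (lt_le_trans _ h)//.
exact/abel_mean_id_gt0/abel_param_in.
Qed.

End radon_nikodym_bound.

Lemma ultra_fmap (T T' : Type) (f : T -> T') (F : set_system T) :
  UltraFilter F -> UltraFilter (f @ F).
Proof.
move=> FU; have FF : ProperFilter F by exact: ultra_proper.
split; first exact: fmap_proper_filter.
move=> H HF sFH; apply/seteqP; split => // A HA.
have [//|FnA] := in_ultra_setVsetC (f @^-1` A) FU.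
have HnA : H (~` A) by exact: sFH.
by have [x []] := filter_ex (filterI HA HnA).
Qed.

(** * Limits along ultrafilters *)

Section real_ultralimit.
Context {R : realType} {T : Type}.
Variables (F : set_system T) (FU : UltraFilter F).
Implicit Types f g : T -> R.

Definition ulim f : R := lim (f @ F).

Let FF : ProperFilter F. Proof. exact: ultra_proper. Qed.

(** The values lie in a compact segment, in which the image ultrafilter converges. *)
Lemma ulim_cvg f : bounded_fct f -> f @ F --> ulim f.
Proof.
move=> bf; have [M M0 fM] := bounded_fctP bf.
have UF : UltraFilter (f @ F) by exact: ultra_fmap.
have := @segment_compact R (- M) M; rewrite compact_ultra => /(_ (f @ F) UF).
case=> [|l [_ fl]]; first by apply: (@filterE _ F) => x /=; rewrite in_itv/=; exact: fM.

by rewrite /ulim (cvg_lim _ fl).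
Qed.

Lemma ulim_unique f l : f @ F --> l -> ulim f = l.
Proof. by move=> fl; apply: cvg_lim. Qed.

Lemma ulim_cst (c : R) : ulim (fun=> c) = c.
Proof. by apply: ulim_unique; exact: cvg_cst. Qed.

Lemma ulimD f g : bounded_fct f -> bounded_fct g ->
  ulim (fun x => f x + g x) = ulim f + ulim g.
Proof. by move=> bf bg; apply: ulim_unique; apply: cvgD; exact: ulim_cvg. Qed.

Lemma ulimM f g : bounded_fct f -> bounded_fct g ->
  ulim (fun x => f x * g x) = ulim f * ulim g.
Proof. by move=> bf bg; apply: ulim_unique; apply: cvgM; exact: ulim_cvg. Qed.

Lemma ulimZ (c : R) f : bounded_fct f -> ulim (fun x => c * f x) = c * ulim f.
Proof.
by move=> bf; rewrite ulimM ?ulim_cst//; exact: bounded_cst.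
Qed.

Lemma ulimN f : bounded_fct f -> ulim (fun x => - f x) = - ulim f.
Proof. by move=> bf; apply: ulim_unique; apply: cvgN; exact: ulim_cvg. Qed.

Lemma ulimB f g : bounded_fct f -> bounded_fct g ->
  ulim (fun x => f x - g x) = ulim f - ulim g.
Proof. by move=> bf bg; rewrite ulimD ?ulimN//; exact: bounded_opp. Qed.

Lemma ulim_between_near f (a b : R) : bounded_fct f ->
  F [set x | a <= f x <= b] -> a <= ulim f <= b.
Proof.
move=> bf fab; have fl := ulim_cvg bf.
apply/andP; split.
  apply: (closed_cvg (fun y => a <= y)) fl; first exact: closed_ge.
  by apply: filterS fab => x /= /andP[].
apply: (closed_cvg (fun y => y <= b)) fl; first exact: closed_le.
by apply: filterS fab => x /= /andP[].
Qed.

Lemma ulim_between f (a b : R) : (forall x, a <= f x <= b) -> a <= ulim f <= b.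
Proof.
move=> fab; apply: ulim_between_near; first exact: bounded_between fab.
by apply: filterE => x; exact: fab.
Qed.

Lemma ulim_ge0 f : bounded_fct f -> (forall x, 0 <= f x) -> 0 <= ulim f.
Proof.
move=> bf f0; have [M M0 fM] := bounded_fctP bf.
suff /andP[] : 0 <= ulim f <= M by [].
by apply: ulim_between => x; rewrite f0/=; case/andP: (fM x).
Qed.

Lemma ler_ulim f g : bounded_fct f -> bounded_fct g ->
  (forall x, f x <= g x) -> ulim f <= ulim g.
Proof.
move=> bf bg fg; rewrite -subr_ge0 -ulimB//; apply: ulim_ge0.
  exact: bounded_sub.
by move=> x; rewrite subr_ge0.
Qed.

Lemma ulim_near_eq f g : F [set x | f x = g x] -> ulim f = ulim g.
Proof.
move=> fg; rewrite /ulim; congr (lim _); apply/seteqP; split => A /= fA.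
  by near=> x; rewrite /= -(near fg x)//; near: x.
by near=> x; rewrite /= (near fg x)//; near: x.
Unshelve. all: end_near. Qed.

Lemma ulim_sum (I : Type) (s : seq I) (f : I -> T -> R) :
  (forall i, bounded_fct (f i)) ->
  bounded_fct (fun x => \sum_(i <- s) f i x) /\
  ulim (fun x => \sum_(i <- s) f i x) = \sum_(i <- s) ulim (f i).
Proof.
move=> bf; elim: s => [|i s [bs IH]].
  rewrite big_nil; split.
    under eq_fun do rewrite big_nil. exact: bounded_cst.
  by under eq_fun do rewrite big_nil; exact: ulim_cst.
rewrite big_cons -IH; split.
  by under eq_fun do rewrite big_cons; exact: bounded_add.
by under eq_fun do rewrite big_cons; exact: ulimD.
Qed.

End real_ultralimit.

Section exchange.
Context {R : realType} {G : groupType} {T : Type}.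
Variables (F : set_system T) (FU : UltraFilter F).
Variables (w : G -> R) (wP : is_prob_mass w).

Let w0 x : 0 <= w x. Proof. by case: wP. Qed.

(** Finite partial sums commute with the ultralimit, which gives a Fatou inequality for nonnegative
    functions. Applied to f + M and to M - f it gives both directions. *)
Lemma avg_ulim (f : T -> G -> R) (M : R) : (forall t x, - M <= f t x <= M) ->
  avg w (fun x => ulim F (f^~ x)) = ulim F (fun t => avg w (f t)).
Proof.
have half (k : T -> G -> R) (N : R) : (forall t x, 0 <= k t x <= N) ->
    avg w (fun x => ulim F (k^~ x)) <= ulim F (fun t => avg w (k t)).
  move=> kN.
  have bk x : bounded_fct (k^~ x) by apply: (@bounded_between _ _ _ 0 N).
  have bk' t : bounded_fct (k t) by apply: (@bounded_between _ _ _ 0 N).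
  have k0 x : 0 <= ulim F (k^~ x).
    by apply: ulim_ge0 => // t; case/andP: (kN t x).
  have bu : bounded_fct (fun x => ulim F (k^~ x)).
    by apply: (@bounded_between _ _ _ 0 N) => x; exact: ulim_between.
  have ba : bounded_fct (fun t => avg w (k t)).
    by apply: (@bounded_between _ _ _ 0 N) => t; exact: avg_between.
  rewrite -lee_fin avg_ge0E//.
  apply: ge_ereal_sup => _ [X [finX _] <-].
  rewrite fsbig_finite//= sumEFin lee_fin.
  have b2 x : bounded_fct (fun t => w x * k t x) by exact: bounded_scale.
  have [b3 e3] := ulim_sum FU (finmap.enum_fset (fset_set X)) b2.
  rewrite (_ : \sum_(_ <- _) _ = \sum_(x <- finmap.enum_fset (fset_set X)) ulim F (fun t => w x * k t x)).
    rewrite -e3; apply: ler_ulim => // t.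
    rewrite -lee_fin avg_ge0E//; last by move=> x; case/andP: (kN t x).
    rewrite -sumEFin; apply: esum_ge; exists X => //.
    rewrite fsbig_finite//=; apply: lee_sum => i _.
    by rewrite mulrC.
  by apply: eq_bigr => x _; rewrite ulimZ// mulrC.
move=> fM.
have bf x : bounded_fct (f^~ x) by apply: (@bounded_between _ _ _ (- M) M).
have bf' t : bounded_fct (f t) by apply: (@bounded_between _ _ _ (- M) M).
have bu : bounded_fct (fun x => ulim F (f^~ x)).
  by apply: (@bounded_between _ _ _ (- M) M) => x; exact: ulim_between.
have ba : bounded_fct (fun t => avg w (f t)).
  by apply: (@bounded_between _ _ _ (- M) M) => t; exact: avg_between.
have cM (I : Type) : bounded_fct (T := I) (fun=> M) by exact: bounded_cst.
apply/eqP; rewrite eq_le; apply/andP; split.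
  have := half (fun t x => f t x + M) (M + M) _.
  rewrite (_ : (fun x => ulim F _) = (fun x => ulim F (f^~ x) + M)); last first.
    by apply/funext => x; rewrite ulimD// ulim_cst.
  rewrite (_ : (fun t => avg w _) = (fun t => avg w (f t) + M)); last first.
    by apply/funext => t; rewrite avgD// avg_cst.
  rewrite avgD// avg_cst// ulimD// ulim_cst// lerD2r; apply.
  by move=> t x; have := fM t x; lra.
have := half (fun t x => M - f t x) (M + M) _.
rewrite (_ : (fun x => ulim F _) = (fun x => M - ulim F (f^~ x))); last first.
  by apply/funext => x; rewrite ulimB// ulim_cst.
rewrite (_ : (fun t => avg w _) = (fun t => M - avg w (f t))); last first.
  by apply/funext => t; rewrite avgB// avg_cst.
rewrite avgB// avg_cst// ulimB// ulim_cst// lerD2l lerN2; apply.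
by move=> t x; have := fM t x; lra.
Qed.

End exchange.

Section complex_ultralimit.
Context {R : realType} {T : Type}.
Variables (F : set_system T) (FU : UltraFilter F).
Local Open Scope complex_scope.
Implicit Types f g : T -> R[i].
Let FF : ProperFilter F. Proof. exact: ultra_proper. Qed.

Definition culim f : R[i] :=
  ulim F (fun t => complex.Re (f t)) +i* ulim F (fun t => complex.Im (f t)).

Lemma norm_le_ReIm (z : R[i]) :
  `|z| <= (`|complex.Re z| + `|complex.Im z|)%:C.
Proof.
case: z => a b /=; rewrite normc_def lecR/=.
rewrite -[leRHS]ger0_norm ?addr_ge0// -sqrtr_sqr ler_wsqrtr//.
rewrite sqrrD !real_normK ?num_real//.
by rewrite lerD2r lerDl mulrn_wge0// mulr_ge0.
Qed.

Lemma Re_le_norm (z : R[i]) : (`|complex.Re z|)%:C <= `|z|.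
Proof.
case: z => a b /=; rewrite normc_def lecR/=.
by rewrite -sqrtr_sqr ler_wsqrtr// lerDl sqr_ge0.
Qed.

Lemma Im_le_norm (z : R[i]) : (`|complex.Im z|)%:C <= `|z|.
Proof.
case: z => a b /=; rewrite normc_def lecR/=.
by rewrite -sqrtr_sqr ler_wsqrtr// lerDr sqr_ge0.
Qed.

Definition cbounded (S : Type) (f : S -> R[i]) := exists M : R, forall t, `|f t| <= M%:C.

Lemma cbounded_Re (S : Type) (f : S -> R[i]) : cbounded f ->
  bounded_fct (fun t => complex.Re (f t)).
Proof. by case=> M fM; exists M => t; rewrite -lecR (le_trans (Re_le_norm _)). Qed.

Lemma cbounded_Im (S : Type) (f : S -> R[i]) : cbounded f ->
  bounded_fct (fun t => complex.Im (f t)).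
Proof. by case=> M fM; exists M => t; rewrite -lecR (le_trans (Im_le_norm _)). Qed.

Lemma cvg_complex (H : set_system T) (HF : Filter H) f (a b : R) :
  (fun t => complex.Re (f t)) @ H --> a -> (fun t => complex.Im (f t)) @ H --> b ->
  f @ H --> (a +i* b : R[i]).
Proof.
move=> /cvgrPdist_lt fa /cvgrPdist_lt fb; apply/cvgrPdist_lt => -[e e'].
rewrite ltcE /= => /andP[/eqP -> e0].
have e2 : 0 < e / 2 by rewrite divr_gt0.
near=> t.
rewrite (le_lt_trans (norm_le_ReIm _))// ltcR.
rewrite [e]splitr ltrD//.
  suff : `|a - complex.Re (f t)| < e / 2 by case: (f t).
  by near: t; exact: fa.
suff : `|b - complex.Im (f t)| < e / 2 by case: (f t).
by near: t; exact: fb.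
Unshelve. all: end_near. Qed.

Lemma culim_cvg f : cbounded f -> f @ F --> culim f.
Proof.
move=> bf; apply: cvg_complex.
  by apply: ulim_cvg; exact: cbounded_Re.
by apply: ulim_cvg; exact: cbounded_Im.
Qed.

Lemma culim_lim f : cbounded f -> lim (f @ F) = culim f.
Proof. by move=> bf; apply: cvg_lim; [exact: norm_hausdorff|exact: culim_cvg]. Qed.

End complex_ultralimit.

(** * Harmonic functions from bounded families *)

Section harmonic_functions.
Context {R : realType} {G : groupType}.
Variables (mu : G -> R) (muP : is_prob_mass mu) (mu_gen : generating mu).

Definition harmonic (h : G -> R) := forall x, h x = avg mu (fun y => h (x * y)%g).

(** For g in the support of [mu], mu(g) h(x g) is one term of the mean that equals h(x); constants
    multiply along products. As K depends only on g, this will compare the translates of nu. *)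
Lemma harnack (g : G) : exists2 K : R, 0 < K & forall h : G -> R,
  bounded_fct h -> (forall x, 0 <= h x) -> harmonic h ->
  forall x, h (x * g)%g <= K * h x.
Proof.
pose H := [set g : G | exists2 K : R, 0 < K & forall h : G -> R,
  bounded_fct h -> (forall x, 0 <= h x) -> harmonic h ->
  forall x, h (x * g)%g <= K * h x].
suff : H = setT by move=> HT; have : H g by rewrite HT.
apply: mu_gen => [y /= my|y z [K K0 yK] [L L0 zL]].
  exists (mu y)^-1 => [|h bh h0 hh x]; first by rewrite invr_gt0.
  rewrite mulrC ler_pdivlMr// [leRHS]hh -lee_fin avg_ge0E//.
    exact: (esum_ge_term (f := fun y => h (x * y)%g * mu y)) (fun y => mulr_ge0 (h0 _) (proj1 muP y)).
  exact: (bounded_comp (fun y => (x * y)%g)).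
exists (L * K) => [|h bh h0 hh x]; first exact: mulr_gt0.
by rewrite mulgA (le_trans (zL _ _ _ _ _))// -mulrA ler_pM2l// yK.
Qed.

End harmonic_functions.

(** * The state on real families and its Poisson transform *)

Section mean_functional.
Context {R : realType} {G : groupType}.
Variables (mu : G -> R) (muP : is_prob_mass mu) (mu_gen : generating mu).
Variables (U : set_system (abel_param R)) (UU : UltraFilter U).
Hypothesis U_to_1 : forall e : R, 0 < e < 2^-1 ->
  U [set a : abel_param R | 1 - e < val a < 1].

Notation fam := (abel_param R -> G -> R).
Implicit Types u v : fam.

Definition bdd2 u := bounded_fct (fun p : abel_param R * G => u p.1 p.2).

Lemma bdd2P u : bdd2 u -> exists2 M : R, 0 < M & forall a x, - M <= u a x <= M.
Proof.
by move=> /bounded_fctP[M M0 uM]; exists M => // a x; exact: (uM (a, x)).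
Qed.

Lemma bdd2_between u (c d : R) : (forall a x, c <= u a x <= d) -> bdd2 u.
Proof. by move=> ucd; apply: (@bounded_between _ _ _ c d) => -[a x]; exact: ucd. Qed.

Lemma bdd2_slice u a : bdd2 u -> bounded_fct (u a).
Proof. by case=> M uM; exists M => x; exact: (uM (a, x)). Qed.

Lemma bdd2_cst (c : R) : bdd2 (fun _ _ => c).
Proof. by exists `|c|. Qed.

Lemma bdd2_add u v : bdd2 u -> bdd2 v -> bdd2 (fun a x => u a x + v a x).
Proof. exact: bounded_add. Qed.

Lemma bdd2_mul u v : bdd2 u -> bdd2 v -> bdd2 (fun a x => u a x * v a x).
Proof. exact: bounded_mul. Qed.

Lemma bdd2_scale (c : R) u : bdd2 u -> bdd2 (fun a x => c * u a x).
Proof. exact: bounded_scale. Qed.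

Lemma bdd2_opp u : bdd2 u -> bdd2 (fun a x => - u a x).
Proof. exact: bounded_opp. Qed.

Lemma bdd2_sqr u : bdd2 u -> bdd2 (fun a x => u a x ^+ 2).
Proof. by move=> bu; under eq_fun do under eq_fun do rewrite expr2; exact: bdd2_mul. Qed.

Lemma bdd2_norm u : bdd2 u -> bdd2 (fun a x => `|u a x|).
Proof. by case=> M uM; exists M => -[a x]; rewrite normr_id; exact: (uM (a, x)). Qed.

Definition translate (g : G) u : fam := fun a x => u a (g * x)%g.

Lemma bdd2_translate g u : bdd2 u -> bdd2 (translate g u).
Proof. by case=> M uM; exists M => -[a x]; exact: (uM (a, (g * x)%g)). Qed.

(** The state restricted to real families; the complex state is recovered from it on real and
    imaginary parts. *)
Definition mean u : R := ulim U (fun a => avg (abel_mean mu (val a)) (u a)).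

Let aP (a : abel_param R) : is_prob_mass (abel_mean mu (val a)).
Proof. by apply: abel_mean_prob => //; exact: abel_param_in. Qed.

Lemma bounded_avg_abel u : bdd2 u ->
  bounded_fct (fun a : abel_param R => avg (abel_mean mu (val a)) (u a)).
Proof.
move=> /bdd2P[M M0 uM]; apply: (@bounded_between _ _ _ (- M) M) => a.
exact: avg_between.
Qed.
Hint Resolve bounded_avg_abel bdd2_slice : core.

Lemma mean_cst (c : R) : mean (fun _ _ => c) = c.
Proof.
by rewrite /mean; under eq_fun do rewrite avg_cst//; rewrite ulim_cst.
Qed.

Lemma meanD u v : bdd2 u -> bdd2 v ->
  mean (fun a x => u a x + v a x) = mean u + mean v.
Proof.
move=> bu bv; rewrite /mean -ulimD; [|exact: bounded_avg_abel..].
by congr ulim; apply/funext => a; rewrite avgD//; exact: bdd2_slice.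
Qed.

Lemma meanZ (c : R) u : bdd2 u -> mean (fun a x => c * u a x) = c * mean u.
Proof.
move=> bu; rewrite /mean -ulimZ; [|exact: bounded_avg_abel..].
by congr ulim; apply/funext => a; rewrite avgZ//; exact: bdd2_slice.
Qed.

Lemma meanN u : bdd2 u -> mean (fun a x => - u a x) = - mean u.
Proof.
move=> bu; rewrite /mean -ulimN; [|exact: bounded_avg_abel..].
by congr ulim; apply/funext => a; rewrite avgN//; exact: bdd2_slice.
Qed.

Lemma meanB u v : bdd2 u -> bdd2 v ->
  mean (fun a x => u a x - v a x) = mean u - mean v.
Proof. by move=> bu bv; rewrite meanD ?meanN//; exact: bdd2_opp. Qed.

Lemma ler_mean u v : bdd2 u -> bdd2 v -> (forall a x, u a x <= v a x) ->
  mean u <= mean v.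
Proof.
move=> bu bv uv; apply: ler_ulim; [exact: bounded_avg_abel..|].
by move=> a; apply: ler_avg => //; exact: bdd2_slice.
Qed.

Lemma mean_between u (c d : R) : (forall a x, c <= u a x <= d) ->
  c <= mean u <= d.
Proof.
by move=> ucd; apply: ulim_between => a; apply: avg_between => // x; exact: ucd.
Qed.

Lemma mean_ge0 u : bdd2 u -> (forall a x, 0 <= u a x) -> 0 <= mean u.
Proof.
by move=> bu u0; rewrite -[leLHS](mean_cst 0) ler_mean//; exact: bdd2_cst.
Qed.

Definition poisson u (x : G) : R := mean (translate x u).

Lemma poisson_between u (c d : R) x : (forall a x, c <= u a x <= d) ->
  c <= poisson u x <= d.
Proof. by move=> ucd; apply: mean_between => a y; exact: ucd. Qed.

Lemma poisson_translate u x y : poisson (translate x u) y = poisson u (x * y)%g.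
Proof.
by congr mean; apply/funext => a; apply/funext => z; rewrite /translate mulgA.
Qed.

Lemma ulim_one_sub (f : abel_param R -> R) : bounded_fct f ->
  ulim U (fun a => (1 - val a) * f a) = 0.
Proof.
move=> bf.
have b1 : bounded_fct (fun a : abel_param R => 1 - val a).
  apply: (@bounded_between _ _ _ 0 1) => a.
  by have /andP[a0 a1] := abel_param_in a; apply/andP; split; lra.
rewrite ulimM// (_ : ulim U (fun a : abel_param R => 1 - val a) = 0) ?mul0r//.
apply/eqP; rewrite eq_le; apply/andP; split; last first.
  apply: ulim_ge0 => // a.
  by have /andP[a0 a1] := abel_param_in a; lra.
apply/ler_addgt0Pr => e e0; rewrite add0r.
(* [U_to_1] only accepts radii below 1/2, hence the cap. *)
pose e' := Num.min e (4^-1).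
have e'0 : 0 < e' by rewrite lt_min e0/=; lra.
have e'1 : e' < 2^-1 by rewrite gt_min; apply/orP; right; lra.
have /U_to_1 Ue : 0 < e' < 2^-1 by rewrite e'0.
suff /andP[_ h] : 0 <= ulim U (fun a : abel_param R => 1 - val a) <= e'.
  by rewrite (le_trans h)// ge_min lexx.
apply: ulim_between_near => //; apply: filterS Ue => a /= /andP[h1 h2].
by apply/andP; split; lra.
Qed.

Lemma poisson_harmonic u : bdd2 u -> harmonic mu (poisson u).
Proof.
move=> bu x; have [M M0 uM] := bdd2P bu.
pose k (a : abel_param R) (y : G) :=
  avg (abel_mean mu (val a)) (fun z => u a (x * y * z)%g).
have kM a y : - M <= k a y <= M by apply: avg_between => // z; exact: uM.
rewrite (_ : avg mu _ = ulim U (fun a => avg mu (k a))); last first.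
  by rewrite -(avg_ulim UU muP kM).
have bk : bounded_fct (fun a : abel_param R => avg mu (k a)).
  by apply: (@bounded_between _ _ _ (- M) M) => a; apply: avg_between.
have bux : bounded_fct (fun a : abel_param R => u a x).
  by apply: (@bounded_between _ _ _ (- M) M) => a.
apply/eqP; rewrite -subr_eq0 -ulimB//; last first.
  exact/bounded_avg_abel/bdd2_translate.
(* By the recursion for mu_a, the defect of harmonicity at level a is 1 - a times a bounded
   quantity. *)
rewrite (_ : (fun a => _) = (fun a : abel_param R =>
   (1 - val a) * (u a x - avg mu (k a)))).
  by rewrite ulim_one_sub//; exact: bounded_sub.
apply/funext => a; rewrite (avg_abel_mean muP (abel_param_in a)); last first.
  exact/bdd2_slice/bdd2_translate.
rewrite /translate mulg1.
rewrite (_ : avg mu _ = avg mu (k a)); first by ring.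
by congr avg; apply/funext => y; congr avg; apply/funext => z; rewrite mulgA.
Qed.

Definition rn (g : G) : fam := fun a x =>
  abel_mean mu (val a) (g^-1 * x)%g / abel_mean mu (val a) x.

Lemma rn_bound (g : G) : exists2 K : R, 0 < K &
  forall (a : abel_param R) x, 0 < rn g a x <= K.
Proof.
have [K K0 gK] := abel_mean_ratio muP mu_gen g.
exists K => // a x; have a0 := abel_mean_gt0 muP mu_gen a.
by rewrite /rn divr_gt0//= ler_pdivrMr ?gK//; exact: a0.
Qed.

(** The density of g at x is the inverse of the density of g^-1 at g^-1 x, which is bounded above.
    The lower bound later makes the classes of the densities invertible. *)
Lemma rn_lower (g : G) : exists2 k : R, 0 < k &
  forall (a : abel_param R) x, k <= rn g a x.
Proof.
have [K K0 gK] := rn_bound g^-1%g; exists K^-1 => [|a x]; first by rewrite invr_gt0.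
have /andP[r0 rK] := gK a (g^-1 * x)%g.
have rE : rn g a x = (rn g^-1 a (g^-1 * x)%g)^-1.
  by rewrite /rn invgK mulVKg invf_div.
by rewrite rE lef_pV2.
Qed.

Lemma bdd2_rn g : bdd2 (rn g).
Proof.
have [K K0 gK] := rn_bound g; apply: (@bdd2_between _ 0 K) => a x.
by have /andP[/ltW -> ->] := gK a x.
Qed.

(** The chain rule for densities of translates, exact at every point; on the boundary it survives
    almost everywhere. *)
Lemma rn_cocycle g h a x : rn h a (g * x)%g * rn g^-1 a x = rn (g^-1 * h) a x.
Proof.
rewrite /rn invgK invgM invgK mulgA.
by rewrite mulrA divfK// gt_eqF// abel_mean_gt0.
Qed.

Lemma rn_id a x : rn 1%g a x = 1.
Proof. by rewrite /rn invg1 mul1g divff// gt_eqF// abel_mean_gt0. Qed.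

Lemma gsum_shift (f : G -> R) (g : G) : gsum (fun x => f (g * x)%g) = gsum f.
Proof.
rewrite /gsum; congr (fine _ - fine _).
  exact: (esum_shift (fun x => (Num.max (f x) 0)%:E) g).
exact: (esum_shift (fun x => (Num.max (- f x) 0)%:E) g).
Qed.

(** The substitution x -> g x. In this way the state sees the values of the Poisson transform away
    from the identity. *)
Lemma mean_rn g u : mean (fun a x => rn g a x * u a x) = poisson u g.
Proof.
congr ulim; apply/funext => a; rewrite /avg -(gsum_shift _ g).
congr gsum; apply/funext => x; rewrite /rn /translate mulKg.
have := abel_mean_gt0 muP mu_gen a (g * x)%g.
by move: (abel_mean _ _ (_ * _)%g) => A A0; field; rewrite gt_eqF.
Qed.

Definition null2 u := mean (fun a x => u a x ^+ 2) = 0.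

Lemma null_mean_norm u : bdd2 u -> null2 u -> mean (fun a x => `|u a x|) = 0.
Proof.
move=> bu nu; apply/eqP; rewrite eq_le; apply/andP; split; last first.
  by apply: mean_ge0 => //; exact: bdd2_norm.
apply/ler_addgt0Pr => e e0; rewrite add0r.
(* The inequality t <= e / 2 + t^2 / (2 e), that is (t - e)^2 >= 0, replaces the Cauchy-Schwarz
   inequality. *)
rewrite (@le_trans _ _ (mean (fun a x => e / 2 + (2 * e)^-1 * u a x ^+ 2)))//.
  apply: ler_mean.
  - exact: bdd2_norm.
  - by apply: bdd2_add; [exact: bdd2_cst|apply: bdd2_scale; exact: bdd2_sqr].
  move=> a x; rewrite -(real_normK (num_real (u a x))).
  move: `|u a x| => t.
  rewrite -subr_ge0 (_ : _ - _ = (2 * e)^-1 * (t - e) ^+ 2); last first.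
    by field; rewrite gt_eqF.
  by rewrite mulr_ge0 ?sqr_ge0// invr_ge0 mulr_ge0// ltW.
rewrite meanD; [|exact: bdd2_cst|by apply: bdd2_scale; exact: bdd2_sqr].
rewrite mean_cst meanZ; last exact: bdd2_sqr.
by rewrite nu mulr0 addr0; lra.
Qed.

Lemma mean_normal u (M : R) : bdd2 u -> `|mean u| <= mean (fun a x => `|u a x|).
Proof.
move=> bu; rewrite ler_norml; apply/andP; split.
  rewrite -meanN; last exact: bdd2_norm.
  apply: ler_mean => //; first by apply: bdd2_opp; exact: bdd2_norm.
  by move=> a x; rewrite lerNl -normrN ler_norm.
by apply: ler_mean => //; [exact: bdd2_norm|move=> a x; exact: ler_norm].
Qed.

Lemma null_mean_mul u v : bdd2 u -> null2 u -> bdd2 v ->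
  mean (fun a x => u a x * v a x) = 0.
Proof.
move=> bu nu bv; have [M M0 vM] := bdd2P bv.
apply/eqP; rewrite -normr_eq0 eq_le normr_ge0 andbT.
rewrite (le_trans (mean_normal 0 _))//; first exact: bdd2_mul.
rewrite (@le_trans _ _ (mean (fun a x => M * `|u a x|)))//.
  apply: ler_mean.
  - by apply: bdd2_norm; exact: bdd2_mul.
  - by apply: bdd2_scale; exact: bdd2_norm.
  - by move=> a x; rewrite normrM mulrC ler_wpM2r// ler_norml.
by rewrite meanZ ?null_mean_norm ?mulr0//; exact: bdd2_norm.
Qed.

Lemma null_mul u v : bdd2 u -> null2 u -> bdd2 v -> null2 (fun a x => u a x * v a x).
Proof.
move=> bu nu bv; rewrite /null2.
under [X in mean X]eq_fun do under eq_fun do rewrite exprMn expr2 -mulrA.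
by apply: null_mean_mul => //; apply: bdd2_mul => //; exact: bdd2_sqr.
Qed.

(** The value at x is a mean weighted by a bounded density, so null families are invisible to the
    whole Poisson transform and not only to the state. *)
Lemma null_poisson u v x : bdd2 u -> null2 u -> bdd2 v ->
  poisson (fun a x => u a x * v a x) x = 0.
Proof.
move=> bu nu bv; rewrite -mean_rn.
under [X in mean X]eq_fun do under eq_fun do rewrite mulrCA.
by apply: null_mean_mul => //; apply: bdd2_mul => //; exact: bdd2_rn.
Qed.

Lemma null_translate g u : bdd2 u -> null2 u -> null2 (translate g u).
Proof.
move=> bu nu; rewrite /null2.
rewrite (_ : mean _ = poisson (fun a x => u a x * u a x) g).
  exact: null_poisson.
by congr mean; apply/funext => a; apply/funext => x; rewrite expr2.
Qed.

Lemma null_add u v : bdd2 u -> bdd2 v -> null2 u -> null2 v ->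
  null2 (fun a x => u a x + v a x).
Proof.
move=> bu bv nu nv; rewrite /null2.
under [X in mean X]eq_fun do under eq_fun do rewrite sqrrD expr2 addrAC -mulrnAr expr2.
rewrite meanD; [|by apply: bdd2_add; apply: bdd2_mul|].
  rewrite meanD; [|exact: bdd2_mul..].
  rewrite !null_mean_mul//; first by rewrite !addr0.
  rewrite (_ : (fun a x => v a x *+ 2) = (fun a x => 2 * v a x)); first exact: bdd2_scale.
  by apply/funext => a; apply/funext => x; rewrite mulr_natl.
apply: bdd2_mul => //.
rewrite (_ : (fun a x => v a x *+ 2) = (fun a x => 2 * v a x)); first exact: bdd2_scale.
by apply/funext => a; apply/funext => x; rewrite mulr_natl.
Qed.

End mean_functional.

(** * The path space and the Poisson representation *)

Section measure_complements.
Context d (T : measurableType d) (R : realType).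
Local Open Scope ereal_scope.

Section density.
Variables (m : {measure set T -> \bar R}) (f : T -> \bar R).
Hypotheses (f0 : forall x, 0 <= f x) (mf : measurable_fun [set: T] f).

(** The proofs are arguments so that the measure structure can be attached to the term itself. *)
Definition density of (forall x, 0 <= f x) & measurable_fun [set: T] f :=
  fun A : set T => \int[m]_(x in A) f x.

Notation dens := (density f0 mf).

Let dens0 : dens set0 = 0. Proof. exact: integral_set0. Qed.

Let dens_ge0 A : 0 <= dens A. Proof. exact: integral_ge0. Qed.

Let dens_sigma_additive : semi_sigma_additive dens.
Proof.
move=> F mF tF mUF; rewrite /density ge0_integral_bigcup//; last first.
  exact: measurable_funTS.
by apply: is_cvg_nneseries => n _ _; exact: integral_ge0.
Qed.

HB.instance Definition _ :=
  isMeasure.Build _ _ _ dens dens0 dens_ge0 dens_sigma_additive.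

End density.

Lemma integral_mrestr (m : {measure set T -> \bar R}) (D : set T)
  (mD : measurable D) (f : T -> \bar R) : measurable_fun [set: T] f ->
  (forall x, 0 <= f x) ->
  \int[mrestr m mD]_(x in [set: T]) f x = \int[m]_(x in D) f x.
Proof.
move=> mf f0; have mDC := measurableC mD.
rewrite -(setUv D) ge0_integral_setU//; [|by rewrite setUv|exact/disj_setPCl].
rewrite [X in _ + X]null_set_integral//; last 2 first.
- exact: measurable_funTS.
- by rewrite /= /mrestr setICl measure0.
rewrite adde0; apply: eq_measure_integral => A mA AD.
by rewrite /= /mrestr setIidl.
Qed.

Section additive_set_function.
Variables (P : probability T R) (lam : set T -> R).
Hypothesis lam_bound : forall A, measurable A -> (0 <= lam A <= fine (P A))%R.
Hypothesis lamU : forall A B, measurable A -> measurable B -> A `&` B = set0 ->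
  (lam (A `|` B) = lam A + lam B)%R.

(** [lam] is controlled on measurable sets only; the truncation makes the set function nonnegative
    everywhere. *)
Let mlam (A : set T) : \bar R := (Num.max (lam A) 0)%:E.

Let mlamE A : measurable A -> mlam A = (lam A)%:E.
Proof. by move=> /lam_bound/andP[l0 _]; rewrite /mlam max_l. Qed.

Let mlam0 : mlam set0 = 0.
Proof.
rewrite mlamE//; have := lam_bound measurable0; rewrite measure0/= => h.
by congr EFin; lra.
Qed.

Let mlam_ge0 A : 0 <= mlam A.
Proof. by rewrite lee_fin le_max lexx orbT. Qed.

Let lam_sum (F : (set T)^nat) n : (forall i, measurable (F i)) ->
  trivIset setT F ->
  (lam (\big[setU/set0]_(i < n) F i) = \sum_(i < n) lam (F i))%R.
Proof.
move=> mF tF; elim: n => [|n IH].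
  by rewrite !big_ord0; have := mlam0; rewrite mlamE// => -[].
rewrite !big_ord_recr/= lamU ?IH//; first exact: bigsetU_measurable.
rewrite -bigcup_mkord; apply/seteqP; split => x // -[[i /= ni Fi] Fn].
have /= := tF i n I I (ex_intro _ x (conj Fi Fn)) => ie.
by rewrite ie ltnn in ni.
Qed.

(** Domination turns finite into countable additivity: [lam] of a tail of the union is at most its
    P-measure, which tends to 0. *)
Let mlam_sigma_additive : semi_sigma_additive mlam.
Proof.
move=> F mF tF mUF.
have PF := @measure_semi_sigma_additive _ _ _ P F mF tF mUF.
have fin A : measurable A -> P A \is a fin_num by exact: fin_num_measure.
pose D n := \bigcup_i F i `\` \big[setU/set0]_(i < n) F i.
have mS n : measurable (\big[setU/set0]_(i < n) F i) by exact: bigsetU_measurable.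
have mD n : measurable (D n) by exact: measurableD.
have SU n : \big[setU/set0]_(i < n) F i `<=` \bigcup_i F i.
  by rewrite -bigcup_mkord => x [i _ Fi]; exists i.
have lamD n : (lam (\bigcup_i F i) = \sum_(i < n) lam (F i) + lam (D n))%R.
  rewrite -lam_sum// -lamU//; first by rewrite setDUK.
  by rewrite setDIK.
have PD n : P (D n) = P (\bigcup_i F i) - \sum_(0 <= i < n) P (F i).
  rewrite measureD//; last by rewrite ltey_eq fin.
  by rewrite setIidr// measure_semi_additive// big_mkord.
have PD0 : (fun n => fine (P (D n))) @ \oo --> (0 : R)%R.
  apply: fine_cvg; rewrite -[X in _ --> X](@subee _ (P (\bigcup_i F i))) ?fin//.
  under eq_fun do rewrite PD.
  by apply: cvgeB; [rewrite fin_num_adde_defr// fin|exact: cvg_cst|].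
rewrite mlamE//.
rewrite (_ : (fun n => _) = EFin \o (fun n => \sum_(0 <= i < n) lam (F i))%R).
  apply: cvg_EFin; first by near=> n.
  apply/cvgrPdist_le => e e0; near=> n.
  rewrite /= (lamD n) big_mkord addrAC subrr add0r.
  have /andP[l0 lP] := lam_bound (mD n).
  rewrite ger0_norm// (le_trans lP)//.
  have : (`|0 - fine (P (D n))| <= e)%R.
    by near: n; move/cvgrPdist_le : PD0; apply.
  by rewrite sub0r normrN; apply: le_trans; exact: ler_norm.
apply/funext => n /=; rewrite -sumEFin.
by apply: eq_bigr => i _; rewrite mlamE.
Unshelve. all: end_near. Qed.

HB.instance Definition _ :=
  isMeasure.Build _ _ _ mlam mlam0 mlam_ge0 mlam_sigma_additive.

Let mlam_le A : measurable A -> mlam A <= P A.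
Proof.
move=> mA; rewrite mlamE//; have /andP[_ h] := lam_bound mA.
by rewrite -[leRHS]fineK ?fin_num_measure// lee_fin.
Qed.

Let mlam_fin : fin_num_fun mlam.
Proof.
move=> A mA; rewrite ge0_fin_numE// (le_lt_trans (mlam_le mA))//.
by rewrite ltey_eq fin_num_measure.
Qed.

HB.instance Definition _ := @Measure_isFinite.Build _ _ _ mlam mlam_fin.

(** The source of the limit of the martingale, of the densities on the boundary and of the
    conditional expectations. The derivative is at most 1 almost everywhere and is truncated, so
    that its bounds hold at every point. *)
Lemma dominated_density : exists f : T -> R,
  [/\ measurable_fun [set: T] f, forall x, (0 <= f x <= 1)%R &
      forall A, measurable A -> (lam A)%:E = \int[P]_(x in A) (f x)%:E].
Proof.
have lamP := mlam_le.
pose M : {finite_measure set T -> \bar R} := mlam.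
have MP : M `<< P.
  apply/null_content_dominatesP => A mA PA.
  by apply/eqP; rewrite eq_le measure_ge0 andbT -PA lamP.
have [g [g0 ig gE]] := radon_nikodym_finite MP.
have mg : measurable_fun setT g := measurable_int _ ig.
have g1 : {ae P, forall x, g x <= 1}.
  have mN : measurable [set x | 1 < g x].
    by rewrite -[X in measurable X]setTI; exact: emeasurable_fun_o_infty.
  have : ae_eq P [set x | 1 < g x] g (cst 1).
    apply: integral_ae_eq => //; first exact: integrableS ig.
    move=> E EN mE; apply/eqP; rewrite eq_le; apply/andP; split.
      by rewrite -gE// integral_cst// mul1e; exact: lamP.
    apply: ge0_le_integral => //; first exact: measurable_funTS.
    by move=> x /EN /ltW.
  apply: filterS => x /= gx; rewrite leNgt; apply/negP => /[dup] /gx ->.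
  by rewrite ltxx.
pose f x := fine (Order.min (g x) 1).
have fE x : (f x)%:E = Order.min (g x) 1.
  rewrite /f fineK// fin_real//; apply/andP; split.
    by rewrite lt_min (lt_le_trans (ltNyr 0) (g0 x)) (ltNyr 1).
  by rewrite gt_min (ltry 1) orbT.
exists f; split.
- apply: measurableT_comp => //.
  exact: measurable_mine.
- move=> x; rewrite -!lee_fin fE le_min g0/= lee_fin ler01/=.
  by rewrite ge_min lexx orbT.
- move=> A mA; rewrite -mlamE// gE//.
  under [RHS]eq_integral do rewrite fE.
  apply: ge0_ae_eq_integral => //.
  + exact: measurable_funTS.
  + by apply: measurable_funTS; exact: measurable_mine.
  + by move=> x _; rewrite le_min g0/= lee_fin ler01.
  + by apply: filterS g1 => x gx _; rewrite min_l.
Qed.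

End additive_set_function.

End measure_complements.

Section image_measure.
Context d d' (T1 : measurableType d) (T2 : measurableType d') (R : realType).
Variables (m : {measure set T1 -> \bar R}) (f : T1 -> T2).

Definition image_measure (mf : measurable_fun [set: T1] f) :
  {measure set T2 -> \bar R} :=
  ltac:(refine (pushforward m f : {measure set T2 -> \bar R}); exact: mf).

Lemma ge0_integral_image mf (h : T2 -> \bar R) :
  measurable_fun [set: T2] h -> (forall y, 0 <= h y)%E ->
  (\int[image_measure mf]_y h y = \int[m]_x h (f x))%E.
Proof. by move=> mh h0; rewrite ge0_integral_pushforward. Qed.

End image_measure.

(** * Cylinders and the Markov property *)

Section path_space.
Context {R : realType} {G : groupType} (countG : countable [set: G]).
Local Notation path := (seq_space G).

Definition cylinder (n : nat) (x : nat -> G) : set path :=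
  [set w | forall i, (i <= n)%N -> w i = x i].

Lemma measurable_coord n (g : G) : measurable [set w : path | w n = g].
Proof. by apply: sub_sigma_algebra; exists (n, g). Qed.

Lemma measurable_cylinder n x : measurable (cylinder n x).
Proof.
rewrite (_ : cylinder n x =
  \bigcap_(i in [set i | (i <= n)%N]) [set w : path | w i = x i]).
  apply: fin_bigcap_measurable => [|i _]; last exact: measurable_coord.
  by apply: (@sub_finite_set _ _ `I_n.+1) => //; exact: finite_II.
by apply/seteqP; split.
Qed.

Lemma measurable_path d (T : measurableType d) (f : T -> path) :
  (forall n g, measurable [set t | f t n = g]) -> measurable_fun setT f.
Proof.
move=> mf; apply: (@measurability _ _ T path setT f (@coordinate_sets G) erefl).
by move=> _ [_ [[n g] _ <-] <-]; rewrite setTI; exact: mf.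
Qed.

Lemma measurable_shift : measurable_fun setT (time_shift : path -> path).
Proof. by apply: measurable_path => n g; exact: (measurable_coord n.+1 g). Qed.

Lemma measurable_left (x : G) : measurable_fun setT (left_translate x : path -> path).
Proof.
apply: measurable_path => n g.
rewrite (_ : [set _ | _] = [set w : path | w n = (x^-1 * g)%g]).
  exact: measurable_coord.
apply/seteqP; split => w /=; rewrite /left_translate.
  by move=> <-; rewrite mulKg.
by move=> ->; rewrite mulVKg.
Qed.

(** Finite words index the cylinders, so that null sets can be collected over them. Integers that
    encode no word are sent to [[::]]. *)
Lemma seq_enumeration : exists e : nat -> seq G, forall s, exists k, e k = s.
Proof.
have /countable_injP[f finj] := countG.
have inj : injective (fun s : seq G => pickle (map f s)).
  move=> s t /(pcan_inj pickleK); apply: inj_map => x y.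
  by apply: finj; rewrite inE.
exists (fun k => if pselect (exists s : seq G, pickle (map f s) = k) is left h
  then projT1 (cid h) else [::]) => s.
exists (pickle (map f s)); case: pselect => [h|]; last by case; exists s.
by case: cid => t /= /inj.
Qed.

(** Together with the empty set, cylinders are stable under intersection and generate the
    sigma-algebra. Testing only indices [n.+1] means that a test cylinder fixes at least two
    coordinates, as needed when a path is compared with its shift. *)
Lemma measure_cylinder_unique (m1 m2 : {measure set path -> \bar R}) :
  (m1 setT < +oo)%E ->
  (forall n x, m1 (cylinder n.+1 x) = m2 (cylinder n.+1 x)) ->
  forall A, measurable A -> m1 A = m2 A.
Proof.
move=> fin1 m12.
pose C : set (set path) := [set A | A = set0 \/ exists n x, A = cylinder n.+1 x].
have [e eP] := seq_enumeration.
pose cyl n k := cylinder n (nth 1%g (e k)).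
have cylP n (w : path) : exists k, cyl n k w /\ nth 1%g (e k) n = w n.
  have [k ek] := eP (map w (iota 0 n.+1)); exists k; rewrite /cyl ek.
  have nthE i : (i <= n)%N -> nth 1%g (map w (iota 0 n.+1)) i = w i.
    by move=> i_n; rewrite (nth_map 0%N) ?size_iota// nth_iota.
  by split; [move=> i i_n; rewrite nthE|rewrite nthE].
have CI : setI_closed C.
  move=> A B [->|[n [x ->]]]; first by rewrite set0I; left.
  move=> [->|[k [y ->]]]; first by rewrite setI0; left.
  wlog nk : n x k y / (n <= k)%N.
    by move=> H; case: (leqP n k) => [|/ltnW] nk; [|rewrite setIC]; exact: H.
  have [xy|xy] := pselect (forall i, (i <= n.+1)%N -> x i = y i).
    right; exists k, y; apply/seteqP; split => [w []//|w wy]; split => // i i_n.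
    by rewrite xy// wy// (leq_trans i_n).
  left; apply/seteqP; split => // w [wx wy]; apply: xy => i i_n.
  by rewrite -wx// wy// (leq_trans i_n).
have Cm : C `<=` measurable.
  by move=> A [->|[n [x ->]]]; [exact: measurable0|exact: measurable_cylinder].
have CS : forall A : set path, measurable A -> <<s C >> A.
  move=> A; apply: smallest_sub; first exact: smallest_sigma_algebra.
  move=> _ [[n g] _ <-] /=.
  rewrite (_ : [set w | _] = \bigcup_k
      (if nth 1%g (e k) n == g then cyl n.+1 k else set0)); last first.
    apply/seteqP; split => [w /= wg|w [k _]].
      have [k [ck _]] := cylP n.+1 w; exists k => //=.
      by rewrite -(ck n)//= wg eqxx.
    by case: eqP => //= <- ck; exact: ck.
  apply: sigma_algebra_bigcup => k; apply: sub_sigma_algebra.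
  by case: eqP => _; [right; exists n, (nth 1%g (e k))|left].
move=> A /CS; apply: (g_sigma_algebra_measure_unique C Cm (cyl 1%N)) => //.
- by move=> k; right; exists 0%N, (nth 1%g (e k)).
- by apply/seteqP; split => // w _; have [k []] := cylP 1%N w; exists k.
- by move=> B [->|[n [x ->]]]; [rewrite !measure0|exact: m12].
- move=> k; rewrite (le_lt_trans _ fin1)// le_measure// inE//.
  exact: measurable_cylinder.
Qed.


Definition path_prob (mu : G -> R) n (x : nat -> G) : R :=
  \prod_(i < n) mu ((x i)^-1 * x i.+1)%g.

Lemma walk_cylinder (theta mu : G -> R) (P : probability path R) n x :
  walk_law theta mu P ->
  P (cylinder n x) = (theta (x 0%N) * path_prob mu n x)%:E.
Proof.
move=> [Q QP PQ]; rewrite PQ; last exact: measurable_cylinder.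
pose y i := if i is j.+1 then ((x j)^-1 * x j.+1)%g else x 0%N.
rewrite -(QP n y); congr (Q _); apply/seteqP; split => s /= sx i.
  elim: i => [|i IH] i_n; first exact: (sx 0%N).
  have := sx _ i_n; rewrite /= (sx i (ltnW i_n)) => <-.
  by rewrite mulKg.
elim: i => [|i IH] i_n; first exact: (sx 0%N).
by rewrite /= IH ?(ltnW i_n)// sx//= mulVKg.
Qed.

Definition iter_shift n (w : path) : path := fun k => w (n + k)%N.

Lemma measurable_iter_shift n : measurable_fun setT (iter_shift n).
Proof. by apply: measurable_path => k g; exact: (measurable_coord (n + k) g). Qed.

Definition join_path n (x y : nat -> G) : nat -> G :=
  fun i => if (i < n)%N then x i else y (i - n)%N.

Lemma path_prob_join mu n m x y : y 0%N = x n ->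
  path_prob mu (n + m) (join_path n x y) = path_prob mu n x * path_prob mu m y.
Proof.
move=> yx; rewrite /path_prob big_split_ord/=; congr (_ * _).
  apply: eq_bigr => i _; rewrite /join_path ltn_ord.
  case: ltnP => // ni; have in1 : i.+1 = n by apply/eqP; rewrite eqn_leq ni ltn_ord.
  by rewrite in1 subnn yx.
apply: eq_bigr => i _; rewrite /join_path.
by rewrite !ltnNge leq_addr/= leqW ?leq_addr//= subSn ?leq_addr// addKn.
Qed.

Lemma path_prob_left mu (g : G) n x :
  path_prob mu n (fun i => (g * x i)%g) = path_prob mu n x.
Proof.
by apply: eq_bigr => i _; rewrite invgM -mulgA mulKg.
Qed.

(** Both sides are finite measures in [D], so cylinders suffice. A cylinder that does not start at
    [x n] has measure 0 on both sides; otherwise the two words are glued at [x n]. *)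
Lemma markov_set (theta mu : G -> R) (P Pe : probability path R) n x (D : set path) :
  walk_law theta mu P -> walk_law (mass_dirac 1%g) mu Pe -> measurable D ->
  (P (cylinder n x `&` iter_shift n @^-1` D) =
   P (cylinder n x) * Pe (left_translate (x n) @^-1` D))%E.
Proof.
move=> PP PeP mD.
have mc := measurable_cylinder n x.
have Pc0 : 0 <= theta (x 0%N) * path_prob mu n x.
  by rewrite -lee_fin -(walk_cylinder _ _ PP) measure_ge0.
pose M1 := image_measure (mrestr P mc) (measurable_iter_shift n).
pose M2 : {measure set path -> \bar R} :=
  mscale (NngNum Pc0) (image_measure Pe (measurable_left (x n))).
have M12 : M1 D = M2 D.
  apply: measure_cylinder_unique => //.
    rewrite /M1 /= /pushforward /mrestr preimage_setT setTI.
    by rewrite (le_lt_trans (probability_le1 _ _))// ltry.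
  move=> m y; rewrite /M1 /M2 /= /pushforward /mscale /mrestr /= /pushforward.
  rewrite (_ : left_translate (x n) @^-1` _ =
      cylinder m.+1 (fun i => (x n)^-1 * y i)%g); last first.
    apply/seteqP; split => w /= wy i im.
      by rewrite -wy// /left_translate mulKg.
    by rewrite /left_translate wy// mulVKg.
  rewrite (walk_cylinder _ _ PeP) path_prob_left /mass_dirac.
  case: eqP => [yx|yx].
    have {}yx : y 0%N = x n by rewrite -[LHS](mulVKg (x n)) yx mulg1.
    rewrite mul1r -EFinM -mulrA -path_prob_join//.
    rewrite (_ : _ `&` _ = cylinder (n + m.+1) (join_path n x y)).
      rewrite (walk_cylinder _ _ PP); congr (_ * _)%:E; congr theta.
      by rewrite /join_path; case: posnP => // n0; rewrite yx n0.
    apply/seteqP; split => w /=.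
      move=> [wy wx] i inm; rewrite /join_path; case: ltnP => ni.
        by rewrite wx// ltnW.
      by rewrite -wy ?/iter_shift ?subnKC// leq_subLR.
    move=> wxy; split => i im.
      rewrite /iter_shift wxy ?leq_add2l// /join_path ltnNge leq_addr/=.
      by rewrite addKn.
    rewrite wxy ?(leq_trans im) ?leq_addr// /join_path; case: ltnP => // ni.
    have -> : i = n by apply/eqP; rewrite eqn_leq im.
    by rewrite subnn.
  rewrite mul0r mule0 (_ : _ `&` _ = set0) ?measure0//.
  apply/seteqP; split => // w /= [wy wx]; apply: yx.
  by rewrite -(wy 0%N)// /iter_shift addn0 wx// mulVg.
move: M12; rewrite /M1 /M2 /= /pushforward /mscale /mrestr /= /pushforward => M12.
by rewrite setIC M12 (walk_cylinder _ _ PP).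
Qed.

End path_space.

(** * Bounded measurable functions on a probability space *)

Section bounded_measurable.
Context d (T : measurableType d) (R : realType) (P : probability T R).
Implicit Types f g : T -> R.

Definition bmf f := measurable_fun [set: T] f /\ bounded_fct f.

Lemma bmf_cst (c : R) : bmf (fun=> c).
Proof. by split; [exact: measurable_cst|exact: bounded_cst]. Qed.

Lemma bmfD f g : bmf f -> bmf g -> bmf (fun x => f x + g x).
Proof.
by move=> [mf bf] [mg bg]; split; [exact: measurable_funD|exact: bounded_add].
Qed.

Lemma bmfM f g : bmf f -> bmf g -> bmf (fun x => f x * g x).
Proof.
by move=> [mf bf] [mg bg]; split; [exact: measurable_funM|exact: bounded_mul].
Qed.

Lemma bmfB f g : bmf f -> bmf g -> bmf (fun x => f x - g x).
Proof.
by move=> [mf bf] [mg bg]; split; [exact: measurable_funB|exact: bounded_sub].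
Qed.

Lemma bmfZ (c : R) f : bmf f -> bmf (fun x => c * f x).
Proof. by move=> ?; apply: bmfM => //; exact: bmf_cst. Qed.

Lemma bmf_indic (A : set T) : measurable A -> bmf (\1_A : T -> R).
Proof.
move=> mA; split; first exact: measurable_indic.
by exists 1 => x; rewrite ger0_norm indicE ?ler0n// lern1 leq_b1.
Qed.

Lemma measurable_EFin f : measurable_fun [set: T] f ->
  measurable_fun [set: T] (EFin \o f).
Proof. by move=> mf; exact/measurable_EFinP. Qed.

Lemma bmf_integrable f D : bmf f -> measurable D ->
  P.-integrable D (EFin \o f).
Proof.
move=> [mf [M fM]] mD; apply: measurable_bounded_integrable => //.
- by rewrite ltey_eq fin_num_measure.
- exact: measurable_funTS.
- exists M; split; first exact: num_real.
  by move=> N MN x _ /=; rewrite (le_trans (fM x))// ltW.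
Qed.

Definition bint f : R := \int[P]_x f x.

Lemma bintE f : bmf f -> ((bint f)%:E = \int[P]_x (f x)%:E)%E.
Proof.
move=> bf; rewrite /bint /Rintegral fineK//.
by apply: integrable_fin_num => //; exact: bmf_integrable.
Qed.

Lemma bint_cst (c : R) : bint (fun=> c) = c.
Proof.
rewrite /bint Rintegral_cst//.
rewrite -[RHS]mulr1; congr (_ * _).
exact: (congr1 fine (probability_setT P)).
Qed.

Lemma bintD f g : bmf f -> bmf g -> bint (fun x => f x + g x) = bint f + bint g.
Proof. by move=> bf bg; apply: RintegralD => //; exact: bmf_integrable. Qed.

Lemma bintB f g : bmf f -> bmf g -> bint (fun x => f x - g x) = bint f - bint g.
Proof. by move=> bf bg; apply: RintegralB => //; exact: bmf_integrable. Qed.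

Lemma bintZ (c : R) f : bmf f -> bint (fun x => c * f x) = c * bint f.
Proof. by move=> bf; apply: RintegralZl => //; exact: bmf_integrable. Qed.

Lemma ler_bint f g : bmf f -> bmf g -> (forall x, f x <= g x) -> bint f <= bint g.
Proof. by move=> bf bg fg; apply: le_Rintegral => //; exact: bmf_integrable. Qed.

Lemma bint_between f (a b : R) : bmf f -> (forall x, a <= f x <= b) ->
  a <= bint f <= b.
Proof.
move=> bf fab; rewrite -{1}(bint_cst a) -{1}(bint_cst b).
by rewrite !ler_bint//; try exact: bmf_cst; move=> x; case/andP: (fab x).
Qed.

Lemma bint_ae f g : bmf f -> bmf g -> {ae P, forall x, f x = g x} ->
  bint f = bint g.
Proof.
move=> [mf _] [mg _] fg; congr fine; apply: ae_eq_integral => //.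
- exact/measurable_EFinP.
- exact/measurable_EFinP.
- by apply: filterS fg => x /= -> _.
Qed.

Lemma bint_indic (A : set T) : measurable A -> bint (\1_A : T -> R) = fine (P A).
Proof. by move=> mA; rewrite /bint /Rintegral integral_indic// setIT. Qed.

Lemma bint_indicM (A : set T) f : measurable A -> bmf f ->
  ((bint (fun x => \1_A x * f x))%:E = \int[P]_(x in A) (f x)%:E)%E.
Proof.
move=> mA bf; rewrite bintE; last by apply: bmfM => //; exact: bmf_indic.
rewrite [RHS]integral_mkcond; apply: eq_integral => x _.
rewrite patchE indicE; case: ifP => _; first by rewrite mul1r.
by rewrite mul0r.
Qed.

Lemma bint_eq_ae f g : bmf f -> bmf g ->
  (forall A, measurable A ->
    bint (fun x => \1_A x * f x) = bint (fun x => \1_A x * g x)) ->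
  {ae P, forall x, f x = g x}.
Proof.
move=> bf bg fg.
have : ae_eq P setT (EFin \o f) (EFin \o g).
  apply: integral_ae_eq => //.
  - exact: bmf_integrable.
  - by apply/measurable_EFinP; case: bg.
  - by move=> A _ mA; rewrite -!bint_indicM// fg.
by apply: filterS => x /= /(_ I) [].
Qed.

Lemma bint_pos_null f (A : set T) : measurable A -> bmf f ->
  (forall x, A x -> 0 < f x) -> bint (fun x => \1_A x * f x) = 0 -> P A = 0%E.
Proof.
move=> mA bf f0 int0.
have mf : measurable_fun A (EFin \o f).
  by apply/measurable_EFinP/measurable_funTS; case: bf.
have : (\int[P]_(x in A) `|(EFin \o f) x|)%E = 0%E.
  rewrite -[RHS]/(0%:E) -int0 bint_indicM//.
  by apply: eq_integral => x /[!inE] /f0 fx; rewrite /= ger0_norm// ltW.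
move/(ae_eq_integral_abs P mA mf) => h.
apply/negligibleP => //; apply: negligibleS h => x Ax /= /(_ Ax) [] fx.
by have := f0 x Ax; rewrite fx ltxx.
Qed.

Lemma ae_imp (Q Q' : T -> Prop) : {ae P, forall x, Q x} ->
  (forall x, Q x -> Q' x) -> {ae P, forall x, Q' x}.
Proof. by move=> aQ QQ'; apply: filterS aQ. Qed.

Lemma ae_imp2 (Q1 Q2 Q' : T -> Prop) :
  {ae P, forall x, Q1 x} -> {ae P, forall x, Q2 x} ->
  (forall x, Q1 x -> Q2 x -> Q' x) -> {ae P, forall x, Q' x}.
Proof. by move=> aQ1 aQ2 QQ'; apply: filterS2 aQ1 aQ2. Qed.

Lemma ae_prob_ex (Q : T -> Prop) : {ae P, forall x, Q x} -> exists x, Q x.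
Proof.
move=> PQ; apply: contrapT => nQ; have : P.-negligible setT.
  by apply: negligibleS PQ => x _ Qx; apply: nQ; exists x.
move/(measure_negligible measurableT) => PT.
by have := probability_setT P; rewrite PT => /esym/eqP; rewrite onee_eq0.
Qed.

End bounded_measurable.

Section countable_partition.
Context d (T : measurableType d) (R : realType) (m : {measure set T -> \bar R}).

Lemma measure_countable_partition (I : choiceType) (A : I -> set T) :
  countable [set: I] -> (forall i, measurable (A i)) ->
  (forall i j, i <> j -> A i `&` A j = set0) ->
  (m (\bigcup_i A i) = \esum_(i in [set: I]) m (A i))%E.
Proof.
move=> /countable_injP[f finj] mA dA.
have inj i j : f i = f j -> i = j by apply: finj; rewrite inE.
pose F n := \bigcup_(i in [set i | f i = n]) A i.
have FE i : F (f i) = A i.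
  apply/seteqP; split => [x [j /= /inj ->]//|x Ax]; by exists i.
have F0 n : ~ (range f) n -> F n = set0.
  by move=> fn; apply/seteqP; split => // x [i /= fi]; case: fn; exists i.
have mF n : measurable (F n).
  have [[i _ <-]|/F0 ->//] := pselect (range f n); by rewrite FE.
have tF : trivIset setT F.
  apply/trivIsetP => n k _ _ nk.
  have [[i _ fi]|/F0 ->] := pselect (range f n); last by rewrite set0I.
  have [[j _ fj]|/F0 ->] := pselect (range f k); last by rewrite setI0.
  rewrite -fi -fj !FE; apply: dA => ij; move/eqP: nk; apply.
  by rewrite -fi -fj ij.
have -> : \bigcup_i A i = \bigcup_n F n.
  apply/seteqP; split => [x [i _ Ax]|x [n _ [i _ Ax]]]; last by exists i.
  by exists (f i) => //; exists i.
rewrite measure_bigcup// nneseries_esum//.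
rewrite (_ : [set x | x \in [set: nat]] = setT); last first.
  by apply/seteqP; split => // n _ /=; rewrite inE.
rewrite (esumID (range f))// setTI [X in (_ + X)%E]esum1 ?adde0; last first.
  by move=> n [_ /F0 ->]; rewrite measure0.
rewrite (esum_image setT f)//.
by apply: eq_esum => i _; rewrite FE.
Qed.

End countable_partition.

(** * First step decomposition and null sets of the walk *)

Section walk.
Context {R : realType} {G : groupType} (countG : countable [set: G]).
Local Notation path := (seq_space G).
Variables (mu : G -> R) (Pe : probability path R).
Hypothesis PeP : walk_law (mass_dirac 1%g) mu Pe.
Local Open Scope ereal_scope.

Lemma markov_int (theta : G -> R) (P : probability path R) n x (F : path -> \bar R) :
  walk_law theta mu P -> measurable_fun setT F -> (forall w, 0 <= F w) ->
  \int[P]_(w in cylinder n x) F (iter_shift n w) =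
  P (cylinder n x) * \int[Pe]_w F (left_translate (x n) w).
Proof.
move=> PP mF F0; have mc := measurable_cylinder n x.
have Pc : P (cylinder n x) = (fine (P (cylinder n x)))%:E.
  by rewrite fineK// fin_num_measure.
have Pc0 : (0 <= fine (P (cylinder n x)))%R by rewrite fine_ge0.
pose M1 := image_measure (mrestr P mc) (measurable_iter_shift n).
pose M2 : {measure set path -> \bar R} :=
  mscale (NngNum Pc0) (image_measure Pe (measurable_left (x n))).
rewrite -(integral_mrestr P mc); last 2 first.
- exact: (measurableT_comp mF (measurable_iter_shift n)).
- by move=> w; exact: F0.
rewrite -(ge0_integral_image (mrestr P mc) (measurable_iter_shift n))//.
rewrite (eq_measure_integral M2); last first.
  move=> A mA _; rewrite /M2 /= /pushforward /mscale /mrestr /= /pushforward -Pc.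
  by rewrite setIC; exact: (markov_set countG n x PP PeP mA).
rewrite ge0_integral_mscale// /= -Pc.
by rewrite -(ge0_integral_image Pe (measurable_left (x n))).
Qed.

Lemma walk_start : Pe (cylinder 0 (fun=> 1%g)) = 1.
Proof.
by rewrite (walk_cylinder _ _ PeP) /path_prob big_ord0 mulr1 /mass_dirac eqxx.
Qed.

(** The walk starts at the identity almost surely; its starting cylinder is partitioned by the first
    step, and the Markov property applies to each piece. *)
Lemma first_step (F : path -> \bar R) : measurable_fun setT F ->
  (forall w, 0 <= F w) ->
  \int[Pe]_w F (time_shift w) =
  \esum_(y in [set: G]) ((mu y)%:E * \int[Pe]_w F (left_translate y w)).
Proof.
move=> mF F0.
have mFs : measurable_fun setT (fun w : path => F (time_shift w)).
  exact: (measurableT_comp mF measurable_shift).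
pose D : {measure set path -> \bar R} := density Pe (fun w : path => F0 (time_shift w)) mFs.
pose x (y : G) (i : nat) : G := if i is 0 then 1%g else y.
pose C := cylinder 0 (fun=> 1%g : G).
have mC : measurable C := measurable_cylinder _ _.
have -> : \int[Pe]_w F (time_shift w) = D C.
  rewrite /D /= /density -(setUv C) ge0_integral_setU//; last 3 first.
  - exact: measurableC.
  - by rewrite setUv.
  - exact/disj_setPCl.
  rewrite [X in _ + X]null_set_integral ?adde0//.
  - exact: measurableC.
  - exact: measurable_funTS.
  - transitivity (1 - Pe C); last by rewrite walk_start subee.
    exact: probability_setC.
have -> : C = \bigcup_y cylinder 1 (x y).
  apply/seteqP; split => [w wC|w [y _ wy] i].
    exists (w 1%N) => // -[_|[_|//]] //=; exact: wC.
  by rewrite leqn0 => /eqP ->; exact: (wy 0%N).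
rewrite measure_countable_partition//; last 2 first.
- by move=> y; exact: measurable_cylinder.
- move=> y z yz; apply/seteqP; split => // w [wy wz]; apply: yz.
  by rewrite -[LHS](wy 1%N)// -[RHS](wz 1%N).
apply: eq_esum => y _; rewrite /D /= /density.
rewrite [LHS](markov_int 1 (x y) PeP mF F0); congr (_ * _).
rewrite (walk_cylinder _ _ PeP) /path_prob big_ord_recl big_ord0 /=.
by rewrite /mass_dirac eqxx mul1r mulr1 invg1 mul1g.
Qed.

(** As [theta] charges g, a P-null set is also null for the walk started at g, which is the walk
    from the identity translated by g. *)
Lemma ae_left (theta : G -> R) (P : probability path R) (Q : path -> Prop) g :
  (0 < theta g)%R -> walk_law theta mu P -> {ae P, forall w, Q w} ->
  {ae Pe, forall w, Q (left_translate g w)}.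
Proof.
move=> th PP [N [mN PN QN]]; exists (left_translate g @^-1` N); split.
- by rewrite -[X in measurable X]setTI; exact: measurable_left.
- have := markov_set countG 0 (fun=> g) PP PeP mN.
  rewrite (walk_cylinder _ _ PP) /path_prob big_ord0 mulr1.
  rewrite [LHS](@subset_measure0 _ _ _ P _ N)//; last first.
    apply: measurableI; first exact: measurable_cylinder.
    by rewrite -[X in measurable X]setTI; exact: measurable_iter_shift.
  move/esym/eqP; rewrite mule_eq0 eqe gt_eqF//= => /eqP.
  by [].
- by move=> w /=; exact: QN.
Qed.

(** The shift need not preserve P, but it preserves null sets: on each of the countably many
    cylinders, the shifted path is a translate of the walk from the identity, and [theta] charges
    every starting point. *)
Lemma ae_iter_shift (theta : G -> R) (P : probability path R) (Q : path -> Prop) n :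
  (forall g, 0 < theta g)%R -> walk_law theta mu P -> {ae P, forall w, Q w} ->
  {ae P, forall w, Q (iter_shift n w)}.
Proof.
move=> th PP aQ.
have [e eP] := seq_enumeration countG.
have [N [mN PN QN]] := aQ.
have mS : measurable (iter_shift n @^-1` N).
  by rewrite -[X in measurable X]setTI; exact: measurable_iter_shift.
suff : P.-negligible (iter_shift n @^-1` N).
  by apply: negligibleS => w; exact: QN.
have -> : iter_shift n @^-1` N =
    \bigcup_k (cylinder n (nth 1%g (e k)) `&` iter_shift n @^-1` N).
  apply/seteqP; split => [w wN|w [k _ []]//].
  have [k ek] := eP (map w (iota 0 n.+1)); exists k => //; split => // i i_n.
  by rewrite ek (nth_map 0%N) ?size_iota// nth_iota.
apply: negligible_bigcup => k; apply/negligibleP.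
  by apply: measurableI => //; exact: measurable_cylinder.
rewrite [LHS](markov_set countG n (nth 1%g (e k)) PP PeP mN).
set g := nth _ _ n.
suff -> : Pe (left_translate g @^-1` N) = 0 by rewrite mule0.
apply/negligibleP.
  by rewrite -[X in measurable X]setTI; exact: measurable_left.
have nN : {ae P, forall w, ~ N w}.
  by apply/negligibleP; rewrite ?setCK//; exact: measurableC.
by apply: negligibleS (ae_left (th g) PP nN) => w Nw /=; exact.
Qed.

End walk.

(** * The Poisson representation of bounded harmonic functions *)

Section boundary.
Context {R : realType} {G : groupType} (countG : countable [set: G]).
Local Notation path := (seq_space G).
Variables (mu : G -> R) (muP : is_prob_mass mu) (mu_gen : generating mu).
Variables (theta : G -> R) (P Pe : probability path R).
Hypotheses (th0 : forall x, 0 < theta x) (PP : walk_law theta mu P).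
Hypothesis PeP : walk_law (mass_dirac 1%g) mu Pe.
Context d (B : measurableType d) (nu : probability B R) (act : G -> B -> B).
Variable bnd : path -> B.
Hypotheses (mact : measurable_action act) (mbnd : measurable_fun setT bnd).
Hypothesis bnd_shift : {ae P, forall w, bnd (time_shift w) = bnd w}.
Hypothesis bnd_inv : forall A : set path, measurable A ->
  [set w | A (time_shift w)] = A ->
  exists2 C : set B, measurable C & {ae P, forall w, A w <-> C (bnd w)}.
Hypothesis bnd_act : forall g, {ae P, forall w,
  bnd (left_translate g w) = act g (bnd w)}.
Hypothesis nuE : forall C : set B, measurable C -> nu C = Pe (bnd @^-1` C).

Let mact1 g : measurable_fun setT (act g). Proof. by case: mact. Qed.

Let actM g h b : act (g * h)%g b = act g (act h b). Proof. by case: mact => -[]. Qed.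
Let act1 b : act 1%g b = b. Proof. by case: mact => -[]. Qed.

Lemma left_id : left_translate (1%g : G) = id.
Proof. by apply/funext => w; apply/funext => n; rewrite /left_translate mul1g. Qed.

Lemma ae_Pe (Q : path -> Prop) : {ae P, forall w, Q w} -> {ae Pe, forall w, Q w}.
Proof.
move=> aQ; have := ae_left countG PeP (th0 1%g) PP aQ.
by move/ae_imp; apply => w; rewrite left_id.
Qed.

Lemma integral_nu (f : B -> \bar R) : measurable_fun setT f -> (forall b, 0 <= f b)%E ->
  (\int[nu]_b f b = \int[Pe]_w f (bnd w))%E.
Proof.
move=> mf f0; rewrite -(ge0_integral_image Pe mbnd)//.
by apply: eq_measure_integral => A mA _; rewrite /= nuE.
Qed.

Lemma integral_nu_act g (f : B -> \bar R) : measurable_fun setT f ->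
  (forall b, 0 <= f b)%E ->
  (\int[nu]_b f (act g b) = \int[Pe]_w f (bnd (left_translate g w)))%E.
Proof.
move=> mf f0; rewrite integral_nu//; last exact: (measurableT_comp mf (mact1 g)).
apply: ae_eq_integral => //.
- exact: (measurableT_comp mf (measurableT_comp (mact1 g) mbnd)).
- exact: (measurableT_comp mf (measurableT_comp mbnd (measurable_left g))).
by apply: (ae_imp (ae_Pe (bnd_act g))) => w /= -> _.
Qed.

Lemma bnd_iter_shift n : {ae P, forall w, bnd (iter_shift n w) = bnd w}.
Proof.
elim: n => [|n IH]; first by apply: aeW => w.
have := ae_iter_shift countG PeP n th0 PP bnd_shift.
move=> h; apply: (ae_imp2 IH h) => w {}IH /= {}h.
rewrite -IH -h; congr bnd; apply/funext => k.
by rewrite /iter_shift /time_shift addnS addSn.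
Qed.

(** The boundary point is unchanged when the first n steps are forgotten, so a cylinder influences
    it only through its endpoint. *)
Lemma integral_cylinder n x (f : B -> \bar R) : measurable_fun setT f ->
  (forall b, 0 <= f b)%E ->
  (\int[P]_(w in cylinder n x) f (bnd w) =
   P (cylinder n x) * \int[nu]_b f (act (x n) b))%E.
Proof.
move=> mf f0; have mc := measurable_cylinder n x.
have mfb : measurable_fun setT (f \o bnd) := measurableT_comp mf mbnd.
rewrite integral_nu_act//.
have f0' w : (0 <= (f \o bnd) w)%E by exact: f0.
rewrite -(markov_int countG PeP n x PP mfb f0').
apply: ae_eq_integral => //.
- exact: measurable_funTS.
- apply: measurable_funTS.
  exact: (measurableT_comp mfb (measurable_iter_shift n)).
by apply: (ae_imp (bnd_iter_shift n)) => w /= -> _.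
Qed.

Lemma ae_nu_of_P (Q : B -> Prop) : measurable [set b | Q b] ->
  {ae P, forall w, Q (bnd w)} -> {ae nu, forall b, Q b}.
Proof.
move=> mQ /ae_Pe aQ; apply/negligibleP; first exact: measurableC.
apply: (etrans (nuE (measurableC mQ))).
apply/negligibleP => //.
by rewrite -[X in measurable X]setTI; apply: mbnd => //; exact: measurableC.
Qed.

Definition pint (f : B -> R) (x : G) : R := bint nu (fun b => f (act x b)).

Lemma bmf_act (f : B -> R) x : bmf f -> bmf (fun b => f (act x b)).
Proof.
move=> [mf bf]; split; first exact: (measurableT_comp mf (mact1 x)).
exact: bounded_comp.
Qed.

(** The Poisson integrals determine the integrals of f o bnd over all cylinders, hence f o bnd up to
    P-null sets, hence f up to nu-null sets. *)
Lemma pint_unique_ge0 (f g : B -> R) : bmf f -> bmf g ->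
  (forall b, 0 <= f b) -> (forall b, 0 <= g b) ->
  (forall x, pint f x = pint g x) -> {ae nu, forall b, f b = g b}.
Proof.
move=> bf bg f0 g0 fg; have [mf _] := bf; have [mg _] := bg.
have mE (k : B -> R) : measurable_fun setT k -> measurable_fun setT (fun w => (k (bnd w))%:E).
  by move=> mk; apply/measurable_EFinP; exact: (measurableT_comp mk mbnd).
have f0' w : (0 <= (f (bnd w))%:E)%E by rewrite lee_fin.
have g0' w : (0 <= (g (bnd w))%:E)%E by rewrite lee_fin.
pose M1 : {measure set path -> \bar R} := density P f0' (mE _ mf).
pose M2 : {measure set path -> \bar R} := density P g0' (mE _ mg).
have bfb : bmf (f \o bnd).
  by split; [exact: (measurableT_comp mf mbnd)|case: bf => _; exact: bounded_comp].
have M12 A : measurable A -> M1 A = M2 A.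
  apply: measure_cylinder_unique => //.
    rewrite /M1 /= /density -(bintE P bfb); exact: ltry.
  move=> n x; rewrite /M1 /M2 /= /density.
  rewrite (integral_cylinder n.+1 x (f := EFin \o f))//; [|exact/measurable_EFinP].
  rewrite (integral_cylinder n.+1 x (f := EFin \o g))//; [|exact/measurable_EFinP].
  have := congr1 EFin (fg (x n.+1)); rewrite /pint (bintE nu (bmf_act _ bf)).
  by rewrite (bintE nu (bmf_act _ bg)) => /= ->.
apply: ae_nu_of_P.
  rewrite (_ : [set _ | _] = (fun b => f b - g b) @^-1` [set 0]).
    by rewrite -[X in measurable X]setTI; apply: measurable_funB.
  by apply/seteqP; split => b /=; [move=> ->; rewrite subrr|move/eqP; rewrite subr_eq0 => /eqP].
have : ae_eq P setT (fun w => (f (bnd w))%:E) (fun w => (g (bnd w))%:E).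
  apply: integral_ae_eq => //.
  - exact: (bmf_integrable P bfb).
  - exact: (mE _ mg).
  - by move=> A _ mA; exact: M12.
by move/ae_imp; apply => w /= /(_ I) [].
Qed.

Lemma pint_unique (f g : B -> R) : bmf f -> bmf g ->
  (forall x, pint f x = pint g x) -> {ae nu, forall b, f b = g b}.
Proof.
move=> bf bg fg.
have [M M0 fM] := bounded_fctP (proj2 bf); have [N N0 gN] := bounded_fctP (proj2 bg).
have : {ae nu, forall b, f b + (M + N) = g b + (M + N)}.
  apply: (@pint_unique_ge0 (fun b => f b + (M + N)) (fun b => g b + (M + N))).
  - by apply: bmfD => //; exact: bmf_cst.
  - by apply: bmfD => //; exact: bmf_cst.
  - by move=> b; have := fM b; lra.
  - by move=> b; have := gN b; lra.
  - move=> x; rewrite /pint !bintD ?bint_cst//; try exact: bmf_cst.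
    + by congr (_ + _); exact: fg.
    + exact: bmf_act.
    + exact: bmf_act.
by move/ae_imp; apply => b /addIr.
Qed.

(** Dropping the first step of the path from x does not move its boundary point; conditioning on
    that step produces the mean over [mu]. *)
Lemma pint_harmonic (f : B -> R) : bmf f -> (forall b, 0 <= f b) ->
  harmonic mu (pint f).
Proof.
move=> bf f0 x; have [mf bdf] := bf; have [M M0 fM] := bounded_fctP bdf.
have bpf : bounded_fct (fun y => pint f (x * y)%g).
  apply: (@bounded_between _ _ _ (- M) M) => y.
  by apply: bint_between; [exact: bmf_act|move=> b; exact: fM].
have mE : measurable_fun setT (EFin \o f) by exact/measurable_EFinP.
have fE0 b : (0 <= (EFin \o f) b)%E by rewrite lee_fin.
have pE y : (pint f y)%:E = (\int[Pe]_w (f (bnd (left_translate y w)))%:E)%E.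
  rewrite /pint bintE; last exact: bmf_act.
  exact: (integral_nu_act y mE fE0).
apply: EFin_inj; rewrite avg_ge0E//; last first.
  by move=> y; rewrite -lee_fin pE integral_ge0// => w _; rewrite lee_fin.
rewrite pE.
pose F (w : path) := (f (bnd (left_translate x w)))%:E.
have mF : measurable_fun setT F.
  apply/measurable_EFinP.
  exact: (measurableT_comp mf (measurableT_comp mbnd (measurable_left x))).
rewrite (_ : \int[Pe]_w _ = \int[Pe]_w F (time_shift w))%E.
  rewrite (first_step countG PeP)//; last by move=> w; rewrite lee_fin.
  apply: eq_esum => y _; rewrite EFinM pE muleC; congr (_ * _)%E.
  apply: eq_integral => w _; rewrite /F; congr (f (bnd _))%:E.
  by apply/funext => n; rewrite /left_translate mulgA.
apply: ae_eq_integral => //.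
  exact: (measurableT_comp mF measurable_shift).
have := ae_left countG PeP (th0 x) PP bnd_shift.
by move/ae_imp; apply => w /= h _; rewrite /F -h.
Qed.

Lemma harmonic_walk (h : G -> R) k g : bounded_fct h -> (forall x, 0 <= h x) ->
  harmonic mu h -> (\int[Pe]_w (h (g * w k)%g)%:E = (h g)%:E)%E.
Proof.
move=> bh h0 hh.
have mk i x : measurable_fun setT (fun w : path => (h (x * w i)%g)%:E).
  apply/measurable_EFinP => _ Y mY; rewrite setTI.
  rewrite (_ : _ @^-1` Y = \bigcup_(y in [set y | Y (h (x * y)%g)])
    [set w : path | w i = y]); last first.
    by apply/seteqP; split => [w Yw|w [y /= Yy ->//]]; exists (w i).
  rewrite bigcup_mkcond; apply: countable_bigcupT_measurable => // y.
  by case: ifP => _; [exact: measurable_coord|exact: measurable0].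
elim: k g => [|k IH] g.
  have m1 : Pe (cylinder 0 (fun=> 1%g)) = 1%E := walk_start PeP.
  rewrite (_ : \int[Pe]_w _ = \int[Pe]_w (h g)%:E)%E.
    by rewrite -(bintE Pe (bmf_cst _ (h g))) bint_cst.
  apply: ae_eq_integral => //.
  exists (~` cylinder 0 (fun=> 1%g)); split.
  - by apply: measurableC; exact: measurable_cylinder.
  - transitivity (1 - Pe (cylinder 0 (fun=> 1%g)))%E; last by rewrite m1 subee.
    by apply: probability_setC; exact: measurable_cylinder.
  - move=> w /= nh wc; apply: nh => _.
    by rewrite (wc 0%N)// mulg1.
rewrite (first_step countG PeP (F := fun w => (h (g * w k)%g)%:E))//; last first.
  by move=> w; rewrite lee_fin.
rewrite hh avg_ge0E//; last exact: (bounded_comp (fun y => (g * y)%g)).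
apply: eq_esum => y _; rewrite EFinM muleC; congr (_ * _)%E.
rewrite -IH; apply: eq_integral => w _.
by rewrite /left_translate mulgA.
Qed.

Section existence.
Variable h : G -> R.
Hypotheses (h01 : forall x, 0 <= h x <= 1) (hh : harmonic mu h).

Let h0 x : 0 <= h x. Proof. by case/andP: (h01 x). Qed.
Let bh : bounded_fct h. Proof. exact: bounded_between h01. Qed.

Lemma measurable_coord_fun (k : G -> R) n :
  measurable_fun setT (fun w : path => k (w n)).
Proof.
move=> _ Y mY; rewrite setTI.
rewrite (_ : _ @^-1` Y = \bigcup_(y in [set y | Y (k y)])
  [set w : path | w n = y]); last first.
  by apply/seteqP; split => [w Yw|w [y /= Yy ->//]]; exists (w n).
rewrite bigcup_mkcond; apply: countable_bigcupT_measurable => // y.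
by case: ifP => _; [exact: measurable_coord|exact: measurable0].
Qed.

Lemma bmf_coord n : bmf (fun w : path => h (w n)).
Proof.
by split; [exact: measurable_coord_fun|exact: (bounded_comp (fun w : path => w n))].
Qed.

Lemma harmonic_cylinder n m x : (n <= m)%N ->
  (\int[P]_(w in cylinder n x) (h (w m))%:E = P (cylinder n x) * (h (x n))%:E)%E.
Proof.
move=> nm; pose F (w : path) := (h (w (m - n)%N))%:E.
have mF : measurable_fun setT F by apply/measurable_EFinP; exact: measurable_coord_fun.
have F0 w : (0 <= F w)%E by rewrite lee_fin.
rewrite -(harmonic_walk (m - n)%N (x n) bh h0 hh).
rewrite -(markov_int countG PeP n x PP mF F0); apply: eq_integral => w _.
by rewrite /F /iter_shift subnKC.
Qed.

(* A free ultralimit of the measures with densities [h (w n)] replaces the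
   martingale convergence theorem. *)
Lemma martingale_limit : exists L : path -> R,
  [/\ measurable_fun setT L, forall w, 0 <= L w <= 1 &
      forall n x, (\int[P]_(w in cylinder n x) (L w)%:E =
        P (cylinder n x) * (h (x n))%:E)%E].
Proof.
have [N [NU Noo]] := @ultraFilterLemma nat \oo _.
pose f (A : set path) (n : nat) := bint P (fun w => \1_A w * h (w n)).
have bA A n : measurable A -> bmf (fun w : path => \1_A w * h (w n)).
  by move=> mA; apply: bmfM; [exact: bmf_indic|exact: bmf_coord].
have fb A n : measurable A -> 0 <= f A n <= fine (P A).
  move=> mA; rewrite -(bint_indic P mA); apply/andP; split.
    rewrite -[leLHS](bint_cst P 0); apply: ler_bint; [exact: bmf_cst|exact: bA|].
    by move=> w; rewrite mulr_ge0// indicE ler0n.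
  apply: ler_bint; [exact: bA|exact: bmf_indic|].
  move=> w; rewrite -[leRHS]mulr1 ler_wpM2l// ?indicE ?ler0n//.
  by case/andP: (h01 (w n)).
have fbd A : measurable A -> bounded_fct (f A).
  by move=> mA; apply: (@bounded_between _ _ _ 0 (fine (P A))) => n; exact: fb.
pose lam A := ulim N (f A).
have lam_bound A : measurable A -> 0 <= lam A <= fine (P A).
  by move=> mA; apply: ulim_between => n; exact: fb.
have lamU A C : measurable A -> measurable C -> A `&` C = set0 ->
    lam (A `|` C) = lam A + lam C.
  move=> mA mC AC; rewrite /lam -ulimD; [|exact: fbd|exact: fbd].
  congr ulim; apply/funext => n; rewrite /f -bintD; [|exact: bA|exact: bA].
  congr bint; apply/funext => w; rewrite -mulrDl; congr (_ * _).
  rewrite !indicE in_setU; have [wA|_] := boolP (w \in A) => /=; last by rewrite add0r.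
  have [wC|_] := boolP (w \in C); last by rewrite addr0.
  by have : (A `&` C) w by [rewrite !inE in wA wC; split]; rewrite AC.
have [L [mL L01 LE]] := dominated_density lam_bound lamU.
exists L; split => // n x; have mc := measurable_cylinder n x.
rewrite -LE// /lam (@ulim_near_eq _ _ _ _ _ (fun=> fine (P (cylinder n x)) * h (x n))).
  by rewrite ulim_cst EFinM fineK// fin_num_measure.
(* By harmonicity the integral over a cylinder of depth n is constant from index n on, and the
   ultrafilter is free. *)
apply: Noo; exists n => // m /= nm.
apply: EFin_inj; rewrite /f bint_indicM//; last exact: bmf_coord.
by rewrite harmonic_cylinder// EFinM fineK// fin_num_measure.
Qed.

(** [bnd_inv] concerns strictly invariant events, whereas the events to which it will be applied are
    invariant only almost everywhere. *)
Lemma invariant_event (A : set path) : measurable A ->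
  {ae P, forall w, A (time_shift w) <-> A w} ->
  exists2 C : set B, measurable C & {ae P, forall w, A w <-> C (bnd w)}.
Proof.
move=> mA Ainv.
have Ainv_n n : {ae P, forall w, A (iter_shift n w) <-> A w}.
  elim: n => [|n IH]; first by apply: aeW.
  have As := ae_iter_shift countG PeP n th0 PP Ainv.
  apply: (ae_imp2 IH As) => w {}IH {}As; rewrite -IH -As.
  suff -> : iter_shift n.+1 w = time_shift (iter_shift n w) by [].
  by apply/funext => k; rewrite /iter_shift /time_shift addnS addSn.
(* limsup of the shifts of [A]: strictly invariant, and a.e. equal to [A] *)
pose A' := \bigcap_k \bigcup_(n in [set n | (k <= n)%N]) (iter_shift n @^-1` A).
have mA' : measurable A'.
  apply: bigcapT_measurable => k; apply: bigcup_measurable => n _.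
  by rewrite -[X in measurable X]setTI; exact: measurable_iter_shift.
have A'inv : [set w | A' (time_shift w)] = A'.
  apply/seteqP; split => w /= wA k _.
    have [n /= kn An] := wA k I; exists n.+1; [exact: leqW|exact: An].
  have [[//|n] /= kn An] := wA k.+1 I; by exists n.
have [C mC A'C] := bnd_inv mA' A'inv; exists C => //.
have AA : {ae P, forall w, forall n, A (iter_shift n w) <-> A w}.
  exact: ae_foralln.
apply: (ae_imp2 A'C AA) => w <- {}AA; split => [Aw k _|wA'].
  by exists k; [exact: leqnn|exact/AA].
by have [n _ /AA] := wA' 0%N I.
Qed.

(** The densities L and L o shift are compared on cylinders. The Markov property at time 1 expresses
    the mass of the second by an integral for the walk from [x 1]; at time 0 the same integral is
    computed from the known masses of L. *)
Lemma limit_invariant (L : path -> R) : measurable_fun setT L ->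
  (forall w, 0 <= L w <= 1) ->
  (forall n x, (\int[P]_(w in cylinder n x) (L w)%:E =
     P (cylinder n x) * (h (x n))%:E)%E) ->
  {ae P, forall w, L (time_shift w) = L w}.
Proof.
move=> mL L01 LE.
have bL : bmf L by split => //; exact: bounded_between L01.
have bLs : bmf (fun w : path => L (time_shift w)).
  split; first exact: (measurableT_comp mL measurable_shift).
  exact: (bounded_comp (time_shift : path -> path) (proj2 bL)).
have L0 w : (0 <= (L w)%:E)%E by rewrite lee_fin; case/andP: (L01 w).
have Ls0 (w : path) : (0 <= (L (time_shift w))%:E)%E by exact: L0.
pose M1 : {measure set path -> \bar R} := density P Ls0 (measurable_EFin (proj1 bLs)).
pose M2 : {measure set path -> \bar R} := density P L0 (measurable_EFin mL).
have M12 A : measurable A -> M1 A = M2 A.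
  apply: measure_cylinder_unique => //.
    by rewrite /M1 /= /density -(bintE P bLs) ltry.
  move=> n x; rewrite /M1 /M2 /= /density LE.
  pose y i := x i.+1.
  have mc := measurable_cylinder.
  pose F (w : path) := \1_(cylinder n y) w * L w.
  have bF : bmf F by apply: bmfM => //; exact: bmf_indic.
  have mF : measurable_fun setT (EFin \o F) by apply/measurable_EFinP; case: bF.
  have F0 w : (0 <= (EFin \o F) w)%E.
    by rewrite lee_fin mulr_ge0// ?indicE ?ler0n//; case/andP: (L01 w).
  have yE : path_prob mu n.+1 x = mu ((x 0%N)^-1 * x 1%N)%g * path_prob mu n y.
    by rewrite /path_prob big_ord_recl.
  have h1 := markov_int countG PeP 1 x PP mF F0.
  have := markov_int countG PeP 0 (fun=> x 1%N) PP mF F0.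
  rewrite (_ : \int[P]_(w in _) _ = \int[P]_(w in cylinder n y) (L w)%:E)%E; last first.
    rewrite -!(bint_indicM P _ bL)//.
    rewrite -(bint_indicM P _ bF)//; congr (bint _ _)%:E; apply/funext => w.
    rewrite /F mulrA; congr (_ * _); rewrite !indicE -natrM mulnb; congr (_%:R).
    congr (nat_of_bool _); apply: andb_idl; rewrite !inE => wy i.
    by rewrite leqn0 => /eqP ->; exact: (wy 0%N).
  rewrite LE !(walk_cylinder _ _ PP) /path_prob big_ord0 mulr1 -/(path_prob mu n y).
  have -> : (\int[P]_(w in cylinder n.+1 x) (L (time_shift w))%:E =
      \int[P]_(w in cylinder 1 x) (EFin \o F) (iter_shift 1 w))%E.
    have bFs : bmf (fun w : path => F (iter_shift 1 w)).
      split; first exact: (measurableT_comp (proj1 bF) (measurable_iter_shift 1)).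
      exact: (bounded_comp (iter_shift 1) (proj2 bF)).
    rewrite -(bint_indicM P _ bLs)// -(bint_indicM P _ bFs)//.
    congr (bint _ _)%:E; apply/funext => w.
    rewrite /F mulrA; congr (_ * _); rewrite !indicE -natrM mulnb; congr (_%:R).
    congr (nat_of_bool _); apply/idP/andP.
      rewrite !inE => wx; split => [[|[|//]] _|i im]; [exact: wx|exact: wx|].
      exact: (wx i.+1).
    rewrite !inE => -[w1 wy] [_|i im]; first exact: w1.
    exact: (wy i).
  rewrite h1 (walk_cylinder _ _ PP) -/(path_prob mu n.+1 x) yE.
  set I := (\int[Pe]__ _)%E.
  have Ifin : I \is a fin_num.
    have bFl : bmf (fun w : path => F (left_translate (x 1%N) w)).
      split; first exact: (measurableT_comp (proj1 bF) (measurable_left (x 1%N))).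
      exact: (bounded_comp (left_translate (x 1%N) : path -> path) (proj2 bF)).
    by rewrite /I -(bintE Pe bFl).
  rewrite -(fineK Ifin) -!EFinM => -[] e; congr EFin.
  have -> : fine I = path_prob mu n y * h (x n.+1).
    have t0 := th0 (x 1%N); apply: (@mulfI _ (theta (x 1%N))); first by rewrite gt_eqF.
    by rewrite -e mulrA.
  rewrite /path_prob big_ord_recl big_ord0 /= mulr1.
  by rewrite !mulrA.
have : ae_eq P setT (fun w => (L (time_shift w))%:E) (fun w => (L w)%:E).
  apply: integral_ae_eq => //.
  - exact: (bmf_integrable P bLs).
  - exact/measurable_EFinP.
  - by move=> A _ mA; exact: M12.
by move/ae_imp; apply => w /= /(_ I) [].
Qed.

(** f o bnd is the conditional expectation of the limit L given bnd. The events where one exceeds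
    the other are almost invariant, so up to null sets they come from B; on such events both
    integrals agree, and the events are null. *)
Lemma poisson_representation : exists f : B -> R,
  [/\ measurable_fun setT f, forall b, 0 <= f b <= 1 &
      forall x, pint f x = h x].
Proof.
have [L [mL L01 LE]] := martingale_limit.
have Linv := limit_invariant mL L01 LE.
have bL : bmf L by split => //; exact: bounded_between L01.
pose bm : {mfun path >-> B} :=
  HB.pack (bnd : path -> B) (isMeasurableFun.Build _ _ _ _ _ mbnd).
pose Q : probability B R := distribution P bm.
have mb C : measurable C -> measurable (bnd @^-1` C).
  by move=> mC; rewrite -[X in measurable X]setTI; exact: mbnd.
pose lam (C : set B) := bint P (fun w => \1_(bnd @^-1` C) w * L w).
have bC C : measurable C -> bmf (fun w => \1_(bnd @^-1` C) w * L w).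
  by move=> mC; apply: bmfM => //; apply: bmf_indic; exact: mb.
have lam_bound C : measurable C -> 0 <= lam C <= fine (Q C).
  move=> mC; rewrite [fine (Q C)](_ : _ = fine (P (bnd @^-1` C)))//.
  rewrite -(bint_indic P (mb _ mC)); apply/andP; split.
    rewrite -[leLHS](bint_cst P 0); apply: ler_bint; [exact: bmf_cst|exact: bC|].
    by move=> w; rewrite mulr_ge0// ?indicE ?ler0n//; case/andP: (L01 w).
  apply: ler_bint; [exact: bC|by apply: bmf_indic; exact: mb|].
  move=> w; rewrite -[leRHS]mulr1 ler_wpM2l// ?indicE ?ler0n//.
  by case/andP: (L01 w).
have lamU A C : measurable A -> measurable C -> A `&` C = set0 ->
    lam (A `|` C) = lam A + lam C.
  move=> mA mC AC; rewrite /lam -bintD; [|exact: bC|exact: bC].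
  congr bint; apply/funext => w; rewrite -mulrDl; congr (_ * _).
  rewrite !indicE preimage_setU in_setU.
  have [wA|_] := boolP (w \in bnd @^-1` A) => /=; last by rewrite add0r.
  have [wC|_] := boolP (w \in bnd @^-1` C); last by rewrite addr0.
  by have : (A `&` C) (bnd w) by [rewrite !inE in wA wC; split]; rewrite AC.
have [f [mf f01 fE]] := dominated_density lam_bound lamU.
have bf : bmf (fun w => f (bnd w)).
  split; first exact: (measurableT_comp mf mbnd).
  exact: bounded_comp (bounded_between f01).
have f0 b : (0 <= (f b)%:E)%E by rewrite lee_fin; case/andP: (f01 b).
have lamE C : measurable C -> lam C = bint P (fun w => \1_(bnd @^-1` C) w * f (bnd w)).
  move=> mC; apply: EFin_inj; rewrite fE// bint_indicM//; last exact: mb.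
  rewrite /Q /= (ge0_integral_pushforward mbnd)//.
  by apply/measurable_EFinP; exact: measurable_funTS.
have mbf := proj1 bf.
have sym (u v : path -> R) : bmf u -> bmf v ->
    {ae P, forall w, u (time_shift w) = u w} ->
    {ae P, forall w, v (time_shift w) = v w} ->
    (forall C, measurable C -> bint P (fun w => \1_(bnd @^-1` C) w * u w) =
      bint P (fun w => \1_(bnd @^-1` C) w * v w)) ->
    P [set w | u w < v w] = 0%E.
  move=> bu bv uinv vinv uv.
  have mA : measurable [set w | u w < v w].
    rewrite -[X in measurable X]setTI; apply: measurable_fun_ltr => //.
      by case: bu.
    by case: bv.
  have [C mC AC] : exists2 C : set B, measurable C &
      {ae P, forall w, (u w < v w) <-> C (bnd w)}.
    apply: (invariant_event mA).
    by apply: (ae_imp2 uinv vinv) => w /= -> ->.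
  have bvu : bmf (fun w => v w - u w) by exact: bmfB.
  apply: (bint_pos_null mA bvu) => [w|]; first by rewrite subr_gt0.
  rewrite (@bint_ae _ _ _ _ _ (fun w => \1_(bnd @^-1` C) w * v w - \1_(bnd @^-1` C) w * u w)).
  - rewrite bintB ?uv ?subrr//; apply: bmfM => //; apply: bmf_indic; exact: mb.
  - by apply: bmfM => //; exact: bmf_indic.
  - by apply: bmfB; apply: bmfM => //; apply: bmf_indic; exact: mb.
  apply: (ae_imp AC) => w wAC; rewrite -mulrBr; congr (_ * _).
  rewrite !indicE; congr (_%:R); congr nat_of_bool.
  by apply/idP/idP; rewrite !inE => /wAC.
have finv : {ae P, forall w, f (bnd (time_shift w)) = f (bnd w)}.
  by apply: (ae_imp bnd_shift) => w ->.
have fL : {ae P, forall w, f (bnd w) = L w}.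
  have N1 := sym _ _ bf bL finv Linv (fun C mC => esym (lamE C mC)).
  have N2 := sym _ _ bL bf Linv finv lamE.
  have mN u v : bmf u -> bmf v -> measurable [set w : path | u w < v w].
    move=> bu bv; rewrite -[X in measurable X]setTI; apply: measurable_fun_ltr => //.
      by case: bu.
    by case: bv.
  have a1 : {ae P, forall w, ~ (f (bnd w) < L w)}.
    by exists [set w | f (bnd w) < L w]; split => //; [exact: mN|move=> w /contrapT].
  have a2 : {ae P, forall w, ~ (L w < f (bnd w))}.
    by exists [set w | L w < f (bnd w)]; split => //; [exact: mN|move=> w /contrapT].
  by apply: (ae_imp2 a1 a2) => w /negP n1 /negP n2; apply/eqP; rewrite eq_le !leNgt n1 n2.
exists f; split => // x.
have bfx : bmf (fun b => f (act x b)).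
  by apply: bmf_act; split => //; exact: bounded_between f01.
(* Paths that start at x: the integral of f o bnd is theta(x) times the Poisson integral at x, and
   that of L is theta(x) h(x). *)
have := integral_cylinder 0 (fun=> x) (measurable_EFin mf) f0.
rewrite (_ : \int[P]_(w in _) _ = P (cylinder 0 (fun=> x)) * (h x)%:E)%E; last first.
  rewrite -LE; apply: ae_eq_integral.
  - exact: measurable_cylinder.
  - by apply/measurable_EFinP; exact: measurable_funTS.
  - by apply/measurable_EFinP; exact: measurable_funTS.
  - by apply: (ae_imp fL) => w /= ->.
rewrite /= -(bintE nu bfx) (walk_cylinder _ _ PP) /path_prob big_ord0 mulr1 -!EFinM.
by move=> [] /(mulfI (lt0r_neq0 (th0 x))) ->.
Qed.

End existence.

End boundary.

Section simple_approximation.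
Context d (T : measurableType d) (R : realType).

(** Dyadic expansion of values: if 0 <= f <= c, subtracting c / 2 on the set where f >= c / 2 halves
    the range, so n rounds approximate f uniformly within c / 2^n. *)
Lemma bmf_ind (K : (T -> R) -> Prop) :
  (forall A, measurable A -> K (\1_A)) ->
  (forall f g, bmf f -> bmf g -> K f -> K g -> K (fun x => f x + g x)) ->
  (forall c f, bmf f -> K f -> K (fun x => c * f x)) ->
  (forall f, bmf f -> (forall e, 0 < e ->
     exists g, [/\ bmf g, K g & forall x, `|f x - g x| <= e]) -> K f) ->
  forall f, bmf f -> K f.
Proof.
move=> K1 KD KZ Klim.
have step n (f : T -> R) (c : R) : 0 <= c -> bmf f -> (forall x, 0 <= f x <= c) ->
    exists g, [/\ bmf g, K g & forall x, 0 <= f x - g x <= c / 2 ^+ n].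
  elim: n f c => [|n IH] f c c0 bf fc.
    (* Zero is written as a multiple of an indicator, to which the closure properties of [K]
       apply. *)
    exists (fun x => 0 * \1_setT x); split.
    - by apply: bmfZ; exact: bmf_indic.
    - by apply: KZ; [exact: bmf_indic|exact: K1].
    - by move=> x; rewrite mul0r subr0 expr0 divr1.
  pose A := [set x | c / 2 <= f x].
  have mA : measurable A.
    rewrite -[X in measurable X]setTI; apply: measurable_fun_ler => //.
    by case: bf.
  have bA : bmf (fun x => c / 2 * \1_A x) by apply: bmfZ; exact: bmf_indic.
  have KA : K (fun x => c / 2 * \1_A x) by apply: KZ; [exact: bmf_indic|exact: K1].
  have bfA : bmf (fun x => f x - c / 2 * \1_A x) by exact: bmfB.
  have [||g [bg Kg gE]] := IH _ (c / 2) _ bfA; first by rewrite divr_ge0.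
    move=> x; rewrite indicE; have := fc x.
    have [|/negP] := boolP (x \in A); rewrite inE /A /= => h; first by lra.
    by move/negP: h; rewrite -ltNge; lra.
  exists (fun x => g x + c / 2 * \1_A x); split; [exact: bmfD|exact: KD|].
  move=> x; have := gE x; rewrite exprS invfM.
  rewrite (_ : c * (2^-1 * (2 ^+ n)^-1) = c / 2 / 2 ^+ n); last by rewrite mulrA.
  lra.
move=> f bf; apply: Klim => // e e0.
have [M M0 fM] := bounded_fctP (proj2 bf).
have bfM : bmf (fun x => f x + M) by apply: bmfD => //; exact: bmf_cst.
have [n ne] : exists n, 2 * M / 2 ^+ n <= e.
  have : (geometric (2 * M) 2^-1) @ \oo --> (0 : R).
    by apply: cvg_geometric; rewrite ger0_norm ?invr_ge0// invf_lt1// ltr1n.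
  move/cvgrPdist_le => /(_ e e0) [n _ /(_ n (leqnn n)) /= h].
  exists n; move: h; rewrite sub0r normrN ger0_norm ?exprVn//.
  by rewrite mulr_ge0 ?exprn_ge0 ?invr_ge0// mulr_ge0// ltW.
have [|x|g [bg Kg gE]] := step n _ (2 * M) _ bfM.
- by rewrite mulr_ge0// ltW.
- by have := fM x; lra.
exists (fun x => g x + (- M) * \1_setT x); split.
- by apply: bmfD => //; apply: bmfZ; exact: bmf_indic.
- apply: KD => //; first by apply: bmfZ; exact: bmf_indic.
  by apply: KZ; [exact: bmf_indic|exact: K1].
- move=> x; rewrite indicE in_setT mulr1; have := gE x.
  by rewrite ler_norml; lra.
Qed.

End simple_approximation.

Section abel_harmonic.
Context {R : realType} {G : groupType}.
Variables (mu : G -> R) (muP : is_prob_mass mu).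

(** The difference D between the two sides, as a function of x, satisfies D(x) = a times the mu-mean
    of D(x y). Hence its supremum norm is at most a < 1 times itself, and vanishes. *)
Lemma avg_abel_harmonic (h : G -> R) (a : R) x : 0 < a < 1 -> bounded_fct h ->
  harmonic mu h -> avg (abel_mean mu a) (fun y => h (x * y)%g) = h x.
Proof.
move=> a01 bh hh; have aP := abel_mean_prob muP a01.
have [M M0 hM] := bounded_fctP bh.
pose A x := avg (abel_mean mu a) (fun y => h (x * y)%g).
have bhx z : bounded_fct (fun y => h (z * y)%g) by exact: (bounded_comp (fun y => (z * y)%g)).
have AM z : - M <= A z <= M by apply: avg_between => // y; exact: hM.
have bA : bounded_fct A by exact: bounded_between AM.
have bD : bounded_fct (fun z => A z - h z) by exact: bounded_sub.
have DE z : A z - h z = a * avg mu (fun y => A (z * y)%g - h (z * y)%g).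
  rewrite avgB//; last exact: (bounded_comp (fun y => (z * y)%g)).
  rewrite -hh {1}/A avg_abel_mean// mulg1.
  rewrite (_ : avg mu _ = avg mu (fun y => A (z * y)%g)); first by ring.
  congr avg; apply/funext => y; congr avg; apply/funext => t.
  by rewrite mulgA.
pose S := [set `|A z - h z| | z in [set: G]].
have [N DN] := bD.
have Ssup : has_sup S.
  split; first by exists `|A x - h x|, x.
  by exists N => _ [z _ <-].
have DS z : `|A z - h z| <= sup S by apply: sup_upper_bound => //; exists z.
have DaS z : `|A z - h z| <= a * sup S.
  have /andP[a0 _] := a01; rewrite DE normrM (gtr0_norm a0) ler_pM2l// ler_norml.
  by apply: avg_between => // y; rewrite -ler_norml.
have SaS : sup S <= a * sup S.
  by apply: ge_sup; [case: Ssup|move=> _ [z _ <-]].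
have S0 : 0 <= sup S by exact: le_trans (DS x).
have {}S0 : sup S = 0.
  by case/andP: a01 => _ a1; apply/eqP; rewrite eq_le S0 andbT; nra.
by apply/eqP; rewrite -subr_eq0 -normr_le0 -S0; exact: DS.
Qed.

End abel_harmonic.

(** * Families acting by multiplication on the boundary *)

Section poisson_representation_of_families.
Context {R : realType} {G : groupType}.
Variables (mu : G -> R) (muP : is_prob_mass mu) (mu_gen : generating mu).
Variables (U : set_system (abel_param R)) (UU : UltraFilter U).
Hypothesis U_to_1 : forall e : R, 0 < e < 2^-1 ->
  U [set a : abel_param R | 1 - e < val a < 1].
Context d (B : measurableType d) (nu : probability B R) (act : G -> B -> B).
Hypothesis mact : measurable_action act.
Notation pint := (pint nu act).
Notation mean := (mean mu U).
Notation poisson := (poisson mu U).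
Hypothesis pint_harm : forall f : B -> R, bmf f -> (forall b, 0 <= f b) ->
  harmonic mu (pint f).
Hypothesis pint_uniq : forall f g : B -> R, bmf f -> bmf g ->
  (forall x, pint f x = pint g x) -> {ae nu, forall b, f b = g b}.
Hypothesis pint_ex : forall h : G -> R, (forall x, 0 <= h x <= 1) ->
  harmonic mu h -> exists f : B -> R,
  [/\ measurable_fun setT f, forall b, 0 <= f b <= 1 & forall x, pint f x = h x].

Let mact1 g : measurable_fun setT (act g). Proof. by case: mact. Qed.
Let actM g h b : act (g * h)%g b = act g (act h b). Proof. by case: mact => -[]. Qed.
Let act1 b : act 1%g b = b. Proof. by case: mact => -[]. Qed.
Let bact (f : B -> R) g : bmf f -> bmf (fun b => f (act g b)).
Proof. exact: bmf_act. Qed.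

Let mpre g C : measurable C -> measurable (act g @^-1` C).
Proof. by move=> mC; rewrite -[X in measurable X]setTI; exact: mact1. Qed.

Lemma pint1 f : pint f 1%g = bint nu f.
Proof. by congr bint; apply/funext => b; rewrite act1. Qed.

Lemma pint_indic C g : measurable C -> pint (\1_C) g = fine (nu (act g @^-1` C)).
Proof.
move=> mC; rewrite -(bint_indic nu (mpre g mC)); congr bint.
Qed.

Lemma bounded_pint f : bmf f -> bounded_fct (pint f).
Proof.
move=> bf; have [M M0 fM] := bounded_fctP (proj2 bf).
apply: (@bounded_between _ _ _ (- M) M) => x.
by apply: bint_between; [exact: bact|move=> b; exact: fM].
Qed.

(** The Harnack inequality at the identity for the harmonic function x |-> nu (x^-1 C), with a
    constant independent of C. *)
Lemma nu_act_bound g : exists2 K : R, 0 < K & forall C, measurable C ->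
  fine (nu (act g @^-1` C)) <= K * fine (nu C).
Proof.
have [K K0 hK] := harnack muP mu_gen g; exists K => // C mC.
have bC : bmf (\1_C : B -> R) by exact: bmf_indic.
have C0 b : 0 <= \1_C b :> R by rewrite indicE ler0n.
have := hK _ (bounded_pint bC) _ (pint_harm bC C0) 1%g.
rewrite mul1g pint1 pint_indic// bint_indic//; apply => x.
by rewrite pint_indic// fine_ge0.
Qed.

Lemma nu_act0 g C : measurable C -> nu C = 0%E -> nu (act g @^-1` C) = 0%E.
Proof.
move=> mC C0; have [K K0 /(_ C mC)] := nu_act_bound g.
rewrite C0 /= mulr0 => h; rewrite -[LHS]fineK ?fin_num_measure//; last exact: mpre.
by congr EFin; apply/eqP; rewrite eq_le h fine_ge0.
Qed.

Lemma boundary_qi : qi_space nu act.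
Proof.
split=> // g C mC; split => [|C0]; last exact: nu_act0.
move=> /(nu_act0 g^-1%g (mpre g mC)) <-; congr (nu _).
by apply/seteqP; split => b /=; rewrite -actM mulgV act1.
Qed.

Lemma ae_act g (Q : B -> Prop) : {ae nu, forall b, Q b} ->
  {ae nu, forall b, Q (act g b)}.
Proof.
move=> [N [mN N0 QN]]; exists (act g @^-1` N); split; [exact: mpre|exact: nu_act0|].
by move=> b /= nQ; exact: QN.
Qed.

Lemma density_ex g : exists2 r : B -> R, bmf r &
  forall f, bmf f -> bint nu (fun b => f (act g b)) = bint nu (fun b => r b * f b).
Proof.
have [K K0 gK] := nu_act_bound g.
(* Division by K brings the translate below nu; the witness restores the factor. *)
pose lam C := K^-1 * fine (nu (act g @^-1` C)).
have lam_bound C : measurable C -> 0 <= lam C <= fine (nu C).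
  move=> mC; apply/andP; split; last by rewrite ler_pdivrMl// gK.
  by rewrite mulr_ge0// ?fine_ge0// invr_ge0 ltW.
have lamU A C : measurable A -> measurable C -> A `&` C = set0 ->
    lam (A `|` C) = lam A + lam C.
  move=> mA mC AC; rewrite /lam -mulrDr -fineD ?fin_num_measure//; try exact: mpre.
  congr (_ * fine _); rewrite preimage_setU measureU//; try exact: mpre.
  by rewrite -preimage_setI AC preimage_set0.
have [f [mf f01 fE]] := dominated_density lam_bound lamU.
have bf : bmf f by split => //; exact: bounded_between f01.
have br : bmf (fun b => K * f b) by exact: bmfZ.
exists (fun b => K * f b) => //.
apply: bmf_ind => [C mC|u v bu bv Eu Ev|c u bu Eu|u bu Eu].
- rewrite (_ : bint nu _ = pint (\1_C) g)// pint_indic//.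
  have := congr1 fine (fE C mC); rewrite /= /lam -(bint_indicM nu mC bf)/=.
  move/(congr1 (fun t => K * t)); rewrite mulVKf ?gt_eqF// => ->.
  rewrite -bintZ; last by apply: bmfM => //; exact: bmf_indic.
  by congr bint; apply/funext => b; rewrite mulrA mulrAC.
- rewrite bintD ?Eu ?Ev; [|exact: bact..].
  rewrite -bintD; [|exact: bmfM..].
  by congr bint; apply/funext => b; rewrite mulrDr.
- rewrite bintZ ?Eu; [|exact: bact].
  rewrite -bintZ; [|exact: bmfM].
  by congr bint; apply/funext => b; rewrite mulrCA.
- have [r r0 rM] := bounded_fctP (proj2 br).
  apply/eqP; rewrite -subr_eq0 -normr_le0; apply/ler_addgt0Pr => e e0; rewrite add0r.
  (* Approximating u within e' costs e' on one side and r e' on the other, r being a bound of the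
     density. *)
  pose e' := e / (1 + r).
  have e'0 : 0 < e' by rewrite divr_gt0// addr_gt0.
  have ee : e = e' + r * e' by rewrite /e'; field; rewrite gt_eqF// addr_gt0.
  have [v [bv Ev uv]] := Eu _ e'0.
  rewrite (_ : _ - _ = bint nu (fun b => u (act g b) - v (act g b)) -
     bint nu (fun b => K * f b * (u b - v b))); last first.
    rewrite [X in _ = _ - bint _ X](_ : _ = fun b => K * f b * u b - K * f b * v b).
      rewrite !bintB ?Ev; [ring|exact: bmfM|exact: bmfM|exact: bact|exact: bact].
    by apply/funext => b; rewrite mulrBr.
  have h1 : - e' <= bint nu (fun b => u (act g b) - v (act g b)) <= e'.
    by apply: bint_between; [apply: bmfB; exact: bact|move=> b; rewrite -ler_norml].
  have h2 : - (r * e') <= bint nu (fun b => K * f b * (u b - v b)) <= r * e'.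
    apply: bint_between; first by apply: bmfM => //; exact: bmfB.
    move=> b; rewrite -ler_norml normrM ler_pM// ler_norml; exact: rM.
  by rewrite ee ler_norml; lra.
Qed.

(** A bounded version of the density q_g of g nu with respect to nu. *)
Definition rho g : B -> R := s2val (cid2 (density_ex g)).

Lemma bmf_rho g : bmf (rho g).
Proof. exact: (s2valP (cid2 (density_ex g))). Qed.

Lemma rhoP g f : bmf f -> pint f g = bint nu (fun b => rho g b * f b).
Proof. by move=> bf; exact: (s2valP' (cid2 (density_ex g))). Qed.

(** This is f = e(u), kept as a relation because f is determined only up to null sets. *)
Definition rep (u : abel_param R -> G -> R) (f : B -> R) :=
  [/\ bdd2 u, bmf f & forall x, poisson u x = pint f x].

Lemma rep_uniq u f g : rep u f -> rep u g -> {ae nu, forall b, f b = g b}.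
Proof.
by move=> [_ bf uf] [_ bg ug]; apply: pint_uniq => // x; rewrite -uf.
Qed.

Lemma rep_ae u f g : rep u f -> bmf g -> {ae nu, forall b, f b = g b} -> rep u g.
Proof.
move=> [bu bf uf] bg fg; split => // x; rewrite uf.
by apply: bint_ae; [exact: bact|exact: bact|exact: (ae_act x fg)].
Qed.

Lemma rep_cst (c : R) : rep (fun _ _ => c) (fun=> c).
Proof.
split; [exact: bdd2_cst|exact: bmf_cst|move=> x].
by rewrite /poisson /pint bint_cst (mean_cst muP UU).
Qed.

Lemma repD u v f g : rep u f -> rep v g ->
  rep (fun a x => u a x + v a x) (fun b => f b + g b).
Proof.
move=> [bu bf uf] [bv bg vg]; split; [exact: bdd2_add|exact: bmfD|move=> x].
rewrite /pint bintD; [|exact: bact..].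
by rewrite -/(pint f x) -/(pint g x) -uf -vg -(meanD muP UU)//; exact: bdd2_translate.
Qed.

Lemma repZ (c : R) u f : rep u f -> rep (fun a x => c * u a x) (fun b => c * f b).
Proof.
move=> [bu bf uf]; split; [exact: bdd2_scale|exact: bmfZ|move=> x].
rewrite /pint bintZ; [|exact: bact].
by rewrite -/(pint f x) -uf -(meanZ muP UU)//; exact: bdd2_translate.
Qed.

Lemma rep_ex01 u : (forall a x, 0 <= u a x <= 1) ->
  exists2 f, rep u f & forall b, 0 <= f b <= 1.
Proof.
move=> u01; have bu : bdd2 u by exact: bdd2_between u01.
have [|f [mf f01 fu]] := @pint_ex (poisson u) _ (poisson_harmonic muP UU U_to_1 bu).
  by move=> x; exact: (poisson_between muP UU).
by exists f => //; split => //; split => //; exact: bounded_between f01.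
Qed.

Lemma bdd2_affine (u : abel_param R -> G -> R) : bdd2 u -> exists v (k c : R),
  (forall a x, 0 <= v a x <= 1) /\ u = (fun a x => k * v a x + c).
Proof.
move=> bu; have [M M0 uM] := bdd2P bu.
exists (fun a x => (u a x + M) / (2 * M)), (2 * M), (- M); split => [a x|].
  have /andP[u0 u1] := uM a x; have M2 : 0 < 2 * M by rewrite mulr_gt0.
  apply/andP; split; last by rewrite ler_pdivrMr//; lra.
  by apply: divr_ge0; [lra|exact: ltW].
apply/funext => a; apply/funext => x; field.
by rewrite gt_eqF.
Qed.

Lemma rep_ex u : bdd2 u -> exists f, rep u f.
Proof.
move=> /bdd2_affine[v [k [c [v01 ->]]]]; have [f vf _] := rep_ex01 v01.
by exists (fun b => k * f b + c); apply: repD; [exact: repZ|exact: rep_cst].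
Qed.

(** The substitute for the indicator of [C] among families; it does not depend on the parameter
    a. *)
Definition pfam (C : set B) : abel_param R -> G -> R := fun _ => pint (\1_C).

Lemma pfam01 C a x : measurable C -> 0 <= pfam C a x <= 1.
Proof.
move=> mC; apply: bint_between; first by apply: bact; exact: bmf_indic.
by move=> b; rewrite indicE ler0n lern1 leq_b1.
Qed.

Lemma bdd2_pfam C : measurable C -> bdd2 (pfam C).
Proof. by move=> mC; apply: (@bdd2_between _ _ _ 0 1) => a x; exact: pfam01. Qed.

Lemma pfamC C a x : measurable C -> pfam C a x + pfam (~` C) a x = 1.
Proof.
move=> mC; have mC' := measurableC mC.
rewrite /pfam /pint -bintD; [|by apply: bact; exact: bmf_indic..].
rewrite -[RHS](bint_cst nu 1); congr bint; apply/funext => b.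
by rewrite !indicE in_setC; case: (_ \in C); rewrite /= ?addr0 ?add0r.
Qed.

(** A bounded harmonic function is reproduced by every Abel mean, before any limit is taken. *)
Lemma rep_pfam C : measurable C -> rep (pfam C) (\1_C).
Proof.
move=> mC; have bC : bmf (\1_C : B -> R) by exact: bmf_indic.
split => //; first exact: bdd2_pfam.
move=> x; rewrite /poisson /mean (_ : (fun a => _) = (fun=> pint (\1_C) x)); last first.
  apply/funext => a; apply: avg_abel_harmonic => //; first exact: abel_param_in.
    exact: bounded_pint.
  by apply: pint_harm => // b; rewrite indicE ler0n.
exact: ulim_cst.
Qed.

(* For [0 <= u <= 1], the functions representing [pfam C * u] and
   [pfam (~` C) * u] lie below [\1_C] and [\1_(~` C)], and add up to [f]. *)
Lemma rep_indic C u f : measurable C -> rep u f ->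
  rep (fun a x => pfam C a x * u a x) (fun b => \1_C b * f b).
Proof.
move=> mC uf.
have [v [k [c [v01 uE]]]] := bdd2_affine (let: And3 bu _ _ := uf in bu).
have [g vg g01] := rep_ex01 v01.
suff Cvg : rep (fun a x => pfam C a x * v a x) (fun b => \1_C b * g b).
  have [bu bf _] := uf.
  have fkg : {ae nu, forall b, f b = k * g b + c}.
    by apply: (rep_uniq uf); rewrite uE; apply: repD; [exact: repZ|exact: rep_cst].
  have := repD (repZ k Cvg) (repZ c (rep_pfam mC)).
  rewrite (_ : (fun a x => _) = (fun a x => pfam C a x * u a x)); last first.
    by apply/funext => a; apply/funext => x; rewrite uE; ring.
  move/rep_ae; apply; first by apply: bmfM => //; exact: bmf_indic.
  by apply: (ae_imp fkg) => b ->; ring.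
have part D : measurable D -> exists f1, rep (fun a x => pfam D a x * v a x) f1 /\
    {ae nu, forall b, 0 <= f1 b <= \1_D b}.
  move=> mD.
  have [f1 r1 f01] : exists2 f, rep (fun a x => pfam D a x * v a x) f & forall b, 0 <= f b <= 1.
    apply: rep_ex01 => a x; have := pfam01 a x mD; have := v01 a x.
    by move=> /andP[? ?] /andP[? ?]; rewrite mulr_ge0//= mulr_ile1.
  (* The companion [f2 >= 0] bounds [f1] from above: their sum represents [pfam D], hence equals the
     indicator of [D] almost everywhere. *)
  have [f2 r2 f02] : exists2 f, rep (fun a x => pfam D a x * (1 - v a x)) f & forall b, 0 <= f b <= 1.
    apply: rep_ex01 => a x; have := pfam01 a x mD; have := v01 a x.
    by move=> /andP[? ?] /andP[? ?]; rewrite mulr_ge0 ?mulr_ile1 ?subr_ge0//=; lra.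
  exists f1; split => //.
  have r12 : rep (pfam D) (fun b => f1 b + f2 b).
    have := repD r1 r2; rewrite (_ : (fun a x => _) = pfam D)//.
    by apply/funext => a; apply/funext => x; rewrite -mulrDr addrC subrK mulr1.
  apply: (ae_imp (rep_uniq (rep_pfam mD) r12)) => b ->.
  by have := f01 b; have := f02 b; lra.
have [f1 [r1 f1C]] := part C mC; have [f2 [r2 f2C]] := part _ (measurableC mC).
have r12 : rep v (fun b => f1 b + f2 b).
  have := repD r1 r2; rewrite (_ : (fun a x => _) = v)//.
  by apply/funext => a; apply/funext => x; rewrite -mulrDl pfamC// mul1r.
have bg : bmf g by case: vg.
apply: (rep_ae r1); first by apply: bmfM => //; exact: bmf_indic.
apply: (ae_imp2 (rep_uniq vg r12) (ae_imp2 f1C f2C (fun b h1 h2 => conj h1 h2))) => b -> [].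
by rewrite !indicE in_setC; case: (_ \in C) => /=; lra.
Qed.

Lemma mean_poisson1 u : mean u = poisson u 1%g.
Proof.
by congr mean; apply/funext => a; apply/funext => x; rewrite /translate mul1g.
Qed.

Lemma rep_mean u f : rep u f -> mean u = bint nu f.
Proof. by move=> [_ _ uf]; rewrite mean_poisson1 uf pint1. Qed.

(** Integrate over an arbitrary C by means of [pfam C]. By commutativity the density may act last,
    where [mean_rn] turns it into evaluation at g; the defining property of [rho] does the same on
    B. *)
Lemma rep_rn g u f : rep u f ->
  rep (fun a x => rn mu g a x * u a x) (fun b => rho g b * f b).
Proof.
move=> uf; have [bu bf _] := uf; have br := bdd2_rn muP mu_gen g.
have [f' rf'] := rep_ex (bdd2_mul br bu); have [_ bf' _] := rf'.
apply: (rep_ae rf'); first by apply: bmfM => //; exact: bmf_rho.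
apply: bint_eq_ae => //; first by apply: bmfM => //; exact: bmf_rho.
move=> C mC; rewrite -(rep_mean (rep_indic mC rf')).
have ruf := rep_indic mC uf.
under [X in mean X]eq_fun do under eq_fun do rewrite mulrCA.
rewrite (mean_rn muP mu_gen); have [_ bCf ->] := ruf.
rewrite rhoP//; congr bint; apply/funext => b; exact: mulrCA.
Qed.

(* Unlike [rep], this relation is stable under products. *)
Definition mult (r : abel_param R -> G -> R) (q : B -> R) :=
  [/\ bdd2 r, bmf q & forall u f, rep u f ->
    rep (fun a x => r a x * u a x) (fun b => q b * f b)].

Lemma mult_rep r q : mult r q -> rep r q.
Proof.
move=> [_ _ /(_ _ _ (rep_cst 1))].
under eq_fun do under eq_fun do rewrite mulr1.
by under [X in rep _ X]eq_fun do rewrite mulr1.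
Qed.

Lemma mult_rn g : mult (rn mu g) (rho g).
Proof.
by split; [exact: bdd2_rn|exact: bmf_rho|move=> u f; exact: rep_rn].
Qed.

Lemma mult_cst (c : R) : mult (fun _ _ => c) (fun=> c).
Proof.
by split; [exact: bdd2_cst|exact: bmf_cst|move=> u f; exact: repZ].
Qed.

Lemma multD r1 r2 q1 q2 : mult r1 q1 -> mult r2 q2 ->
  mult (fun a x => r1 a x + r2 a x) (fun b => q1 b + q2 b).
Proof.
move=> [b1 c1 m1] [b2 c2 m2]; split; [exact: bdd2_add|exact: bmfD|move=> u f uf].
have := repD (m1 _ _ uf) (m2 _ _ uf).
under eq_fun do under eq_fun do rewrite -mulrDl.
by under [X in rep _ X]eq_fun do rewrite -mulrDl.
Qed.

Lemma multM r1 r2 q1 q2 : mult r1 q1 -> mult r2 q2 ->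
  mult (fun a x => r1 a x * r2 a x) (fun b => q1 b * q2 b).
Proof.
move=> [b1 c1 m1] [b2 c2 m2]; split; [exact: bdd2_mul|exact: bmfM|move=> u f uf].
have := m1 _ _ (m2 _ _ uf).
under eq_fun do under eq_fun do rewrite mulrA.
by under [X in rep _ X]eq_fun do rewrite mulrA.
Qed.

Lemma multZ (c : R) r q : mult r q -> mult (fun a x => c * r a x) (fun b => c * q b).
Proof. by move=> m; apply: multM => //; exact: mult_cst. Qed.

Lemma multB r1 r2 q1 q2 : mult r1 q1 -> mult r2 q2 ->
  mult (fun a x => r1 a x - r2 a x) (fun b => q1 b - q2 b).
Proof.
move=> m1 /(multZ (-1)) m2; have := multD m1 m2.
under eq_fun do under eq_fun do rewrite mulN1r.
by under [X in mult _ X]eq_fun do rewrite mulN1r.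
Qed.

(** Null families act as 0, so being a multiplier depends only on the class modulo null families. *)
Lemma mult_null r : bdd2 r -> null2 mu U r -> mult r (fun=> 0).
Proof.
move=> br nr; split => //; first exact: bmf_cst.
move=> u f [bu bf uf]; split; first exact: bdd2_mul.
  by apply: bmfM => //; exact: bmf_cst.
move=> x; rewrite (null_poisson muP mu_gen UU)//.
by rewrite /pint; under eq_fun do rewrite mul0r; rewrite bint_cst.
Qed.

Lemma mult_uniq r q q' : mult r q -> mult r q' -> {ae nu, forall b, q b = q' b}.
Proof. by move=> /mult_rep m /mult_rep; exact: rep_uniq. Qed.

Lemma mult_lim r q : bdd2 r -> bmf q -> (forall e : R, 0 < e -> exists r' q',
    [/\ mult r' q', forall a x, `|r a x - r' a x| <= e &
        forall b, `|q b - q' b| <= e]) -> mult r q.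
Proof.
move=> br bq H; split => // u f [bu bf uf].
split; [exact: bdd2_mul|exact: bmfM|move=> x].
have [M M0 uM] := bdd2P bu; have [N N0 fN] := bounded_fctP (proj2 bf).
apply/eqP; rewrite -subr_eq0 -normr_le0; apply/ler_addgt0Pr => e e0; rewrite add0r.
(* M bounds [u] and N bounds [f], so the two errors e' M and e' N add up to e. *)
pose e' := e / (M + N).
have e'0 : 0 < e' by rewrite divr_gt0// addr_gt0.
have ee : e = e' * M + e' * N by rewrite /e'; field; rewrite gt_eqF// addr_gt0.
have [r' [q' [[br' bq' m'] rr' qq']]] := H _ e'0.
have [_ _ /(_ x) mx] := m' _ _ (And3 bu bf uf).
have bt v : bdd2 v -> bdd2 (translate x v) by exact: bdd2_translate.
have p1 : `|poisson (fun a x => r a x * u a x) x - poisson (fun a x => r' a x * u a x) x| <= e' * M.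
  rewrite /poisson -(meanB muP UU); [|by apply: bt; exact: bdd2_mul..].
  rewrite ler_norml; apply: (mean_between muP UU) => a y.
  by rewrite /translate -mulrBl -ler_norml normrM ler_pM// ler_norml.
have p2 : `|pint (fun b => q b * f b) x - pint (fun b => q' b * f b) x| <= e' * N.
  rewrite /pint -bintB; [|by apply: (@bact (fun b => _ b * f b)); exact: bmfM..].
  rewrite ler_norml; apply: bint_between.
    by apply: bmfB; apply: (@bact (fun b => _ b * f b)); exact: bmfM.
  by move=> b; rewrite -mulrBl -ler_norml normrM ler_pM// ler_norml.
move: p1 p2; rewrite mx ee; move: (poisson _ _) (pint _ _) (pint _ _) => A D C p1 p2.
rewrite (_ : A - _ = (A - C) - (D - C)); last by ring.
by rewrite (le_trans (ler_normB _ _))// lerD.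
Qed.

Lemma rep_translate g u f : rep u f -> rep (translate g u) (fun b => f (act g b)).
Proof.
move=> [bu bf uf]; split; [exact: bdd2_translate|exact: bact|move=> x].
rewrite poisson_translate uf; congr bint; apply/funext => b.
by rewrite actM.
Qed.

Lemma mult_translate g r q : mult r q -> mult (translate g r) (fun b => q (act g b)).
Proof.
move=> [br bq m]; split; [exact: bdd2_translate|exact: bact|move=> u f uf].
(* [u] is first moved by g^-1, so that translating the product by g moves [r] alone. *)
have := rep_translate g (m _ _ (rep_translate g^-1%g uf)).
rewrite (_ : translate g _ = (fun a x => translate g r a x * u a x)); last first.
  by apply/funext => a; apply/funext => x; rewrite /translate mulKg.
by under [X in rep _ X]eq_fun do rewrite -actM mulVg act1.
Qed.

Lemma mult_mean C r q : measurable C -> mult r q ->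
  mean (fun a x => pfam C a x * r a x) = bint nu (fun b => \1_C b * q b).
Proof. by move=> mC /mult_rep m; apply: rep_mean; exact: rep_indic. Qed.

(** The identity is exact for the densities on G, and a multiplier determines its function almost
    everywhere. *)
Lemma rho_cocycle g h : {ae nu, forall b,
  rho h (act g b) * rho g^-1%g b = rho (g^-1 * h)%g b}.
Proof.
have := multM (mult_translate g (mult_rn h)) (mult_rn g^-1%g).
rewrite (_ : (fun a x => _) = rn mu (g^-1 * h)%g).
  by move/mult_uniq; apply; exact: mult_rn.
by apply/funext => a; apply/funext => x; rewrite /translate rn_cocycle.
Qed.

(** The family eta - sum (r_g - t_g)^2 is a multiplier whose function has positive integral over C.
    If no pair worked, the family would be at most 0 wherever |v| < dl; the remaining pairs are
    absorbed by eta / dl^2 times v^2, of mean 0, as in Chebyshev's inequality. *)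
Lemma joint_support (s : seq G) (t : G -> R) (C : set B) (e eta dl : R) v :
  measurable C -> (0 < nu C)%E ->
  (forall g b, g \in s -> C b -> `|rho g b - t g| <= e) ->
  (size s)%:R * e ^+ 2 < eta -> 0 < dl -> bdd2 v -> null2 mu U v ->
  exists a x, (forall g, g \in s -> (rn mu g a x - t g) ^+ 2 < eta) /\ `|v a x| < dl.
Proof.
move=> mC C0 Ce eeta dl0 bv nv.
pose w (z : seq G) a x := \sum_(g <- z) (rn mu g a x - t g) ^+ 2.
pose k (z : seq G) b := \sum_(g <- z) (rho g b - t g) ^+ 2.
have mwk z : mult (w z) (k z).
  elim: z => [|g z IH].
    rewrite (_ : w [::] = fun _ _ => 0); last first.
      by apply/funext => a; apply/funext => x; exact: big_nil.
    by rewrite (_ : k [::] = fun=> 0); [exact: mult_cst|apply/funext => b; exact: big_nil].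
  rewrite (_ : w (g :: z) = fun a x => (rn mu g a x - t g) * (rn mu g a x - t g) + w z a x); last first.
    by apply/funext => a; apply/funext => x; rewrite /w big_cons expr2.
  rewrite (_ : k (g :: z) = fun b => (rho g b - t g) * (rho g b - t g) + k z b); last first.
    by apply/funext => b; rewrite /k big_cons expr2.
  by apply: multD => //; apply: multM; apply: multB;
    [exact: mult_rn|exact: mult_cst|exact: mult_rn|exact: mult_cst].
have mm := multB (mult_cst eta) (mwk s).
apply: contrapT => /forallNP nex.
have far a x : eta <= w s a x \/ dl <= `|v a x|.
  have [|dv] := leP dl `|v a x|; [by right|left].
  have /forallNP/(_ x)/not_andP[|//] := nex a.
  move/existsNP => [g /not_implyP[gs /negP]]; rewrite -leNgt => h.
  rewrite (le_trans h)// /w (big_rem g)//= lerDl sumr_ge0// => i _.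
  exact: sqr_ge0.
have eta0 : 0 < eta.
  by rewrite (le_lt_trans _ eeta)// mulr_ge0 ?ler0n ?sqr_ge0.
have w0 a x : 0 <= w s a x by rewrite sumr_ge0// => g _; exact: sqr_ge0.
have [bm bk _] := mm.
have bsq := bdd2_sqr bv.
have : mean (fun a x => pfam C a x * (eta - w s a x)) <= 0.
  have -> : 0 = mean (fun a x => eta / dl ^+ 2 * v a x ^+ 2).
    by rewrite (meanZ muP UU)// nv mulr0.
  apply: (ler_mean muP UU).
  - by apply: bdd2_mul => //; exact: bdd2_pfam.
  - exact: bdd2_scale.
  - move=> a x; have /andP[p0 p1] := pfam01 a x mC.
    have v0 : 0 <= eta / dl ^+ 2 * v a x ^+ 2.
      by rewrite mulr_ge0 ?sqr_ge0// divr_ge0 ?sqr_ge0// ltW.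
    have [ew|dv] := far a x.
      by rewrite (le_trans _ v0)// mulr_ge0_le0// subr_le0.
    have v1 : eta <= eta / dl ^+ 2 * v a x ^+ 2.
      rewrite mulrAC ler_pdivlMr ?exprn_gt0//; apply: ler_wpM2l; first exact: ltW.
      rewrite -(real_normK (num_real (v a x))) lerXn2r// nnegrE//; exact: ltW.
    rewrite (le_trans _ v1)//.
    have := w0 a x; nra.
rewrite (mult_mean mC mm); apply/negP; rewrite -ltNge.
have c0 : 0 < fine (nu C) by rewrite fine_gt0// C0 ltey_eq fin_num_measure.
rewrite (@lt_le_trans _ _ ((eta - (size s)%:R * e ^+ 2) * fine (nu C)))//.
  by rewrite mulr_gt0// subr_gt0.
rewrite -(bint_indic nu mC) -bintZ; last exact: bmf_indic.
apply: ler_bint.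
- by apply: bmfZ; exact: bmf_indic.
- by apply: bmfM => //; exact: bmf_indic.
move=> b; rewrite mulrC indicE; case: (boolP (b \in C)) => [|_]; last by rewrite !mul0r.
rewrite inE => Cb; rewrite !mul1r lerD2l lerN2 /k.
rewrite -sum1_size natr_sum mulr_suml big_seq [leRHS]big_seq.
apply: ler_sum => g gs; rewrite mul1r -(real_normK (num_real (rho g b - t g))).
by rewrite lerXn2r// ?nnegrE// ?Ce// (le_trans _ (Ce g b gs Cb)).
Qed.

End poisson_representation_of_families.

Local Open Scope complex_scope.

(** * The quotient algebra and its characters *)

Section bounded_families_algebra.
Context {R : realType} {G : groupType}.
Notation V := (bfam R G).
Implicit Types u v r : V.

Lemma bfam_ext u v : (forall a x, u a x = v a x) -> u = v.
Proof.
by move=> uv; apply/val_inj; apply/funext => a; apply/funext => x; exact: uv.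
Qed.

Lemma bfamD u v a x : (u + v) a x = u a x + v a x. Proof. by []. Qed.
Lemma bfamB u v a x : (u - v) a x = u a x - v a x. Proof. by []. Qed.
Lemma bfamM u v a x : (u * v) a x = u a x * v a x. Proof. by []. Qed.
Lemma bfamZ k v a x : bscale k v a x = k * v a x. Proof. by []. Qed.
Lemma bfamC v a x : bconj v a x = (v a x)^*%C. Proof. by []. Qed.
Lemma bfam1 a x : (1 : V) a x = 1. Proof. by []. Qed.

Lemma bfamX v n a x : (v ^+ n) a x = v a x ^+ n.
Proof. by elim: n => [|n IH]; rewrite ?expr0// !exprS bfamM IH. Qed.

Lemma bfam_cbounded v : cbounded (fun p : abel_param R * G => v p.1 p.2).
Proof. by have /asboolP[M vM] := bfamP v; exists M => -[a x]; exact: vM. Qed.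

Lemma bfam_bound v : exists2 M : R, 0 < M & forall a x, `|v a x| <= M%:C.
Proof.
have /asboolP[M vM] := bfamP v; exists (`|M| + 1) => [|a x].
  by rewrite ltr_wpDl.
by rewrite (le_trans (vM a x))// lecR (le_trans (ler_norm M))// lerDl.
Qed.

Definition re v : abel_param R -> G -> R := fun a x => complex.Re (v a x).
Definition im v : abel_param R -> G -> R := fun a x => complex.Im (v a x).

Lemma bdd2_re v : bdd2 (re v). Proof. exact: cbounded_Re (bfam_cbounded v). Qed.
Lemma bdd2_im v : bdd2 (im v). Proof. exact: cbounded_Im (bfam_cbounded v). Qed.

Lemma Re_mul (z w : R[i]) :
  complex.Re (z * w) = complex.Re z * complex.Re w - complex.Im z * complex.Im w.
Proof. by case: z => a b; case: w. Qed.

Lemma Im_mul (z w : R[i]) :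
  complex.Im (z * w) = complex.Re z * complex.Im w + complex.Im z * complex.Re w.
Proof. by case: z => a b; case: w. Qed.

Lemma ReD (z w : R[i]) : complex.Re (z + w) = complex.Re z + complex.Re w.
Proof. by case: z => a b; case: w. Qed.

Lemma ImD (z w : R[i]) : complex.Im (z + w) = complex.Im z + complex.Im w.
Proof. by case: z => a b; case: w. Qed.

Lemma ReB (z w : R[i]) : complex.Re (z - w) = complex.Re z - complex.Re w.
Proof. by case: z => a b; case: w. Qed.

Lemma ImB (z w : R[i]) : complex.Im (z - w) = complex.Im z - complex.Im w.
Proof. by case: z => a b; case: w. Qed.

Lemma bounded_real_family (u : abel_param R -> G -> R) : bdd2 u ->
  bounded_family (fun a x => (u a x)%:C).
Proof.
move=> bu; have [M M0 uM] := bdd2P bu; apply/asboolP; exists M => a x.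
by rewrite normc_def /= expr0n addr0 sqrtr_sqr lecR ler_norml.
Qed.

Definition real_fam (u : abel_param R -> G -> R) (bu : bdd2 u) : V :=
  BFam (bounded_real_family bu).

Lemma normC_real (t : R) : `|t%:C| = `|t|%:C :> R[i].
Proof. by rewrite normc_def /= expr0n addr0 sqrtr_sqr. Qed.

Lemma normC_realE (z : R[i]) : exists t : R, `|z| = t%:C.
Proof. by exists (complex.Re `|z|); rewrite RRe_real ?normr_real. Qed.

Lemma normC_inv_le (z : R[i]) (t : R) : 0 < t -> t%:C <= `|z| ->
  `|z^-1| <= (t^-1)%:C.
Proof.
have [s sE] := normC_realE z; rewrite normfV sE -fmorphV !lecR => t0 ts.
by rewrite lef_pV2// posrE// (lt_le_trans t0).
Qed.

Lemma normC_small (z : R[i]) : (forall e : R, 0 < e -> `|z| <= e%:C) -> z = 0.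
Proof.
move=> h; apply/eqP; rewrite -normr_eq0.
have [t tE] := normC_realE z.
have t0 : 0 <= t by rewrite -lecR -tE normr_ge0.
rewrite tE in h *.
suff : t <= 0 by move=> t1; rewrite (_ : t = 0)//; apply/eqP; rewrite eq_le t1.
by apply/ler_addgt0Pr => e e0; rewrite add0r -lecR h.
Qed.

End bounded_families_algebra.

Lemma mulB_telescope (T : comPzRingType) (u v u' v' : T) :
  u' * v' - u * v = (u' - u) * v' + (v' - v) * u.
Proof. by rewrite mulrBl mulrBl (mulrC v' u) addrA subrK (mulrC v). Qed.

Section quotient.
Context {R : realType} {G : groupType}.
Variables (mu : G -> R) (muP : is_prob_mass mu) (mu_gen : generating mu).
Variables (U : set_system (abel_param R)) (UU : UltraFilter U).
Notation V := (bfam R G).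
Notation mean := (mean mu U).
Notation null_family := (null_family mu U).
Notation qproj := (qproj mu U).
Notation quot := (quot mu U).
Implicit Types u v r : V.

Let UF : ProperFilter U. Proof. exact: ultra_proper. Qed.

Lemma stateE v : state mu U v = mean (re v) +i* mean (im v).
Proof.
pose f (a : abel_param R) := cgsum (fun x => v a x * (abel_mean mu (val a) x)%:C).
have fE a : f a = avg (abel_mean mu (val a)) (re v a) +i*
    avg (abel_mean mu (val a)) (im v a).
  rewrite /f /cgsum /avg; apply/eqP; rewrite eq_complex /=; apply/andP.
  split; apply/eqP; congr gsum; apply/funext => x.
    by rewrite Re_mul /= mulr0 subr0.
  by rewrite Im_mul /= mulr0 add0r.
have bre := bounded_avg_abel muP (bdd2_re v).
have bim := bounded_avg_abel muP (bdd2_im v).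
rewrite /state -[X in lim (X @ _)]/f culim_lim//; last first.
  have [M bM] := bre; have [N bN] := bim; exists (M + N) => a.
  rewrite (le_trans (norm_le_ReIm _))// lecR fE /=; exact: lerD (bM a) (bN a).
rewrite /culim; apply/eqP; rewrite eq_complex /=; apply/andP.
by split; apply/eqP; congr ulim; apply/funext => a; have := fE a; rewrite /f /cgsum => -[].
Qed.

(** The state of |v|^2 is a sum of two nonnegative means, which vanishes only if both do. *)
Lemma null_familyE v : null_family v <-> null2 mu U (re v) /\ null2 mu U (im v).
Proof.
have b1 := bdd2_sqr (bdd2_re v); have b2 := bdd2_sqr (bdd2_im v).
have -> : null_family v <->
    mean (fun a x => re v a x ^+ 2) + mean (fun a x => im v a x ^+ 2) = 0.
  rewrite /Defs.null_family stateE.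
  have -> : re (bconj v * v) = fun a x => re v a x ^+ 2 + im v a x ^+ 2.
    apply/funext => a; apply/funext => x; rewrite /re /im bfamM /= Re_mul.
    by case: (v a x) => p q /=; rewrite mulNr opprK !expr2.
  have -> : im (bconj v * v) = fun _ _ => 0.
    apply/funext => a; apply/funext => x; rewrite /re /im bfamM /= Im_mul.
    by case: (v a x) => p q /=; rewrite mulNr mulrC subrr.
  rewrite (mean_cst muP UU) (meanD muP UU)//.
  by split => [[]|->].
have m1 := mean_ge0 muP UU b1 (fun a x => sqr_ge0 _).
have m2 := mean_ge0 muP UU b2 (fun a x => sqr_ge0 _).
rewrite /null2; split => [h|[-> ->]]; last by rewrite addr0.
by split; lra.
Qed.

Lemma null2_scale (c : R) (u : abel_param R -> G -> R) : bdd2 u ->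
  null2 mu U u -> null2 mu U (fun a x => c * u a x).
Proof.
move=> bu nu; under eq_fun do under eq_fun do rewrite mulrC.
by apply: (null_mul muP UU) => //; exact: bdd2_cst.
Qed.

Lemma null2_sub (u v : abel_param R -> G -> R) : bdd2 u -> bdd2 v ->
  null2 mu U u -> null2 mu U v ->
  null2 mu U (fun a x => u a x - v a x).
Proof.
move=> bu bv nu nv; under eq_fun do under eq_fun do rewrite -mulN1r.
by apply: (null_add muP UU) => //; [exact: bdd2_scale|exact: null2_scale].
Qed.

Lemma null0 : null_family 0.
Proof.
apply/null_familyE; split; rewrite /null2 -[RHS](mean_cst muP UU 0); congr (mean _);
  by apply/funext => a; apply/funext => x; rewrite /re /im /= expr0n.
Qed.

Lemma nullD u v : null_family u -> null_family v -> null_family (u + v).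
Proof.
move=> /null_familyE[u1 u2] /null_familyE[v1 v2]; apply/null_familyE; split.
  rewrite (_ : re _ = fun a x => re u a x + re v a x).
    by apply: (null_add muP UU) => //; exact: bdd2_re.
  by apply/funext => a; apply/funext => x; rewrite /re bfamD ReD.
rewrite (_ : im _ = fun a x => im u a x + im v a x).
  by apply: (null_add muP UU) => //; exact: bdd2_im.
by apply/funext => a; apply/funext => x; rewrite /im bfamD ImD.
Qed.

Lemma nullM u v : null_family u -> null_family (u * v).
Proof.
move=> /null_familyE[u1 u2]; apply/null_familyE.
have b1 := bdd2_re u; have b2 := bdd2_im u.
have c1 := bdd2_re v; have c2 := bdd2_im v.
split.
  rewrite (_ : re _ = fun a x => re u a x * re v a x - im u a x * im v a x).
    by apply: null2_sub; [exact: bdd2_mul..| |]; apply: (null_mul muP UU).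
  by apply/funext => a; apply/funext => x; rewrite /re bfamM Re_mul.
rewrite (_ : im _ = fun a x => re u a x * im v a x + im u a x * re v a x).
  by apply: (null_add muP UU); [exact: bdd2_mul..| |]; apply: (null_mul muP UU).
by apply/funext => a; apply/funext => x; rewrite /im bfamM Im_mul.
Qed.

Lemma nullN u : null_family u -> null_family (- u).
Proof. by move=> nu; rewrite -mulrN1; exact: nullM. Qed.

Lemma nullB u v : null_family u -> null_family v -> null_family (u - v).
Proof. by move=> nu nv; apply: nullD => //; exact: nullN. Qed.

Lemma null_conj u : null_family u -> null_family (bconj u).
Proof.
move=> /null_familyE[u1 u2]; apply/null_familyE; split.
  rewrite (_ : re _ = re u)//.
  by apply/funext => a; apply/funext => x; rewrite /re /=; case: (u a x).
rewrite (_ : im _ = fun a x => -1 * im u a x).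
  by apply: null2_scale => //; exact: bdd2_im.
by apply/funext => a; apply/funext => x; rewrite /im /= mulN1r; case: (u a x).
Qed.

Lemma null_btranslate g u : null_family u -> null_family (btranslate g u).
Proof.
move=> /null_familyE[u1 u2]; apply/null_familyE.
have := null_translate muP mu_gen UU g^-1%g (bdd2_re u) u1.
by have := null_translate muP mu_gen UU g^-1%g (bdd2_im u) u2.
Qed.

Lemma qprojP u v : qproj u = qproj v <-> null_family (u - v).
Proof.
split=> [|uv].
  move=> /(congr1 sval) /= /(congr1 (fun A => A u)) /= h.
  have : null_coset mu U u u by rewrite /null_coset /= subrr; exact: null0.
  by rewrite h.
apply: eq_exist; apply/seteqP; split => w /=; rewrite /null_coset /= => nw.
  by rewrite (_ : w - v = (w - u) + (u - v)); [exact: nullD|rewrite addrA subrK].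
by rewrite (_ : w - u = (w - v) - (u - v)); [exact: nullB|rewrite opprB addrA subrK].
Qed.

Lemma qrepK (c : quot) : qproj (qrep c) = c.
Proof.
case: c => C hC; apply: eq_exist; rewrite /qrep.
by case: cid => v /= ->.
Qed.

Lemma qrep_null v : null_family (qrep (qproj v) - v).
Proof. by apply/qprojP; exact: qrepK. Qed.

Lemma qaddE u v : qadd (qproj u) (qproj v) = qproj (u + v).
Proof.
apply/qprojP; rewrite opprD addrACA.
by apply: nullD; exact: qrep_null.
Qed.

Lemma qsubE u v : qsub (qproj u) (qproj v) = qproj (u - v).
Proof.
apply/qprojP; have nu := qrep_null u; have nv := qrep_null v.
set u' := qrep _ in nu *; set v' := qrep _ in nv *.
rewrite (_ : _ - _ = (u' - u) - (v' - v)); first exact: nullB nu nv.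
by rewrite !opprB addrACA [in RHS]addrACA; congr (_ + _); rewrite addrC.
Qed.

Lemma qmulE u v : qmul (qproj u) (qproj v) = qproj (u * v).
Proof.
apply/qprojP; have nu := qrep_null u; have nv := qrep_null v.
set u' := qrep _ in nu *; set v' := qrep _ in nv *.
rewrite mulB_telescope.
by apply: nullD; [exact: nullM _ nu|exact: nullM _ nv].
Qed.

Lemma bscaleE k v : bscale k v = bscale k 1 * v.
Proof. by apply: bfam_ext => a x; rewrite bfamM /= mulr1. Qed.

Lemma qscaleE k v : qscale k (qproj v) = qproj (bscale k v).
Proof.
apply/qprojP; rewrite bscaleE (bscaleE k v) -mulrBr mulrC.
by apply: nullM; exact: qrep_null.
Qed.

Lemma bconjB u v : bconj u - bconj v = bconj (u - v).
Proof. by apply: bfam_ext => a x; rewrite !bfamB /= rmorphB. Qed.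

Lemma qconjE v : qconj (qproj v) = qproj (bconj v).
Proof.
by apply/qprojP; rewrite bconjB; apply: null_conj; exact: qrep_null.
Qed.

Lemma sup_norm_le v (M : R) : (forall a x, `|v a x| <= M%:C) -> sup_norm v <= M.
Proof.
move=> vM; have a0 : abel_param R by exists (3 / 4); apply/andP; split; lra.
apply: ge_sup; first by exists (complex.Re `|v a0 1%g|), a0, 1%g.
by move=> _ [a [x ->]]; rewrite -lecR RRe_real ?normr_real.
Qed.

Lemma sup_norm_ge v a x : `|v a x| <= (sup_norm v)%:C.
Proof.
have [M M0 vM] := bfam_bound v.
rewrite -[leLHS]RRe_real ?normr_real// lecR; apply: ub_le_sup.
  by exists M => _ [b [y ->]]; rewrite -lecR RRe_real ?normr_real.
by exists a, x.
Qed.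

Lemma qnorm_le v (M : R) : (forall a x, `|v a x| <= M%:C) -> qnorm (qproj v) <= M.
Proof.
move=> vM; apply: le_trans (sup_norm_le vM); apply: ge_inf; last first.
  by exists v => //=; rewrite /null_coset /= subrr; exact: null0.
exists 0 => _ [w _ <-]; rewrite -lecR.
have a0 : abel_param R by exists (3 / 4); apply/andP; split; lra.
exact: le_trans (normr_ge0 _) (sup_norm_ge w a0 1%g).
Qed.

(** Through such representatives, norm limits in the quotient become uniform limits of families. *)
Lemma qnorm_lt (c : quot) (e : R) : qnorm c < e ->
  exists w, qproj w = c /\ forall a x, `|w a x| <= e%:C.
Proof.
move=> ce; have [|x [w cw <-] we] := inf_lt _ ce.
  exists (sup_norm (qrep c)), (qrep c) => //.
  rewrite -{1}(qrepK c) /= /null_coset /= subrr; exact: null0.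
exists w; split => [|a y]; last first.
  by rewrite (le_trans (sup_norm_ge w a y))// lecR ltW.
by rewrite -(qrepK c); apply/qprojP; move: cw; rewrite -{1}(qrepK c).
Qed.

Definition inA v := rn_algebra mu U (qproj v).

Lemma rn_algebra_cstar : cstar_subalgebra (rn_algebra mu U).
Proof.
split; first split.
- by move=> S [[[]]].
- by move=> c d Ac Ad S SS; have [[[_ h] _ _ _ _] _] := SS; exact: h (Ac _ SS) (Ad _ SS).
- by move=> c d Ac Ad S SS; have [[_ h _ _ _] _] := SS; exact: h (Ac _ SS) (Ad _ SS).
- by move=> k c Ac S SS; have [[_ _ h _ _] _] := SS; exact: h (Ac _ SS).
- by move=> c Ac S SS; have [[_ _ _ h _] _] := SS; exact: h (Ac _ SS).
- move=> c H S SS; have [[_ _ _ _ h] _] := SS; apply: h => e e0.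
  by have [d Ad de] := H e e0; exists d => //; exact: Ad.
Qed.

Lemma inA_null u v : null_family (u - v) -> inA u -> inA v.
Proof. by move=> /qprojP uv; rewrite /inA uv. Qed.

Lemma inA0 : inA 0. Proof. by have [[]] := rn_algebra_cstar. Qed.

Lemma inAD u v : inA u -> inA v -> inA (u + v).
Proof. by rewrite /inA -qaddE; have [[_ h] _ _ _ _] := rn_algebra_cstar; exact: h. Qed.

Lemma inAM u v : inA u -> inA v -> inA (u * v).
Proof. by rewrite /inA -qmulE; have [_ h _ _ _] := rn_algebra_cstar; exact: h. Qed.

Lemma inAZ k v : inA v -> inA (bscale k v).
Proof. by rewrite /inA -qscaleE; have [_ _ h _ _] := rn_algebra_cstar; exact: h. Qed.

Lemma inA_conj v : inA v -> inA (bconj v).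
Proof. by rewrite /inA -qconjE; have [_ _ _ h _] := rn_algebra_cstar; exact: h. Qed.

Lemma inA_lim v : (forall e : R, 0 < e -> exists2 w, inA w &
  forall a x, `|v a x - w a x| <= e%:C) -> inA v.
Proof.
move=> H; have [_ _ _ _ h] := rn_algebra_cstar; apply: h => e e0.
have e2 : 0 < e / 2 by rewrite divr_gt0.
have [w Aw vw] := H _ e2; exists (qproj w) => //.
by rewrite qsubE (@le_lt_trans _ _ (e / 2))//; [exact: qnorm_le|lra].
Qed.

Definition rnV g : V := real_fam (bdd2_rn muP mu_gen g).

Lemma rnVE g a x : rnV g a x = (rn mu g a x)%:C. Proof. by []. Qed.

Lemma inA_rn g : inA (rnV g).
Proof. by move=> S [_ h]; apply: h; exists g, (rnV g). Qed.

(** The classes in the algebra whose representative satisfies [S] form a C*-subalgebra containing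
    the generators. Inducting on families, with one case for null differences, avoids chosen
    representatives in later proofs. *)
Lemma inA_ind (S : V -> Prop) :
  (forall u v, null_family (u - v) -> S u -> S v) -> S 0 ->
  (forall u v, inA u -> inA v -> S u -> S v -> S (u + v)) ->
  (forall u v, inA u -> inA v -> S u -> S v -> S (u * v)) ->
  (forall k v, inA v -> S v -> S (bscale k v)) ->
  (forall v, inA v -> S v -> S (bconj v)) ->
  (forall v, inA v -> (forall e : R, 0 < e -> exists w, [/\ inA w, S w &
     forall a x, `|v a x - w a x| <= e%:C]) -> S v) ->
  (forall g, S (rnV g)) -> forall v, inA v -> S v.
Proof.
move=> Snull S0 SD SM SZ SC Slim Srn v Av.
pose T := [set c : quot | rn_algebra mu U c /\ S (qrep c)].
have TE w : T (qproj w) <-> inA w /\ S w.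
  split => -[Aw Sw]; split => //; first exact: Snull (qrep_null w) Sw.
  by apply: Snull Sw; rewrite -opprB; apply: nullN; exact: qrep_null.
suff : T (qproj v) by move/TE => -[].
apply: Av; split; last first.
  move=> _ [g [w [wE ->]]]; have -> : w = rnV g by exact: val_inj.
  by apply/TE; split => //; exact: inA_rn.
split; first split.
- by apply/TE; split => //; exact: inA0.
- move=> c d; rewrite -(qrepK c) -(qrepK d) => /TE[Ac Sc] /TE[Ad Sd].
  by rewrite qaddE; apply/TE; split; [exact: inAD|exact: SD].
- move=> c d; rewrite -(qrepK c) -(qrepK d) => /TE[Ac Sc] /TE[Ad Sd].
  by rewrite qmulE; apply/TE; split; [exact: inAM|exact: SM].
- move=> k c; rewrite -(qrepK c) => /TE[Ac Sc].
  by rewrite qscaleE; apply/TE; split; [exact: inAZ|exact: SZ].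
- move=> c; rewrite -(qrepK c) => /TE[Ac Sc].
  by rewrite qconjE; apply/TE; split; [exact: inA_conj|exact: SC].
move=> c; rewrite -(qrepK c); move: (qrep c) => w H.
have lim e : 0 < e -> exists z, [/\ inA z, S z & forall a x, `|w a x - z a x| <= e%:C].
  move=> e0; have [d] := H e e0; rewrite -(qrepK d) => /TE[Ad Sd].
  (* [z] is a small representative of the class of w - d; hence [w - z] represents [d] and is
     uniformly close to [w]. *)
  rewrite qsubE => /qnorm_lt[z [zE ze]]; exists (w - z).
  have nz : null_family (qrep d - (w - z)).
    move/qprojP : zE => /nullD; rewrite (_ : _ - (w - z) = (z - (w - qrep d))) => [nz|].
      by have := nz 0 null0; rewrite addr0.
    by rewrite !opprB addrCA addrA addrC addrA addrAC.
  split => [||a x]; [exact: inA_null nz Ad|exact: Snull nz Sd|].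
  by rewrite bfamB opprB addrCA subrr addr0.
have Aw : inA w by apply: inA_lim => e /lim[z [Az _ wz]]; exists z.
by apply/TE; split => //; exact: Slim.
Qed.

End quotient.

(** * Automatic continuity and symmetry of characters *)

Section characters.
Context {R : realType} {G : groupType}.
Variables (mu : G -> R) (muP : is_prob_mass mu) (mu_gen : generating mu).
Variables (U : set_system (abel_param R)) (UU : UltraFilter U).
Notation V := (bfam R G).
Notation null_family := (null_family mu U).
Notation qproj := (qproj mu U).
Notation inA := (inA mu U).
Notation rnV := (rnV muP mu_gen).
Notation spec := (spectrum mu U).
Implicit Types u v r : V.
Implicit Types chi : spec.

Lemma rnV1 : rnV 1%g = 1.
Proof.
by apply: bfam_ext => a x; rewrite bfam1 /= rn_id.
Qed.

Lemma inA1 : inA 1. Proof. by rewrite -rnV1; exact: inA_rn. Qed.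

Lemma inAB u v : inA u -> inA v -> inA (u - v).
Proof.
move=> Au Av; rewrite (_ : u - v = u + bscale (-1) v).
  by apply: (inAD muP UU) => //; exact: inAZ.
by apply: bfam_ext => a x; rewrite bfamB bfamD /= mulN1r.
Qed.

Lemma inAX v n : inA v -> inA (v ^+ n).
Proof.
move=> Av; elim: n => [|n IH]; first by rewrite expr0; exact: inA1.
by rewrite exprS; exact: inAM.
Qed.

(** The Neumann series of r: after n terms the remainder is [r' * (1 - r) ^+ n], uniformly at most C
    k^n because the family [r'] is bounded. *)
Lemma inA_inv r r' (k : R) : inA r -> k < 1 ->
  (forall a x, `|1 - r a x| <= k%:C) -> r' * r = 1 -> inA r'.
Proof.
move=> Ar k1 rk r'r; have [C C0 r'C] := bfam_bound r'.
have k0 : 0 <= k.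
  have a0 : abel_param R by exists (3 / 4); apply/andP; split; lra.
  by rewrite -lecR; exact: le_trans (normr_ge0 _) (rk a0 1%g).
apply: (inA_lim muP UU) => e e0.
have [n ne] : exists n, C * k ^+ n <= e.
  have : (geometric C k) @ \oo --> (0 : R).
    by apply: cvg_geometric; rewrite ger0_norm.
  move/cvgrPdist_le => /(_ e e0) [n _ /(_ n (leqnn n)) /= h].
  exists n; move: h; rewrite sub0r normrN ger0_norm//.
  by rewrite mulr_ge0 ?exprn_ge0// ltW.
exists (\sum_(i < n) (1 - r) ^+ i).
  elim: n {ne} => [|n IH]; first by rewrite big_ord0; exact: inA0.
  rewrite big_ord_recr /=; apply: (inAD muP UU) => //.
  by apply: inAX; apply: inAB => //; exact: inA1.
move=> a x; rewrite -bfamB.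
have -> : r' - \sum_(i < n) (1 - r) ^+ i = r' * (1 - r) ^+ n.
  have := subrX1 (1 - r) n; set s := \sum_(i < n) _; set t := (1 - r) ^+ n => h.
  have -> : t = 1 - r * s by move/(congr1 (fun z => z + 1)) : h; rewrite subrK => ->; ring.
  by rewrite mulrBr mulr1 mulrA r'r mul1r.
rewrite bfamM bfamX normrM normrX.
rewrite (@le_trans _ _ (C * k ^+ n)%:C) ?lecR// rmorphM rmorphXn /=.
apply: ler_pM => //.
by apply: lerXn2r; rewrite ?nnegrE// (le_trans _ (rk a x)).
Qed.

Definition qclass v (h : inA v) : rn_algebra mu U :=
  exist _ (qproj v) (mem_set (h : rn_algebra mu U (qproj v))).

(** Characters are evaluated on families rather than on cosets; the value 0 outside the algebra is a
    default. *)
Definition ev chi v : R[i] :=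
  if pselect (inA v) is left h then val chi (qclass h) else 0.

Lemma evE chi v (c : rn_algebra mu U) : inA v -> val c = qproj v -> val chi c = ev chi v.
Proof.
move=> Av cv; rewrite /ev; case: pselect => // h.
by congr (val chi _); apply: val_inj.
Qed.

Lemma ev_qrep chi (c : rn_algebra mu U) : val chi c = ev chi (qrep (val c)).
Proof.
have cE := qrepK (val c).
by apply: evE; rewrite /inA cE//; exact: set_valP.
Qed.

Let charP chi : is_character (val chi). Proof. exact: set_valP. Qed.

Lemma ev_null chi u v : null_family (u - v) -> inA u -> ev chi u = ev chi v.
Proof.
move=> uv Au; have Av := inA_null muP UU uv Au.
rewrite -(@evE chi u (qclass Au))// -(@evE chi v (qclass Au))//=.
exact/(qprojP muP UU).
Qed.

Lemma evD chi u v : inA u -> inA v -> ev chi (u + v) = ev chi u + ev chi v.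
Proof.
move=> Au Av; have Auv := inAD muP UU Au Av; have [h _ _ _] := charP chi.
rewrite -(@evE chi u (qclass Au))// -(@evE chi v (qclass Av))// -(@evE chi _ (qclass Auv))//.
by apply: h; rewrite /= qaddE.
Qed.

Lemma evM chi u v : inA u -> inA v -> ev chi (u * v) = ev chi u * ev chi v.
Proof.
move=> Au Av; have Auv := inAM muP UU Au Av; have [_ h _ _] := charP chi.
rewrite -(@evE chi u (qclass Au))// -(@evE chi v (qclass Av))// -(@evE chi _ (qclass Auv))//.
by apply: h; rewrite /= qmulE.
Qed.

Lemma evZ chi k v : inA v -> ev chi (bscale k v) = k * ev chi v.
Proof.
move=> Av; have Akv := inAZ muP UU k Av; have [_ _ h _] := charP chi.
rewrite -(@evE chi v (qclass Av))// -(@evE chi _ (qclass Akv))//.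
by apply: h; rewrite /= qscaleE.
Qed.

Lemma ev1 chi : ev chi 1 = 1.
Proof.
have [_ _ _ [c]] := charP chi; rewrite ev_qrep.
have Ac : inA (qrep (val c)) by rewrite /inA (qrepK); exact: set_valP.
move=> c0; have := evM chi Ac inA1; rewrite mulr1 => /eqP.
by rewrite -{1}[ev chi _]mulr1 => /eqP /(mulfI c0).
Qed.

Lemma evB chi u v : inA u -> inA v -> ev chi (u - v) = ev chi u - ev chi v.
Proof.
move=> Au Av; by have := evD chi (inAB Au Av) Av; rewrite subrK => ->; rewrite addrK.
Qed.

(** Continuity is not part of [is_character]; it follows from multiplicativity and from the
    closedness of the algebra. *)
Lemma ev_bound chi v (M : R) : inA v -> (forall a x, `|v a x| <= M%:C) ->
  `|ev chi v| <= M%:C.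
Proof.
move=> Av vM; have a0 : abel_param R by exists (3 / 4); apply/andP; split; lra.
have M0 : 0 <= M by rewrite -lecR; exact: le_trans (normr_ge0 _) (vM a0 1%g).
set l := ev chi v; rewrite -[`|l|]RRe_real ?normr_real// lecR leNgt.
apply/negP => Ml; set t := complex.Re `|l| in Ml.
have tE : `|l| = t%:C by rewrite RRe_real ?normr_real.
have t0 : 0 < t by exact: le_lt_trans Ml.
have l0 : l != 0 by rewrite -normr_gt0 tE ltcR.
(* Otherwise the Neumann series inverts [1 - v / l], which [chi] kills. *)
pose r := 1 - bscale l^-1 v.
have Ar : inA r by apply: inAB; [exact: inA1|exact: inAZ].
have rk a x : `|1 - r a x| <= (M / t)%:C.
  rewrite bfamB bfam1 opprB addrCA subrr addr0 /= normrM normfV tE.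
  rewrite rmorphM mulrC fmorphV ler_wpM2r ?vM// invr_ge0 (ler0c _).
  exact: ltW.
have k1 : M / t < 1 by rewrite ltr_pdivrMr// mul1r.
have low a x : (1 - M / t)%:C <= `|r a x|.
  have := ler_normB 1 (1 - r a x); rewrite opprB addrCA subrr addr0 normr1.
  move=> _; rewrite rmorphB /= lerBlDr.
  rewrite (@le_trans _ _ (`|r a x| + `|1 - r a x|))//; last by rewrite lerD2l.
  by rewrite (le_trans _ (ler_normD _ _))// addrC subrK normr1.
have r0 a x : r a x != 0.
  by rewrite -normr_gt0 (lt_le_trans _ (low a x))// ltcR subr_gt0.
have br' : bounded_family (fun a x => (r a x)^-1).
  apply/asboolP; exists (1 - M / t)^-1 => a x.
  by apply: normC_inv_le; [rewrite subr_gt0|exact: low].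
pose r' : V := BFam br'.
have r'r : r' * r = 1 by apply: bfam_ext => a x; rewrite bfamM; exact: mulVf (r0 a x).
have Ar' := inA_inv Ar k1 rk r'r.
have := evM chi Ar' Ar; rewrite r'r ev1 evB; [|exact: inA1|exact: inAZ].
rewrite ev1 evZ// mulVf// subrr mulr0 => /eqP.
by rewrite oner_eq0.
Qed.

Lemma ev_real chi v : inA v -> (forall a x, im v a x = 0) -> complex.Im (ev chi v) = 0.
Proof.
move=> Av v0; have [M M0 vM] := bfam_bound v.
case E : (ev chi v) => [p q] /=; apply/eqP; apply: contraT => q0.
(* Arens' trick: bound [ev (v + i t)] and let [t] vary. *)
have key (t : R) : p ^+ 2 + (q + t) ^+ 2 <= M ^+ 2 + t ^+ 2.
  have Aw : inA (v + bscale (0 +i* t) 1).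
    by apply: (inAD muP UU) => //; apply: inAZ => //; exact: inA1.
  have wM a x : `|(v + bscale (0 +i* t) 1 : V) a x| <= (Num.sqrt (M ^+ 2 + t ^+ 2))%:C.
    rewrite bfamD bfamZ bfam1 mulr1.
    have := vM a x; have := v0 a x; rewrite /im; case: (v a x) => z1 z2 /= ->.
    rewrite normc_def /= expr0n addr0 sqrtr_sqr lecR => zM.
    rewrite normc_def /= lecR ler_wsqrtr// addr0 add0r.
    by rewrite lerD2r -(real_normK (num_real z1)) lerXn2r// nnegrE ltW.
  have := ev_bound chi Aw wM.
  rewrite evD//; last by apply: inAZ => //; exact: inA1.
  rewrite evZ; last exact: inA1.
  rewrite ev1 mulr1 E.
  have -> : p +i* q + 0 +i* t = p +i* (q + t) by apply/eqP; rewrite eq_complex /= addr0 !eqxx.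
  rewrite normc_def /= lecR => h.
  by move: h; rewrite ler_sqrt// addr_ge0 ?sqr_ge0.
(* For this t, 2 q t = M^2 + 1, and the inequality would become p^2 + q^2 + 1 <= 0. *)
have := key ((M ^+ 2 + 1) / (2 * q)); set t := _ / _ => ht.
have tq : 2 * q * t = M ^+ 2 + 1 by rewrite /t mulrC divfK// mulf_neq0.
by have := sqr_ge0 p; have := sqr_ge0 q; nra.
Qed.

(** Both v + bconj v and i (v - bconj v) are real families, so their values are real. *)
Lemma ev_conj chi v : inA v -> ev chi (bconj v) = (ev chi v)^*%C.
Proof.
move=> Av; have Ac := inA_conj muP UU Av.
pose p := v + bconj v; pose q := bscale 'i%C (v - bconj v).
have Ap : inA p by exact: (inAD muP UU).
have Aq : inA q by apply: inAZ => //; exact: inAB.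
have p0 : forall a x, im p a x = 0.
  by move=> a x; rewrite /im bfamD /=; case: (v a x) => b c /=; rewrite subrr.
have q0 : forall a x, im q a x = 0.
  move=> a x; rewrite /im bfamZ bfamB bfamC; case: (v a x) => b c /=.
  by rewrite mul1r mul0r add0r subrr.
have := ev_real chi Aq q0; have := ev_real chi Ap p0.
rewrite evD// evZ; last exact: inAB.
rewrite evB//; case: (ev chi v) => b c; case: (ev chi (bconj v)) => b' c' /=.
rewrite mul0r mul1r add0r => h1 h2.
by apply/eqP; rewrite eq_complex /=; apply/andP; split; apply/eqP; lra.
Qed.

Lemma ev_ext chi chi' : (forall g, ev chi (rnV g) = ev chi' (rnV g)) ->
  forall v, inA v -> ev chi v = ev chi' v.
Proof.
move=> Erw v Av; suff [] : inA v /\ ev chi v = ev chi' v by [].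
apply: (inA_ind (muP := muP) (mu_gen := mu_gen) UU
  (S := fun v => inA v /\ ev chi v = ev chi' v)) Av => {v}.
- move=> u v uv [Au Eu]; split; first exact: inA_null uv Au.
  by move: (ev_null chi uv Au) (ev_null chi' uv Au) => <- <-.
- by split; [exact: inA0|rewrite -(subrr 1) !evB ?ev1//; exact: inA1].
- by move=> u v _ _ [Au Eu] [Av Ev]; split; [exact: inAD|rewrite !evD// Eu Ev].
- by move=> u v _ _ [Au Eu] [Av Ev]; split; [exact: inAM|rewrite !evM// Eu Ev].
- by move=> k v _ [Av Ev]; split; [exact: inAZ|rewrite !evZ// Ev].
- by move=> v _ [Av Ev]; split; [exact: inA_conj|rewrite !ev_conj// Ev].
- move=> v Av H; split => //; apply/eqP; rewrite -subr_eq0; apply/eqP.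
  apply: normC_small => e e0.
  have e2 : 0 < e / 2 by rewrite divr_gt0.
  have [w [Aw [_ Ew] vw]] := H _ e2.
  rewrite (_ : _ - _ = (ev chi v - ev chi w) - (ev chi' v - ev chi' w)); last first.
    by rewrite Ew opprB addrA subrK.
  rewrite (le_trans (ler_normB _ _))// -!evB// [e]splitr rmorphD /= lerD//.
    by apply: ev_bound => //; exact: inAB.
  by apply: ev_bound => //; exact: inAB.
- by move=> g; split => //; exact: inA_rn.
Qed.

(** A point of the spectrum is thus described by its values on the generators, countably many when G
    is countable; these are its coordinates from now on. *)
Lemma spectrum_ext chi chi' : (forall g, ev chi (rnV g) = ev chi' (rnV g)) -> chi = chi'.
Proof.
move=> Erw; apply: val_inj; apply/funext => c.
rewrite !ev_qrep; apply: ev_ext => //.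
by rewrite /inA (qrepK); exact: set_valP.
Qed.

End characters.

Section complex_ultralimit_algebra.
Context {R : realType} {T : Type}.
Variables (F : set_system T) (FU : UltraFilter F).
Implicit Types f g : T -> R[i].
Let FF : ProperFilter F. Proof. exact: ultra_proper. Qed.

Lemma culim_unique f (l : R[i]) : cbounded f -> f @ F --> l -> culim F f = l.
Proof.
by move=> bf fl; rewrite -culim_lim//; apply: cvg_lim; [exact: norm_hausdorff|].
Qed.

Lemma culim_cst (c : R[i]) : culim F (fun=> c) = c.
Proof. by rewrite /culim !ulim_cst//; case: c. Qed.

Lemma cboundedD f g : cbounded f -> cbounded g -> cbounded (fun t => f t + g t).
Proof.
move=> [M fM] [N gN]; exists (M + N) => t.
by rewrite rmorphD (le_trans (ler_normD _ _))// lerD.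
Qed.

Lemma cboundedM f g : cbounded f -> cbounded g -> cbounded (fun t => f t * g t).
Proof.
move=> [M fM] [N gN]; exists (M * N) => t.
by rewrite rmorphM normrM ler_pM.
Qed.

Lemma culimD f g : cbounded f -> cbounded g ->
  culim F (fun t => f t + g t) = culim F f + culim F g.
Proof.
move=> bf bg; apply: culim_unique; first exact: cboundedD.
by apply: cvgD; exact: culim_cvg.
Qed.

Lemma culimM f g : cbounded f -> cbounded g ->
  culim F (fun t => f t * g t) = culim F f * culim F g.
Proof.
move=> bf bg; apply: culim_unique; first exact: cboundedM.
by apply: cvgM; exact: culim_cvg.
Qed.

Lemma culimZ (k : R[i]) f : cbounded f -> culim F (fun t => k * f t) = k * culim F f.
Proof.
move=> bf; rewrite culimM ?culim_cst//.
have [t tE] := normC_realE k.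
by exists t => _; rewrite tE.
Qed.

End complex_ultralimit_algebra.

Lemma ptws_cvg (I : Type) (T : topologicalType) (H : set_system (I -> T))
    (f : {ptws I -> T}) : Filter H ->
  (forall i, g i @[g --> H] --> f i) -> H --> (f : {ptws I -> T}).
Proof.
move=> FH Hf; apply/cvg_sup => i A /= [_ [[D oD <-] Df DA]].
have /Hf : nbhs (f i) D by exact: open_nbhs_nbhs.
by move=> HD; exact: (@filterS _ H FH _ _ DA HD).
Qed.

Lemma ptws_eval_continuous (I : Type) (T : topologicalType) (i : I) :
  continuous (fun f : {ptws I -> T} => f i).
Proof.
move=> f A fA; have /cvg_sup/(_ i) fi : nbhs f --> f by exact: cvg_id.
by apply: fi; exact: (@initial_continuous _ _ (fun f : I -> T => f i) f A).
Qed.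

(** * The spectrum of the Radon-Nikodym algebra *)

Section spectrum_topology.
Context {R : realType} {G : groupType}.
Variables (mu : G -> R) (muP : is_prob_mass mu) (mu_gen : generating mu).
Variables (U : set_system (abel_param R)) (UU : UltraFilter U).
Notation V := (bfam R G).
Notation null_family := (null_family mu U).
Notation qproj := (qproj mu U).
Notation inA := (inA mu U).
Notation rnV := (rnV muP mu_gen).
Notation spec := (spectrum mu U).
Implicit Types u v r : V.
Implicit Types chi : spec.

Definition character_of (f : rn_algebra mu U -> R[i]) (fP : is_character f) : spec :=
  exist _ (f : {ptws rn_algebra mu U -> R[i]}) (mem_set fP).

Lemma inA_qrep (c : rn_algebra mu U) : inA (qrep (val c)).
Proof. by rewrite /inA qrepK; exact: set_valP. Qed.

Lemma null_qrepD (c d z : rn_algebra mu U) : val z = qadd (val c) (val d) ->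
  null_family (qrep (val z) - (qrep (val c) + qrep (val d))).
Proof. by move=> ->; exact: qrep_null. Qed.

Lemma null_qrepM (c d z : rn_algebra mu U) : val z = qmul (val c) (val d) ->
  null_family (qrep (val z) - (qrep (val c) * qrep (val d))).
Proof. by move=> ->; exact: qrep_null. Qed.

Lemma null_qrepZ k (c z : rn_algebra mu U) : val z = qscale k (val c) ->
  null_family (qrep (val z) - bscale k (qrep (val c))).
Proof. by move=> ->; exact: qrep_null. Qed.

Lemma is_character_of (f : V -> R[i]) :
  (forall u v, null_family (u - v) -> inA u -> inA v -> f u = f v) ->
  (forall u v, inA u -> inA v -> f (u + v) = f u + f v) ->
  (forall u v, inA u -> inA v -> f (u * v) = f u * f v) ->
  (forall k v, inA v -> f (bscale k v) = k * f v) -> f 1 = 1 ->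
  is_character (fun c : rn_algebra mu U => f (qrep (val c))).
Proof.
move=> f0 fD fM fZ f1; split.
- move=> c d z /null_qrepD zE; rewrite -fD; try exact: inA_qrep.
  by apply: f0 => //; [exact: inA_qrep|apply: inAD => //; exact: inA_qrep].
- move=> c d z /null_qrepM zE; rewrite -fM; try exact: inA_qrep.
  by apply: f0 => //; [exact: inA_qrep|apply: inAM => //; exact: inA_qrep].
- move=> k c z /null_qrepZ zE; rewrite -fZ; try exact: inA_qrep.
  by apply: f0 => //; [exact: inA_qrep|apply: inAZ => //; exact: inA_qrep].
have A1 : inA 1 by exact: inA1.
exists (qclass A1) => /=.
rewrite (f0 _ 1) ?f1 ?oner_neq0//; first exact: qrep_null.
exact: (inA_qrep (qclass A1)).
Qed.

Section from_functional.
Variable (f : V -> R[i]).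
Hypothesis fP : is_character (fun c : rn_algebra mu U => f (qrep (val c))).
Hypothesis f0 : forall u v, null_family (u - v) -> inA u -> inA v -> f u = f v.

Lemma ev_character_of v : inA v -> ev (character_of fP) v = f v.
Proof.
move=> Av; rewrite -(@evE _ _ _ _ _ v (qclass Av))//=.
apply: f0 => //; [exact: qrep_null|exact: (inA_qrep (qclass Av))].
Qed.

End from_functional.

Section from_ultrafilter.
Variables (W : set_system (abel_param R * G)) (WU : UltraFilter W).
Let wval v := culim W (fun p => v p.1 p.2).
Hypothesis W_null : forall v, null_family v -> wval v = 0.

Let wvalB0 u v : null_family (u - v) -> inA u -> inA v -> wval u = wval v.
Proof.
move=> /W_null; rewrite /wval => uv _ _.
rewrite -[u in LHS](subrK v); under eq_fun do rewrite bfamD.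
by rewrite (culimD WU (bfam_cbounded (u - v)) (bfam_cbounded v)) uv add0r.
Qed.

Lemma is_character_culim : is_character (fun c : rn_algebra mu U => wval (qrep (val c))).
Proof.
apply: is_character_of => //.
- by move=> u v _ _; have := culimD WU (bfam_cbounded u) (bfam_cbounded v).
- by move=> u v _ _; have := culimM WU (bfam_cbounded u) (bfam_cbounded v).
- by move=> k v _; have := culimZ WU k (bfam_cbounded v).
- exact: culim_cst.
Qed.

(** Evaluation at one pair (a, x) is multiplicative on families but need not vanish on null ones; a
    limit along [W] does, by assumption. *)
Lemma character_of_ultrafilter : exists chi, forall v, inA v -> ev chi v = wval v.
Proof.
by exists (character_of is_character_culim) => v Av; rewrite (ev_character_of is_character_culim).
Qed.

End from_ultrafilter.

Lemma spectrum_cvg (F : set_system spec) (FF : Filter F) chi :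
  (forall v, inA v -> ev chi' v @[chi' --> F] --> ev chi v) -> F --> chi.
Proof.
move=> Fc.
have ptw : (val chi' : {ptws rn_algebra mu U -> R[i]}) @[chi' --> F] -->
    (val chi : {ptws rn_algebra mu U -> R[i]}).
  apply: ptws_cvg => c; rewrite ev_qrep.
  have := Fc _ (inA_qrep c).
  rewrite (_ : (fun chi' : spec => ev chi' _) =
    (fun chi' : spec => (val chi' : rn_algebra mu U -> R[i]) c))//.
  by apply/funext => chi'; rewrite ev_qrep.
move=> A /= [_ [[D oD <-] Dc DA]].
have /ptw : nbhs (val chi : {ptws rn_algebra mu U -> R[i]}) D by exact: open_nbhs_nbhs.
by move=> FD; exact: (@filterS _ F FF _ _ DA FD).
Qed.

Lemma continuous_ev v : inA v -> continuous (fun chi => ev chi v).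
Proof.
move=> Av chi.
have c1 : (val chi' : {ptws rn_algebra mu U -> R[i]}) @[chi' --> chi] -->
    (val chi : {ptws rn_algebra mu U -> R[i]}) by exact: initial_continuous.
have := continuous_comp c1 (@ptws_eval_continuous _ _ (qclass Av) (val chi)).
rewrite (_ : (fun f => f (qclass Av)) \o _ = fun chi' : spec => ev chi' v)//.
by apply/funext => chi' /=; rewrite (evE chi' Av).
Qed.

(** Characters are uniformly bounded on each family, so they converge pointwise along an
    ultrafilter; the normalization at 1 keeps the limit nonzero. *)
Lemma compact_spectrum : compact [set: spec].
Proof.
rewrite compact_ultra => F FU _.
pose f v := culim F (fun chi => ev chi v).
have bf v : inA v -> cbounded (fun chi : spec => ev chi v).
  move=> Av; have [M _ vM] := bfam_bound v; exists M => chi.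
  exact: ev_bound vM.
have f0 u v : null_family (u - v) -> inA u -> inA v -> f u = f v.
  move=> uv Au Av; rewrite /f; congr culim; apply/funext => chi.
  exact: ev_null.
have fP : is_character (fun c : rn_algebra mu U => f (qrep (val c))).
  apply: is_character_of => //.
  - move=> u v Au Av; rewrite /f -culimD//; [|exact: bf|exact: bf].
    by congr culim; apply/funext => chi; exact: evD.
  - move=> u v Au Av; rewrite /f -culimM//; [|exact: bf|exact: bf].
    by congr culim; apply/funext => chi; exact: evM.
  - move=> k v Av; rewrite /f -culimZ//; last exact: bf.
    by congr culim; apply/funext => chi; exact: evZ.
  - rewrite -[RHS](culim_cst FU 1); congr culim; apply/funext => chi.
    exact: (ev1 muP mu_gen UU).
exists (character_of fP); split => //=.
apply: spectrum_cvg => v Av; rewrite ev_character_of//.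
by apply: culim_cvg; exact: bf.
Qed.

Definition coord (g : G) chi : R := complex.Re (ev chi (rnV g)).

Lemma coordE g chi : coord g chi = complex.Re (ev chi (rnV g)). Proof. by []. Qed.

Lemma continuous_Re_ev v : inA v -> continuous (fun chi => complex.Re (ev chi v)).
Proof.
move=> Av chi; have := continuous_ev Av (x := chi).
have FF : Filter (nbhs chi) by exact: nbhs_filter.
rewrite /continuous_at => /cvgrPdist_lt h; apply/cvgrPdist_lt => e e0.
have e0' : 0 < e%:C :> R[i] by rewrite ltcR.
have := h _ e0'; apply: filterS => chi' /=; rewrite -ReB -ltcR.
exact: le_lt_trans (Re_le_norm _).
Qed.

Lemma continuous_Im_ev v : inA v -> continuous (fun chi => complex.Im (ev chi v)).
Proof.
move=> Av chi; have := continuous_ev Av (x := chi).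
have FF : Filter (nbhs chi) by exact: nbhs_filter.
rewrite /continuous_at => /cvgrPdist_lt h; apply/cvgrPdist_lt => e e0.
have e0' : 0 < e%:C :> R[i] by rewrite ltcR.
have := h _ e0'; apply: filterS => chi' /=; rewrite -ImB -ltcR.
exact: le_lt_trans (Im_le_norm _).
Qed.

Lemma ev_rn chi g : ev chi (rnV g) = (coord g chi)%:C.
Proof.
have : complex.Im (ev chi (rnV g)) = 0.
  by apply: (ev_real muP mu_gen UU) => //; exact: inA_rn.
by rewrite /coord; case: (ev chi (rnV g)) => p q /= ->.
Qed.

Lemma coord_ext chi chi' : (forall g, coord g chi = coord g chi') -> chi = chi'.
Proof.
by move=> h; apply: (spectrum_ext (muP := muP) (mu_gen := mu_gen) UU) => g; rewrite !ev_rn h.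
Qed.

Lemma continuous_coord g : continuous (coord g).
Proof. exact: continuous_Re_ev (inA_rn muP mu_gen (U := U) g). Qed.

Lemma near_coord chi g (e : R) : 0 < e ->
  \forall chi' \near chi, `|coord g chi' - coord g chi| < e.
Proof.
move=> e0; have := continuous_coord (g := g) (x := chi).
move=> /cvgrPdist_lt /(_ e e0); apply: filterS => chi' /=.
by rewrite distrC.
Qed.

(** Otherwise some ultrafilter avoids O while every coordinate tends to that of chi. By compactness
    it converges, and its limit has the coordinates of chi, hence is chi. *)
Lemma nbhs_coord chi (O : set spec) : nbhs chi O -> exists (s : seq G) (e : R), 0 < e /\
  forall chi', (forall g, g \in s -> `|coord g chi' - coord g chi| < e) -> O chi'.
Proof.
move=> Ochi; apply/not_existsP => no.
pose D := [set se : seq G * R | 0 < se.2].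
pose N (se : seq G * R) := [set chi' | (forall g, g \in se.1 ->
  `|coord g chi' - coord g chi| < se.2) /\ ~ O chi'].
have PF : ProperFilter (filter_from D N).
  apply: filter_from_proper; first apply: filter_from_filter.
  - by exists ([::], 1) => //=; exact: ltr01.
  - move=> [s e] [t f]; rewrite /D /= => e0 f0; exists (s ++ t, Num.min e f).
      by rewrite /= lt_min e0.
    move=> chi' [h nO]; split; split => // g gs; have := h g; rewrite /= mem_cat gs ?orbT.
      by move=> /(_ isT); rewrite lt_min => /andP[].
    by move=> /(_ isT); rewrite lt_min => /andP[].
  move=> [s e] e0; apply: contrapT => nN; apply: (no s); exists e; split => //.
  move=> chi' h; apply: contrapT => nO; apply: nN; exists chi'; split => //.
have [F [FU FN]] := ultraFilterLemma PF.
have := compact_spectrum; rewrite compact_ultra => /(_ F FU filterT) [chi' [_ Fchi']].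
have FF : ProperFilter F by exact: ultra_proper.
have E : chi' = chi.
  apply: coord_ext => g; apply/eqP; rewrite -subr_eq0 -normr_le0.
  apply/ler_addgt0Pr => e e0; rewrite add0r.
  have e2 : 0 < e / 2 by rewrite divr_gt0.
  have F1 : F [set c | `|coord g c - coord g chi| < e / 2].
    apply: FN; exists ([:: g], e / 2) => //= c [h _]; apply: h.
    by rewrite inE eqxx.
  have F2 : F [set c | `|coord g c - coord g chi'| < e / 2].
    by apply: Fchi'; exact: near_coord.
  have [c [c1 c2]] := filter_ex (filterI F1 F2).
  rewrite (_ : _ - _ = (coord g c - coord g chi) - (coord g c - coord g chi')); last by ring.
  by rewrite (le_trans (ler_normB _ _))// [e]splitr ltW// ltrD.
have FO : F O by apply: Fchi'; rewrite /= E.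
have FnO : F (~` O) by apply: FN; exists ([::], 1) => [|c []]; first exact: ltr01.
have [c []] := filter_ex (filterI FO FnO).
by [].
Qed.

Section countable_group.
Hypothesis countG : countable [set: G].

Lemma group_enumeration : exists e : nat -> G, forall g, exists n, e n = g.
Proof.
have [e eP] := seq_enumeration countG.
by exists (fun n => head 1%g (e n)) => g; have [n en] := eP [:: g]; exists n; rewrite en.
Qed.

Let en := sval (cid group_enumeration).
Let enP g : exists n, en n = g. Proof. by rewrite /en; case: cid => e /= eP; exact: eP. Qed.

(** Capping the n-th coordinate at 1 / (n + 1) leaves finitely many coordinates relevant at each
    scale, so that the supremum metrizes the product topology. *)
Let gap n chi chi' : R := Num.min `|coord (en n) chi - coord (en n) chi'| n.+1%:R^-1.
Let gaps chi chi' := range (fun n => gap n chi chi').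
Let dist chi chi' := sup (gaps chi chi').

Let gap_ge0 n chi chi' : 0 <= gap n chi chi'.
Proof. by rewrite /gap le_min normr_ge0 invr_ge0 ler0n. Qed.

Let gap_le n chi chi' : gap n chi chi' <= dist chi chi'.
Proof.
apply: ub_le_sup; last by exists n.
exists 1 => _ [m _ <-]; rewrite /gap ge_min; apply/orP; right.
by rewrite invf_le1// ler1n.
Qed.

Let dist_le chi chi' (e : R) : (forall n, gap n chi chi' <= e) -> dist chi chi' <= e.
Proof. by move=> h; apply: ge_sup; [exists (gap 0 chi chi'), 0%N|move=> _ [n _ <-]]. Qed.

Lemma metrizable_spectrum : metrizable (R := R) spec.
Proof.
exists dist; split.
- move=> chi chi'; split => [d0|->].
    apply: coord_ext => g; have [n <-] := enP g.
    have := gap_le n chi chi'; rewrite d0 /gap ge_min => /orP[|].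
      by rewrite normr_le0 subr_eq0 => /eqP.
    by rewrite leNgt invr_gt0 ltr0Sn.
  apply/eqP; rewrite eq_le; apply/andP; split; last exact: le_trans (gap_ge0 0 _ _) (gap_le 0 _ _).
  apply: dist_le => n; rewrite /gap subrr normr0 ge_min; apply/orP; left.
  exact: lexx.
- move=> chi chi'; rewrite /dist; congr sup.
  by apply/seteqP; split => _ [n _ <-]; exists n => //; rewrite /gap distrC.
- move=> c1 c2 c3; apply: dist_le => n.
  apply: le_trans (lerD (gap_le n c1 c2) (gap_le n c2 c3)).
  rewrite /gap; set k := n.+1%:R^-1.
  have k0 : 0 <= k by rewrite invr_ge0.
  have := ler_distD (coord (en n) c2) (coord (en n) c1) (coord (en n) c3).
  have := normr_ge0 (coord (en n) c1 - coord (en n) c2).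
  have := normr_ge0 (coord (en n) c2 - coord (en n) c3).
  move: `|_ - _| `|_ - _| `|_ - _| => x y z x0 y0 zyx.
  by rewrite ge_min /Num.min /Order.min; case: ifP => _; case: ifP => _; lra.
move=> chi A; split.
  move=> /nbhs_coord[s [e [e0 sA]]].
  have [N NP] : exists N, forall g, g \in s -> exists2 n, (n < N)%N & en n = g.
    elim: s {sA} => [|g s [N NP]]; first by exists 0%N.
    have [n ng] := enP g; exists (maxn n.+1 N) => h; rewrite inE => /orP[/eqP ->|/NP[m mN mh]].
      by exists n => //; rewrite leq_max ltnSn.
    by exists m => //; rewrite leq_max mN orbT.
  (* Below 1 / (N + 1) the cap is inactive for all indices n < N. *)
  exists (Num.min e N.+1%:R^-1); first by rewrite lt_min e0 invr_gt0 ltr0Sn.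
  move=> chi' /=; rewrite lt_min => /andP[de dN]; apply: sA => g /NP[n nN <-].
  have ngap : gap n chi chi' = `|coord (en n) chi - coord (en n) chi'|.
    have := le_lt_trans (gap_le n chi chi') dN; rewrite /gap /Num.min /Order.min.
    case: ifP => // _; rewrite ltf_pV2 ?posrE ?ltr0Sn// ltr_nat ltnS.
    by rewrite ltnNge (ltnW nN).
  by rewrite distrC -ngap; exact: le_lt_trans (gap_le n chi chi') de.
move=> [e e0 eA].
have e2 : 0 < e / 2 by rewrite divr_gt0.
have [N _ /(_ N (leqnn N)) /= NP] := near_infty_natSinv_lt (PosNum e2).
have FF : Filter (nbhs chi) by exact: nbhs_filter.
have : \forall chi' \near chi, forall n, (n < N)%N ->
    `|coord (en n) chi' - coord (en n) chi| < e / 2.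
  elim: N {NP} => [|N IH]; first by apply: (@filterS _ _ FF setT) filterT => chi' _ n; rewrite ltn0.
  have := near_coord chi (en N) e2; move: IH; apply: filterS2 => chi' h1 h2 n.
  by rewrite ltnS leq_eqVlt => /orP[/eqP ->|/h1].
apply: filterS => chi' h; apply: eA => /=.
rewrite (@le_lt_trans _ _ (e / 2))//; last by lra.
apply: dist_le => n; rewrite /gap ge_min; have [nN|Nn] := ltnP n N.
  by apply/orP; left; rewrite distrC; exact: ltW (h n nN).
apply/orP; right; apply: le_trans (ltW NP).
by rewrite lef_pV2 ?posrE ?ltr0Sn// ler_nat ltnS.
Qed.

End countable_group.
End spectrum_topology.

Section rational_boxes.
Context {R : realType} {G : groupType}.
Variable (en : nat -> G).
Hypothesis enP : forall g, exists n, en n = g.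

(** Only countably many boxes occur. They serve to write open sets as countable unions and to
    discard null sets all at once. *)
Definition rbox (k : seq (nat * (rat * rat))) (c : G -> R) :=
  forall z, z \in k -> ratr z.2.1 < c (en z.1) < ratr z.2.2.

Lemma rbox_approx (c : G -> R) (s : seq G) (e : R) : 0 < e -> exists k, rbox k c /\
  forall c', rbox k c' -> forall g, g \in s -> `|c' g - c g| < e.
Proof.
move=> e0; elim: s => [|g s [k [kc ks]]]; first by exists [::]; split.
have [n ng] := enP g.
have [q] : exists q, ratr q \in `]c g - e / 2, c g[ by apply: rat_in_itvoo; lra.
rewrite in_itv /= => /andP[q1 q2].
have [r] : exists q, ratr q \in `]c g, c g + e / 2[ by apply: rat_in_itvoo; lra.
rewrite in_itv /= => /andP[r1 r2].
exists ((n, (q, r)) :: k); split=> [z|c' kc' h].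
  by rewrite inE => /orP[/eqP -> /=|/kc//]; rewrite ng q2.
rewrite inE => /orP[/eqP ->|]; last first.
  by apply: ks => z zk; apply: kc'; rewrite inE zk orbT.
have := kc' (n, (q, r)); rewrite inE eqxx => /(_ isT) /=; rewrite ng => /andP[c1 c2].
by rewrite ltr_norml; apply/andP; split; lra.
Qed.

Lemma measurable_rbox d (T : measurableType d) (f : G -> T -> R) k :
  (forall g, measurable_fun setT (f g)) -> measurable [set t | rbox k (f^~ t)].
Proof.
move=> mf; elim: k => [|[n [q r]] k IH].
  by rewrite (_ : mkset _ = setT)//; apply/seteqP; split.
rewrite (_ : mkset _ = (f (en n) @^-1` `]ratr q, ratr r[) `&` [set t | rbox k (f^~ t)]).
  apply: measurableI => //; rewrite -[X in measurable X]setTI; exact: mf.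
apply/seteqP; split => t /=; rewrite in_itv /=.
  move=> h; split; first by have := h (n, (q, r)); rewrite inE eqxx => /(_ isT).
  by move=> z zk; apply: h; rewrite inE zk orbT.
by move=> [h1 h2] z; rewrite inE => /orP[/eqP ->|/h2].
Qed.

End rational_boxes.

(* Keeps unification from unfolding the choice of representatives of cosets. *)
Opaque rnV ev coord.

(** * The induced action and the Borel structure of the spectrum *)

Section spectrum_action.
Context {R : realType} {G : groupType}.
Variables (mu : G -> R) (muP : is_prob_mass mu) (mu_gen : generating mu).
Variables (U : set_system (abel_param R)) (UU : UltraFilter U).
Notation V := (bfam R G).
Notation null_family := (null_family mu U).
Notation qproj := (qproj mu U).
Notation inA := (inA mu U).
Notation rnV := (rnV muP mu_gen).
Notation spec := (spectrum mu U).
Notation coord := (coord muP mu_gen (U := U)).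
Implicit Types u v r : V.
Implicit Types chi : spec.

Lemma btranslateE g v a x : btranslate g v a x = v a (g^-1 * x)%g.
Proof. by []. Qed.

Lemma btranslateD g u v : btranslate g (u + v) = btranslate g u + btranslate g v.
Proof. exact: bfam_ext. Qed.

Lemma btranslateM g u v : btranslate g (u * v) = btranslate g u * btranslate g v.
Proof. exact: bfam_ext. Qed.

Lemma btranslateZ g k v : btranslate g (bscale k v) = bscale k (btranslate g v).
Proof. exact: bfam_ext. Qed.

Lemma btranslate_conj g v : btranslate g (bconj v) = bconj (btranslate g v).
Proof. exact: bfam_ext. Qed.

Lemma btranslate0 g : btranslate g 0 = 0 :> V.
Proof. exact: bfam_ext. Qed.

Lemma btranslate1 g : btranslate g 1 = 1 :> V.
Proof. exact: bfam_ext. Qed.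

Lemma btranslateB g u v : btranslate g u - btranslate g v = btranslate g (u - v).
Proof. exact: bfam_ext. Qed.

Lemma realM (s t : R) : (s * t)%:C = s%:C * t%:C :> R[i].
Proof. exact: rmorphM. Qed.

(** Divided by its upper bound K, the density lies between k / K and 1, so the Neumann series
    inverts it inside the algebra. The translate of r_h by g is r_(g h) / r_g, so the invariance of
    the algebra rests on this inverse. *)
Lemma rn_inverse g : exists2 r, inA r & r * rnV g = 1.
Proof.
have [K K0 gK] := rn_bound muP mu_gen g; have [k k0 kg] := rn_lower muP mu_gen g.
have rn0 a x : 0 < rn mu g a x by have /andP[] := gK a x.
have b : bdd2 (fun a x => K / rn mu g a x).
  apply: (@bdd2_between _ _ _ 0 (K / k)) => a x.
  by rewrite divr_ge0 ?(ltW K0) ?(ltW (rn0 a x))//= ler_pM2l// lef_pV2 ?posrE ?kg.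
pose r' : V := real_fam b; pose r := bscale K^-1%:C (rnV g).
have r'E a x : r' a x = (K / rn mu g a x)%:C by [].
have rE a x : r a x = (K^-1 * rn mu g a x)%:C by rewrite bfamZ rnVE -rmorphM.
have Ar : inA r by apply: inAZ => //; exact: inA_rn.
have r'r : r' * r = 1.
  apply: bfam_ext => a x; rewrite bfamM r'E rE -rmorphM bfam1.
  by rewrite mulrA mulrAC divfK ?mulfV ?gt_eqF.
have Ar' : inA r'.
  apply: (inA_inv muP mu_gen UU Ar (k := 1 - k / K)) r'r; first by rewrite gtrBl divr_gt0.
  move=> a x; rewrite rE -(rmorphB _ 1) normC_real lecR ger0_norm; last first.
    by rewrite subr_ge0 mulrC ler_pdivrMr// mul1r; have /andP[] := gK a x.
  by rewrite lerD2l lerN2 (mulrC k) ler_pM2l ?invr_gt0.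
exists (bscale K^-1%:C r'); first exact: inAZ.
apply: bfam_ext => a x; rewrite bfamM bfamZ r'E rnVE -!rmorphM bfam1.
by rewrite mulKf ?gt_eqF// mulVf ?gt_eqF.
Qed.

Lemma coord_neq0 chi g : coord g chi != 0.
Proof.
have [r Ar rg] := rn_inverse g.
have := ev1 muP mu_gen UU chi; rewrite -rg evM//; last exact: inA_rn.
rewrite (ev_rn muP mu_gen UU) => E; apply/eqP => c0; move: E; rewrite c0 mulr0 => /eqP.
by rewrite eq_sym oner_eq0.
Qed.

Lemma btranslate_rn g h : btranslate g (rnV h) * rnV g = rnV (g * h)%g.
Proof.
apply: bfam_ext => a x; rewrite bfamM btranslateE !rnVE -realM.
by have := rn_cocycle muP mu_gen g^-1%g h a x; rewrite invgK => ->.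
Qed.

Lemma inA_btranslate g v : inA v -> inA (btranslate g v).
Proof.
move=> Av; apply: (inA_ind (muP := muP) (mu_gen := mu_gen) UU
  (S := fun v => inA (btranslate g v))) Av => {v}.
- move=> u v /(null_btranslate muP mu_gen UU g); rewrite -btranslateB.
  exact: inA_null.
- by rewrite btranslate0; exact: inA0.
- by move=> u v _ _ Au Av; rewrite btranslateD; exact: inAD.
- by move=> u v _ _ Au Av; rewrite btranslateM; exact: inAM.
- by move=> k v _ Av; rewrite btranslateZ; exact: inAZ.
- by move=> v _ Av; rewrite btranslate_conj; exact: inA_conj.
- move=> v _ H; apply: inA_lim => // e e0; have [w [_ Aw vw]] := H e e0.
  by exists (btranslate g w) => // a x; exact: vw.
move=> h; have [r Ar rg] := rn_inverse g.
rewrite (_ : btranslate g (rnV h) = rnV (g * h)%g * r).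
  by apply: inAM => //; exact: inA_rn.
by rewrite -btranslate_rn -mulrA (mulrC _ r) rg mulr1.
Qed.

Lemma is_character_translate g chi :
  is_character (fun c : rn_algebra mu U => ev chi (btranslate g (qrep (val c)))).
Proof.
apply: (is_character_of muP mu_gen UU (f := fun v => ev chi (btranslate g v))).
- move=> u v /(null_btranslate muP mu_gen UU g); rewrite -btranslateB => uv Au Av.
  by apply: ev_null => //; exact: inA_btranslate.
- by move=> u v /(inA_btranslate g) Au /(inA_btranslate g) Av; rewrite btranslateD evD.
- by move=> u v /(inA_btranslate g) Au /(inA_btranslate g) Av; rewrite btranslateM evM.
- by move=> k v /(inA_btranslate g) Av; rewrite btranslateZ evZ.
- by rewrite btranslate1 (ev1 muP mu_gen UU).
Qed.

Lemma translated_character g chi : exists chi' : spec,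
  forall v, inA v -> ev chi' v = ev chi (btranslate g v).
Proof.
exists (character_of (is_character_translate g chi)) => v Av.
apply: (ev_character_of muP UU (f := fun v => ev chi (btranslate g v)) _ _ Av).
move=> u w /(null_btranslate muP mu_gen UU g); rewrite -btranslateB => uw Au Aw.
by apply: ev_null => //; exact: inA_btranslate.
Qed.

Definition spectrum_act g chi : spec := sval (cid (translated_character g^-1%g chi)).

Lemma ev_act g chi v : inA v -> ev (spectrum_act g chi) v = ev chi (btranslate g^-1%g v).
Proof. by rewrite /spectrum_act; case: cid => chi' /= h /h. Qed.

Lemma spectrum_act_induced : is_induced_action spectrum_act.
Proof.
move=> g chi c; have Ac := inA_btranslate g^-1%g (inA_qrep c).
exists (qclass Ac) => //.
by rewrite ev_qrep ev_act ?(evE chi Ac)//; exact: inA_qrep.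
Qed.

Opaque spectrum_act.

(** The cocycle identity evaluated at a character, to be matched with [rho_cocycle]. *)
Lemma coord_act g h chi :
  coord h (spectrum_act g chi) * coord g^-1%g chi = coord (g^-1 * h)%g chi.
Proof.
have Ah := inA_rn muP mu_gen (U := U).
have := evM muP UU chi (inA_btranslate g^-1%g (Ah h)) (Ah g^-1%g).
rewrite btranslate_rn -(ev_act g chi (Ah h)) (ev_rn muP mu_gen UU chi).
by rewrite (ev_rn muP mu_gen UU chi) (ev_rn muP mu_gen UU _ h) -realM => -[].
Qed.

Lemma spectrum_act_is_action : is_action spectrum_act.
Proof.
split=> [chi|g h chi]; apply: (spectrum_ext (muP := muP) (mu_gen := mu_gen) UU) => k;
  have Ak := inA_rn muP mu_gen (U := U) k.
  rewrite (ev_act 1%g chi Ak); congr ev.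
  by apply: bfam_ext => a x; rewrite btranslateE !invg1 mul1g.
rewrite (ev_act _ chi Ak) (ev_act g _ Ak) (ev_act h chi (inA_btranslate _ Ak)).
by congr ev; apply: bfam_ext => a x; rewrite !btranslateE !invgK mulgA.
Qed.

Lemma continuous_spectrum_act g : continuous (spectrum_act g).
Proof.
move=> chi; have FF : Filter (nbhs chi) by exact: nbhs_filter.
apply: spectrum_cvg => v Av.
have := continuous_ev (inA_btranslate g^-1%g Av) (x := chi).
have -> : (fun chi' : spec => ev chi' (btranslate g^-1%g v)) =
    fun chi' => ev (spectrum_act g chi') v.
  by apply/funext => chi'; rewrite (ev_act g chi' Av).
exact.
Qed.

Section borel_structure.
Hypothesis countG : countable [set: G].
Variable chi0 : spec.
Notation Y := (borel (pointed_at chi0)).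

Lemma continuous_borel (f : spec -> R) : continuous f -> measurable_fun [set: Y] f.
Proof.
move=> cf; apply: (measurability _ (RGenOpens.measurableE R)).
move=> _ [_ [a [b ->] <-]]; rewrite setTI; apply: sub_sigma_algebra.
by move/continuousP : cf; apply; exact: interval_open.
Qed.

Lemma continuous_borel_map (f : spec -> spec) : continuous f ->
  measurable_fun [set: Y] (f : Y -> Y).
Proof.
move=> cf; apply: (@measurability _ _ Y Y setT f (@open (pointed_at chi0))) => //.
move=> _ [D oD <-]; rewrite setTI; apply: sub_sigma_algebra.
by move/continuousP : cf; exact.
Qed.

(** An open set is the union of the countably many rational boxes contained in it. *)
Lemma measurable_into_spectrum d (T : measurableType d) (p : T -> Y) :
  (forall g, measurable_fun setT (fun t => coord g (p t))) -> measurable_fun setT p.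
Proof.
move=> mp; have [en enP] := group_enumeration countG.
apply: (@measurability _ _ T Y setT p (@open (pointed_at chi0))) => //.
move=> _ [D oD <-]; rewrite setTI.
pose F k := if pselect (forall chi, rbox en k (coord^~ chi) -> D chi) then
  [set t | rbox en k (fun g => coord g (p t))] else set0.
rewrite (_ : p @^-1` D = \bigcup_k F k).
  apply: countable_bigcupT_measurable => // k; rewrite /F; case: pselect => kD /=;
    last exact: measurable0.
  exact: measurable_rbox.
apply/seteqP; split => t /=.
  move=> Dpt; have /(nbhs_coord muP mu_gen UU)[s [e [e0 sD]]] : nbhs (p t : spec) D.
    exact: open_nbhs_nbhs.
  have [k [kp ks]] := rbox_approx enP (fun g => coord g (p t)) s e0.
  exists k => //; rewrite /F; case: pselect => // -[] chi /ks; exact: sD.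
by move=> [k _]; rewrite /F; case: pselect => //= kO; exact: kO.
Qed.

End borel_structure.
End spectrum_action.

(** * The boundary map *)

Section factor.
Context d d' (B : measurableType d) (Y : measurableType d') (R : realType).
Variables (nu : probability B R) (p : B -> Y).
Hypothesis mp : measurable_fun [set: B] p.

Let mpre A : measurable A -> measurable (p @^-1` A).
Proof. by move=> mA; rewrite -[X in measurable X]setTI; exact: mp. Qed.

Lemma image_probability : exists m : probability Y R, forall A, m A = nu (p @^-1` A).
Proof.
pose X : {mfun B >-> Y} := mfun_Sub (mem_set mp).
by exists (distribution nu X).
Qed.

Variable m : probability Y R.
Hypothesis mE : forall A, measurable A -> m A = nu (p @^-1` A).

Lemma bmf_factor (h : Y -> R) : bmf h -> bmf (fun b => h (p b)).
Proof.
move=> [mh bh]; split; last exact: bounded_comp.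
exact: (measurableT_comp mh mp).
Qed.

Lemma bint_image (h : Y -> R) : bmf h -> bint m h = bint nu (fun b => h (p b)).
Proof.
move: h; apply: bmf_ind.
- move=> A mA; rewrite bint_indic// mE// -(bint_indic nu (mpre mA)).
  by congr bint.
- move=> f g bf bg If Ig; rewrite !bintD ?If ?Ig//; exact: bmf_factor.
- by move=> c f bf If; rewrite !bintZ ?If//; exact: bmf_factor.
move=> f bf H; apply/eqP; rewrite -subr_eq0 -normr_le0.
apply/ler_addgt0Pr => e e0; rewrite add0r.
have e2 : 0 < e / 2 by rewrite divr_gt0.
have [g [bg Ig fg]] := H _ e2.
have h1 : `|bint m f - bint m g| <= e / 2.
  rewrite -bintB// ler_norml; apply: bint_between; first exact: bmfB.
  by move=> y; rewrite -ler_norml.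
have h2 : `|bint nu (fun b => f (p b)) - bint m g| <= e / 2.
  rewrite Ig -bintB; [|exact: bmf_factor..].
  rewrite ler_norml; apply: bint_between.
    by apply: bmfB; exact: bmf_factor.
  by move=> y; rewrite -ler_norml.
move: h1 h2; move: (bint m f) (bint m g) (bint nu (fun b => f (p b))) => x y z h1 h2.
rewrite (_ : x - z = (x - y) - (z - y)); last by ring.
by rewrite (le_trans (ler_normB _ _))// [e]splitr lerD.
Qed.

Lemma ae_image (Q : Y -> Prop) : {ae m, forall y, Q y} -> {ae nu, forall b, Q (p b)}.
Proof.
move=> [N [mN N0 QN]]; exists (p @^-1` N); split; [exact: mpre|by rewrite -mE|].
by move=> b /= nQ; exact: QN.
Qed.

Lemma ae_of_image (A : set Y) : measurable A -> {ae nu, forall b, A (p b)} ->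
  {ae m, forall y, A y}.
Proof.
move=> mA Ap; exists (~` A); split; [exact: measurableC| |by []].
rewrite mE; last exact: measurableC.
apply/negligibleP; first by apply: mpre; exact: measurableC.
exact: Ap.
Qed.

Lemma Linfty_factor (h : Y -> R[i]) : Linfty m h -> Linfty nu (h \o p).
Proof.
move=> [m1 m2 [M hM]]; split.
- exact: (measurableT_comp m1 mp).
- exact: (measurableT_comp m2 mp).
- by exists M; exact: ae_image hM.
Qed.

Lemma Linfty_factor_inj (h k : Y -> R[i]) : Linfty m h -> Linfty m k ->
  {ae nu, forall b, h (p b) = k (p b)} <-> {ae m, forall y, h y = k y}.
Proof.
move=> [h1 h2 _] [k1 k2 _]; split; last exact: (@ae_image (fun y => h y = k y)).
apply: ae_of_image.
rewrite (_ : (fun y => h y = k y) =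
    ((fun y => complex.Re (h y) - complex.Re (k y)) @^-1` [set 0]) `&`
    ((fun y => complex.Im (h y) - complex.Im (k y)) @^-1` [set 0])).
  apply: measurableI; rewrite -[X in measurable X]setTI.
    exact: (measurable_funB h1 k1).
  exact: (measurable_funB h2 k2).
apply/seteqP; split => y /=; first by move=> ->; rewrite !subrr.
case: (h y) (k y) => [a b] [a' b'] /= [/eqP + /eqP].
by rewrite !subr_eq0 => /eqP -> /eqP ->.
Qed.

(** h o p is the conditional expectation of f given p. *)
Lemma factor_density (f : B -> R) : bmf f -> (forall b, 0 <= f b <= 1) ->
  exists h : Y -> R, [/\ measurable_fun setT h, forall y, 0 <= h y <= 1 &
    forall k : Y -> R, bmf k -> bint nu (fun b => k (p b) * f b) =
      bint nu (fun b => k (p b) * h (p b))].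
Proof.
move=> bf f01.
pose lam C := bint nu (fun b => \1_(p @^-1` C) b * f b).
have bi C : measurable C -> bmf (\1_(p @^-1` C) : B -> R).
  by move=> mC; apply: bmf_indic; exact: mpre.
have lam_bound C : measurable C -> 0 <= lam C <= fine (m C).
  move=> mC; have bC := bi C mC; rewrite mE// -(bint_indic nu (mpre mC)).
  rewrite -(bint_cst nu 0) !ler_bint//; try exact: bmf_cst; try exact: bmfM.
    by move=> b; have /andP[f0 f1] := f01 b; rewrite ler_piMr// indicE ler0n.
  by move=> b; have /andP[f0 f1] := f01 b; rewrite mulr_ge0// indicE ler0n.
have lamU C D : measurable C -> measurable D -> C `&` D = set0 ->
    lam (C `|` D) = lam C + lam D.
  move=> mC mD CD; rewrite /lam -bintD; [|by apply: bmfM => //; exact: bi..].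
  congr bint; apply/funext => b; rewrite -mulrDl; congr (_ * _).
  rewrite !indicE !preimage_setU !in_setU.
  have : ~ ((b \in p @^-1` C) && (b \in p @^-1` D)).
    move=> /andP[/set_mem Cb /set_mem Db].
    by have : (C `&` D) (p b) by []; rewrite CD.
  by case: (b \in _) => //; case: (b \in _) => //= _; rewrite ?addr0 ?add0r.
have [h [mh h01 hE]] := dominated_density lam_bound lamU.
have bh : bmf h.
  by split => //; apply: (@bounded_between _ _ _ 0 1).
exists h; split => //.
have bfh := bmf_factor bh.
apply: bmf_ind.
- move=> A mA; have := hE A mA; rewrite -bint_indicM// => -[].
  rewrite /lam (_ : bint m _ = bint nu (fun b => \1_A (p b) * h (p b))) => [<-//|].
  by apply: (@bint_image (fun y => \1_A y * h y)); apply: bmfM => //; exact: bmf_indic.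
- move=> k l bk bl Ik Il; have bk' := bmf_factor bk; have bl' := bmf_factor bl.
  under eq_fun do rewrite mulrDl; under [in RHS]eq_fun do rewrite mulrDl.
  rewrite !bintD; [|exact: bmfM..].
  by rewrite Ik Il.
- move=> c k bk Ik; have bk' := bmf_factor bk.
  under eq_fun do rewrite -mulrA; under [in RHS]eq_fun do rewrite -mulrA.
  by rewrite !bintZ ?Ik//; exact: bmfM.
move=> k bk H; have bk' := bmf_factor bk.
apply/eqP; rewrite -subr_eq0 -normr_le0.
apply/ler_addgt0Pr => e e0; rewrite add0r.
have e2 : 0 < e / 2 by rewrite divr_gt0.
have [l [bl Il kl]] := H _ e2; have bl' := bmf_factor bl.
have key (w : B -> R) : bmf w -> (forall b, 0 <= w b <= 1) ->
    `|bint nu (fun b => k (p b) * w b) - bint nu (fun b => l (p b) * w b)| <= e / 2.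
  move=> bw w01; rewrite -bintB; [|exact: bmfM..].
  rewrite ler_norml; apply: bint_between; first by apply: bmfB; exact: bmfM.
  move=> b; rewrite -mulrBl -ler_norml normrM -[leRHS]mulr1.
  have /andP[w0 w1] := w01 b.
  by apply: ler_pM => //; rewrite ger0_norm.
have := key _ bf f01; have := key _ bfh (fun b => h01 (p b)).
rewrite Il; move: (bint _ _) (bint _ _) (bint _ _) => x y z h1 h2.
rewrite (_ : x - z = (x - y) - (z - y)); last by ring.
by rewrite (le_trans (ler_normB _ _))// [e]splitr lerD.
Qed.

(** If integrals against functions of p determine a function on B, then each function equals its
    conditional expectation given p, which factors through p. *)
Lemma Linfty_factor_surj :
  (forall f g : B -> R, bmf f -> bmf g ->
    (forall k : Y -> R, bmf k ->
      bint nu (fun b => k (p b) * f b) = bint nu (fun b => k (p b) * g b)) ->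
    {ae nu, forall b, f b = g b}) ->
  forall f, Linfty nu f ->
    exists2 h, Linfty m h & {ae nu, forall b, h (p b) = f b}.
Proof.
move=> uniq.
have real (f : B -> R) (M : R) : 0 < M -> measurable_fun setT f ->
    {ae nu, forall b, `|f b| <= M} -> exists h : Y -> R,
    [/\ measurable_fun setT h, forall y, `|h y| <= M & {ae nu, forall b, h (p b) = f b}].
  move=> M0 mf fM.
  (* The bound on f holds only almost everywhere: f is clamped to [-M, M], then rescaled to
     [0, 1]. *)
  pose f1 b := (Num.min (Num.max (f b) (- M)) M + M) / (2 * M).
  have f01 b : 0 <= f1 b <= 1.
    rewrite /f1 divr_ge0 ?mulr_ge0 ?(ltW M0)//=.
      rewrite ler_pdivrMr ?mulr_gt0// mul1r mulr2n mulrDl mul1r lerD2r.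
      by rewrite ge_min lexx orbT.
    by rewrite -lerBlDr sub0r le_min le_max lexx orbT/= lerNl; lra.
  have bf1 : bmf f1.
    split; last by apply: (@bounded_between _ _ _ 0 1).
    apply: measurable_funM => //; apply: measurable_funD => //.
    by apply: measurable_minr => //; apply: measurable_maxr.
  have [h [mh h01 hE]] := factor_density bf1 f01.
  have bh : bmf h by split => //; apply: (@bounded_between _ _ _ 0 1).
  exists (fun y => 2 * M * h y - M); split.
  - by apply: measurable_funB => //; apply: measurable_funM.
  - move=> y; have /andP[h0 h1] := h01 y; rewrite ler_norml; apply/andP.
    by split; nra.
  apply: ae_imp2 (uniq _ _ bf1 (bmf_factor bh) hE) fM _ => b <-.
  rewrite ler_norml => /andP[l1 l2].
  by rewrite /f1 max_l// min_l// mulrC divfK ?addrK// gt_eqF// mulr_gt0.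
move=> f [m1 m2 [M fM]].
have M0 : 0 < `|M| + 1 by rewrite ltr_wpDl.
have bnd z : `|z| <= M%:C -> (`|complex.Re z| <= `|M| + 1) && (`|complex.Im z| <= `|M| + 1).
  move=> zM; have h1 := le_trans (Re_le_norm z) zM; have h2 := le_trans (Im_le_norm z) zM.
  rewrite !lecR in h1 h2; have := ler_norm M.
  by move=> hM; apply/andP; split; lra.
have [h [mh hM hf]] : exists h : Y -> R, [/\ measurable_fun setT h,
    forall y, `|h y| <= `|M| + 1 & {ae nu, forall b, h (p b) = complex.Re (f b)}].
  by apply: real => //; apply: ae_imp fM _ => b /bnd /andP[].
have [k [mk kM kf]] : exists h : Y -> R, [/\ measurable_fun setT h,
    forall y, `|h y| <= `|M| + 1 & {ae nu, forall b, h (p b) = complex.Im (f b)}].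
  by apply: real => //; apply: ae_imp fM _ => b /bnd /andP[].
exists (fun y => h y +i* k y).
  split => //; exists ((`|M| + 1) + (`|M| + 1)); apply: aeW => y.
  apply: le_trans (norm_le_ReIm _) _; rewrite lecR.
  exact: lerD (hM y) (kM y).
by apply: ae_imp2 hf kf _ => b -> ->; case: (f b).
Qed.

End factor.

Section boundary_map.
Context {R : realType} {G : groupType} (countG : countable [set: G]).
Variables (mu : G -> R) (muP : is_prob_mass mu) (mu_gen : generating mu).
Variables (U : set_system (abel_param R)) (UU : UltraFilter U).
Hypothesis U_to_1 : forall e : R, 0 < e < 2^-1 ->
  U [set a : abel_param R | 1 - e < val a < 1].
Context d (B : measurableType d) (nu : probability B R) (act : G -> B -> B).
Hypothesis mact : measurable_action act.
Notation pint := (pint nu act).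
Notation mean := (mean mu U).
Hypothesis pint_harm : forall f : B -> R, bmf f -> (forall b, 0 <= f b) ->
  harmonic mu (pint f).
Hypothesis pint_uniq : forall f g : B -> R, bmf f -> bmf g ->
  (forall x, pint f x = pint g x) -> {ae nu, forall b, f b = g b}.
Hypothesis pint_ex : forall h : G -> R, (forall x, 0 <= h x <= 1) ->
  harmonic mu h -> exists f : B -> R,
  [/\ measurable_fun setT f, forall b, 0 <= f b <= 1 & forall x, pint f x = h x].
Notation V := (bfam R G).
Notation null_family := (null_family mu U).
Notation inA := (inA mu U).
Notation rnV := (rnV muP mu_gen).
Notation spec := (spectrum mu U).
Notation coord := (coord muP mu_gen (U := U)).
Notation rho := (rho muP mu_gen mact pint_harm).
Notation mult := (mult mu U nu act).
Implicit Types u v r : V.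
Implicit Types chi : spec.

Let mpre (f : B -> R) (D : set R) : measurable_fun setT f -> measurable D ->
  measurable (f @^-1` D).
Proof. by move=> mf mD; rewrite -[X in measurable X]setTI; exact: mf. Qed.

Section generic_points.
Variable en : nat -> G.
Hypothesis enP : forall g, exists n, en n = g.

Let box k := [set b | rbox en k (rho^~ b)].

Let mbox k : measurable (box k).
Proof. by apply: measurable_rbox => g; case: (bmf_rho muP mu_gen mact pint_harm g). Qed.

(* The cocycle values at [b] lie in the joint essential range of [rho]. *)
Definition generic b := forall k, box k b -> (0 < nu (box k))%E.

Let null_box n := if unpickle n is Some k then
  if nu (box k) == 0%E then box k else set0 else set0.

Let genericE : [set b | generic b] = ~` \bigcup_n null_box n.
Proof.
apply/seteqP; split => b /=.
  move=> gb [n _]; rewrite /null_box; case: unpickle => // k; case: ifP => // /eqP k0.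
  by move/gb; rewrite k0 ltxx.
move=> nb k kb; rewrite lt0e measure_ge0 andbT; apply/negP => /eqP k0; apply: nb.
by exists (pickle k) => //; rewrite /null_box pickleK k0 eqxx.
Qed.

Lemma measurable_generic : measurable [set b | generic b].
Proof.
rewrite genericE; apply: measurableC; apply: bigcupT_measurable => n.
rewrite /null_box; case: unpickle => [k|]; last exact: measurable0.
by case: ifP => _; [exact: mbox|exact: measurable0].
Qed.

Lemma generic_ae : {ae nu, forall b, generic b}.
Proof.
change (nu.-negligible (~` [set b | generic b])); rewrite genericE setCK.
apply: negligible_bigcup => n; rewrite /null_box.
case: unpickle => [k|]; last exact: negligible_set0.
case: ifP => [/eqP k0|_]; last exact: negligible_set0.
by apply/negligibleP => //; exact: mbox.
Qed.

(** Pairs (a, x) at which finitely many densities are close to their values at b and one null family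
    is small form a filter base. Each such set is nonempty by [joint_support], applied to a rational
    box around the values at b; that box is not null because b is generic. *)
Lemma generic_character b : generic b -> exists chi, forall g, coord g chi = rho g b.
Proof.
move=> gb.
pose D := [set z : (seq G * R) * (abel_param R -> G -> R) |
  [/\ 0 < z.1.2, bdd2 z.2 & null2 mu U z.2]].
pose N (z : (seq G * R) * (abel_param R -> G -> R)) := [set ax : abel_param R * G |
  (forall g, g \in z.1.1 -> `|rn mu g ax.1 ax.2 - rho g b| < z.1.2) /\
  `|z.2 ax.1 ax.2| < z.1.2].
have n0 : null2 mu U (fun _ _ => 0).
  rewrite /null2 -[RHS](mean_cst muP UU 0); congr (mean _).
  by apply/funext => a; apply/funext => x; rewrite expr0n.
have nn (w : abel_param R -> G -> R) : null2 mu U w -> null2 mu U (fun a x => `|w a x|).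
  move=> nw; rewrite /null2 -nw; congr (mean _).
  by apply/funext => a; apply/funext => x; rewrite real_normK ?num_real.
have PF : ProperFilter (filter_from D N).
  apply: filter_from_proper; first apply: filter_from_filter.
  - by exists (([::], 1), fun _ _ => 0); split => //=; exact: bdd2_cst.
  - move=> [[s e] w] [[t f] w'] [/= e0 bw nw] [/= f0 bw' nw'].
    (* Adding absolute values merges two null families into one that controls both. *)
    exists ((s ++ t, Num.min e f), fun a x => `|w a x| + `|w' a x|).
      split => /=; first by rewrite lt_min e0.
        by apply: bdd2_add; exact: bdd2_norm.
      by apply: (null_add muP UU); try exact: bdd2_norm; exact: nn.
    move=> [a x] [/= h1]; rewrite ger0_norm ?addr_ge0// lt_min => /andP[h2 h3].
    split; split => /=.
    + by move=> g gs; have := h1 g; rewrite mem_cat gs => /(_ isT); rewrite lt_min => /andP[].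
    + by rewrite (le_lt_trans _ h2)// lerDl.
    + by move=> g gs; have := h1 g; rewrite mem_cat gs orbT => /(_ isT); rewrite lt_min => /andP[].
    + by rewrite (le_lt_trans _ h3)// lerDr.
  - move=> [[s e] w] [/= e0 bw nw].
    (* [joint_support] with eta = e^2 asks for n (e i)^2 < e^2; here n i^2 = i (1 - i) < 1. *)
    pose n : R := (size s)%:R; pose i := (n + 1)^-1.
    have n_ge0 : 0 <= n by rewrite ler0n.
    have n1 : 0 < n + 1 by rewrite ltr_wpDl.
    have i0 : 0 < i by rewrite invr_gt0.
    have i1 : i * n + i = 1 by rewrite -[X in _ + X]mulr1 -mulrDr mulVf ?gt_eqF.
    have iE : i * n = 1 - i by rewrite -i1 addrK.
    have ei0 : 0 < e * i by rewrite mulr_gt0.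
    have [k [kb ks]] := rbox_approx enP (rho^~ b) s ei0.
    have small : (size s)%:R * (e * i) ^+ 2 < e ^+ 2.
      rewrite -/n (_ : n * _ = e ^+ 2 * (i * (i * n))); last by ring.
      by rewrite iE gtr_pMr ?exprn_gt0//; nra.
    have cl g b' : g \in s -> box k b' -> `|rho g b' - rho g b| <= e * i.
      by move=> gs kb'; apply: ltW; exact: (ks (rho^~ b')).
    have [a [x [h1 h2]]] := joint_support UU U_to_1 pint_uniq pint_ex
      (mbox k) (gb k kb) cl small e0 bw nw.
    exists (a, x); split => //= g gs.
    by have := h1 g gs; rewrite -(real_normK (num_real _)) ltr_pXn2r// nnegrE// ltW.
have [W [WU NW]] := ultraFilterLemma PF.
have lim (f : abel_param R * G -> R) (l : R) :
    (forall e, 0 < e -> W [set ax | `|f ax - l| < e]) -> ulim W f = l.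
  move=> H; apply: ulim_unique => //; have FF : ProperFilter W by exact: ultra_proper.
  apply/cvgrPdist_lt => e e0; apply: filterS (H e e0) => ax /=.
  by rewrite distrC.
have W0 w : bdd2 w -> null2 mu U w -> ulim W (fun p => w p.1 p.2) = 0.
  move=> bw nw; apply: lim => e e0; apply: NW; exists (([::], e), w) => // ax [_ /=].
  by rewrite subr0.
have culim0 v : null_family v -> culim W (fun p => v p.1 p.2) = 0.
  move=> /(null_familyE muP UU)[/(W0 _ (bdd2_re v)) rv /(W0 _ (bdd2_im v)) iv].
  by rewrite /culim -[ulim _ _]/(ulim W (fun p => re v p.1 p.2)) rv
    -[ulim _ _]/(ulim W (fun p => im v p.1 p.2)) iv.
have [chi chiP] := character_of_ultrafilter muP mu_gen UU WU culim0.
exists chi => g; rewrite coordE (chiP _ (inA_rn muP mu_gen (U := U) g)) /culim /=.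
apply: lim => e e0; apply: NW; exists (([:: g], e), fun _ _ => 0).
  by split => //=; exact: bdd2_cst.
move=> ax [/= h _]; have := h g; rewrite inE eqxx => /(_ isT).
by rewrite ?rnVE.
Qed.

End generic_points.

Lemma boundary_map_exists : exists (chi0 : spec) (p : B -> borel (pointed_at chi0)),
  measurable_fun setT p /\ {ae nu, forall b, forall g, coord g (p b) = rho g b}.
Proof.
have [en enP] := group_enumeration countG.
have [b0 gb0] := ae_prob_ex (generic_ae en).
have [chi0 chi0P] := generic_character enP gb0.
(* The character at one generic point is both the base point of the spectrum and the value of p at
   the points that are not generic. *)
pose p b : borel (pointed_at chi0) :=
  if pselect (generic en b) is left h then sval (cid (generic_character enP h)) else chi0.
have pE g b : generic en b -> coord g (p b) = rho g b.
  by rewrite /p; case: pselect => // h _; case: cid => chi /= ->.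
exists chi0, p; split; last by apply: ae_imp (generic_ae en) _ => b gb g; exact: pE.
apply: (measurable_into_spectrum UU countG) => g.
pose E := [set b | generic en b].
have mE : measurable E by exact: measurable_generic.
have [mr _] := bmf_rho muP mu_gen mact pint_harm g.
rewrite (_ : (fun b => _) = fun b => \1_E b * rho g b + \1_(~` E) b * coord g chi0).
  apply: measurable_funD; apply: measurable_funM => //.
  by apply: measurable_indic; exact: measurableC.
apply/funext => b; rewrite !indicE in_setC.
have [bE|bE] := boolP (b \in E); rewrite ?mul1r ?mul0r ?addr0 ?add0r.
  by rewrite pE//; exact: set_mem bE.
rewrite /p; case: pselect => // h; exfalso; move/negP: bE; apply.
exact: mem_set.
Qed.

End boundary_map.

(** * The spectrum as a model of the boundary *)

Section boundary_model.
Context {R : realType} {G : groupType} (countG : countable [set: G]).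
Variables (mu : G -> R) (muP : is_prob_mass mu) (mu_gen : generating mu).
Variables (U : set_system (abel_param R)) (UU : UltraFilter U).
Hypothesis U_to_1 : forall e : R, 0 < e < 2^-1 ->
  U [set a : abel_param R | 1 - e < val a < 1].
Context d (B : measurableType d) (nu : probability B R) (act : G -> B -> B).
Hypothesis mact : measurable_action act.
Notation pint := (pint nu act).
Notation mean := (mean mu U).
Hypothesis pint_harm : forall f : B -> R, bmf f -> (forall b, 0 <= f b) ->
  harmonic mu (pint f).
Hypothesis pint_uniq : forall f g : B -> R, bmf f -> bmf g ->
  (forall x, pint f x = pint g x) -> {ae nu, forall b, f b = g b}.
Hypothesis pint_ex : forall h : G -> R, (forall x, 0 <= h x <= 1) ->
  harmonic mu h -> exists f : B -> R,
  [/\ measurable_fun setT f, forall b, 0 <= f b <= 1 & forall x, pint f x = h x].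
Notation V := (bfam R G).
Notation null_family := (null_family mu U).
Notation inA := (inA mu U).
Notation rnV := (rnV muP mu_gen).
Notation spec := (spectrum mu U).
Notation coord := (coord muP mu_gen (U := U)).
Notation rho := (rho muP mu_gen mact pint_harm).
Notation mult := (mult mu U nu act).
Implicit Types u v : V.
Implicit Types chi : spec.

Variables (chi0 : spec) (p : B -> borel (pointed_at chi0)).
Notation Y := (borel (pointed_at chi0)).
Hypothesis mp : measurable_fun setT p.
Hypothesis p_rho : {ae nu, forall b, forall g, coord g (p b) = rho g b}.
Variable m : probability Y R.
Hypothesis mE : forall A, measurable A -> m A = nu (p @^-1` A).
Notation sact := (spectrum_act muP mu_gen UU).

Lemma mult_ae (r : abel_param R -> G -> R) (q q' : B -> R) :
  mult r q -> bmf q' -> {ae nu, forall b, q b = q' b} -> mult r q'.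
Proof.
move=> [br bq H] bq' qq'; split => // u f uf; have [_ bf _] := uf.
apply: (rep_ae muP mu_gen mact pint_harm (H u f uf)); first exact: bmfM.
by apply: ae_imp qq' _ => b ->.
Qed.

Lemma bmf_Re_ev v : inA v -> bmf (fun y : Y => complex.Re (ev (y : spec) v)).
Proof.
move=> Av; split; first exact: continuous_borel (continuous_Re_ev Av).
have [M _ vM] := bfam_bound v; exists M => y; rewrite -lecR.
exact: le_trans (Re_le_norm _) (ev_bound muP mu_gen UU _ Av vM).
Qed.

Lemma bmf_Im_ev v : inA v -> bmf (fun y : Y => complex.Im (ev (y : spec) v)).
Proof.
move=> Av; split; first exact: continuous_borel (continuous_Im_ev Av).
have [M _ vM] := bfam_bound v; exists M => y; rewrite -lecR.
exact: le_trans (Im_le_norm _) (ev_bound muP mu_gen UU _ Av vM).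
Qed.

Let Rev v b := complex.Re (ev (p b : spec) v).
Let Iev v b := complex.Im (ev (p b : spec) v).

Let bmf_Rev v : inA v -> bmf (Rev v).
Proof. by move=> Av; exact: (bmf_factor mp (bmf_Re_ev Av)). Qed.

Let bmf_Iev v : inA v -> bmf (Iev v).
Proof. by move=> Av; exact: (bmf_factor mp (bmf_Im_ev Av)). Qed.

Let fam_ext (r r' : abel_param R -> G -> R) q q' : (forall a x, r a x = r' a x) ->
  (forall b, q b = q' b) -> mult r q -> mult r' q'.
Proof.
move=> rr' qq'; have -> : r' = r by apply/funext => a; apply/funext => x.
by have -> : q' = q by apply/funext.
Qed.

(** The Gelfand transform of v, pulled back by p, is the multiplier attached to v. On generators
    this is the defining property of p; the induction then needs stability under products and
    uniform limits, which [mult] has. *)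
Lemma mult_ev v : inA v -> mult (re v) (Rev v) /\ mult (im v) (Iev v).
Proof.
move=> Av; suff [_ //] : inA v /\ (mult (re v) (Rev v) /\ mult (im v) (Iev v)).
apply: (inA_ind (muP := muP) (mu_gen := mu_gen) UU
  (S := fun v => inA v /\ (mult (re v) (Rev v) /\ mult (im v) (Iev v)))) Av => {v}.
- move=> u v uv [Au [mr mi]]; split; first exact: inA_null uv Au.
  have [nr ni] := iffLR (null_familyE muP UU _) uv.
  have evE b : ev (p b : spec) u = ev (p b : spec) v by exact: ev_null uv Au.
  split.
    apply: fam_ext (multB muP UU mact mr
      (mult_null muP mu_gen UU nu act (bdd2_re (u - v)) nr)) => [a x|b].
      by rewrite /re bfamB ReB; ring.
    by rewrite subr0 /Rev evE.
  apply: fam_ext (multB muP UU mact mi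
    (mult_null muP mu_gen UU nu act (bdd2_im (u - v)) ni)) => [a x|b].
    by rewrite /im bfamB ImB; ring.
  by rewrite subr0 /Iev evE.
- split; first exact: inA0.
  have e0 b : ev (p b : spec) 0 = 0.
    by rewrite -(subrr 1) (evB muP UU) ?subrr//; exact: inA1.
  by split; apply: fam_ext (mult_cst muP UU nu mact 0) => // b; rewrite /Rev /Iev e0.
- move=> u v _ _ [Au [ur ui]] [Av [vr vi]]; split; first exact: inAD.
  split.
    apply: fam_ext (multD muP UU mact ur vr) => [a x|b]; first by rewrite /re bfamD ReD.
    by rewrite /Rev evD// ReD.
  apply: fam_ext (multD muP UU mact ui vi) => [a x|b]; first by rewrite /im bfamD ImD.
  by rewrite /Iev evD// ImD.
- move=> u v _ _ [Au [ur ui]] [Av [vr vi]]; split; first exact: inAM.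
  split.
    apply: fam_ext (multB muP UU mact (multM ur vr) (multM ui vi)) => [a x|b].
      exact: esym (Re_mul (u a x) (v a x)).
    by rewrite /Rev /Iev evM// Re_mul.
  apply: fam_ext (multD muP UU mact (multM ur vi) (multM ui vr)) => [a x|b].
    exact: esym (Im_mul (u a x) (v a x)).
  by rewrite /Rev /Iev evM// Im_mul.
- move=> k v _ [Av [vr vi]]; split; first exact: inAZ.
  split.
    apply: fam_ext (multB muP UU mact (multZ muP UU mact (complex.Re k) vr)
      (multZ muP UU mact (complex.Im k) vi)) => [a x|b].
      exact: esym (Re_mul k (v a x)).
    by rewrite /Rev /Iev evZ// Re_mul.
  apply: fam_ext (multD muP UU mact (multZ muP UU mact (complex.Re k) vi)
    (multZ muP UU mact (complex.Im k) vr)) => [a x|b].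
    exact: esym (Im_mul k (v a x)).
  by rewrite /Rev /Iev evZ// Im_mul.
- move=> v _ [Av [vr vi]]; split; first exact: inA_conj.
  split.
    apply: fam_ext vr => [a x|b]; first by rewrite /re bfamC; case: (v a x).
    by rewrite /Rev (ev_conj muP mu_gen UU)//; case: (ev _ v).
  apply: fam_ext (multZ muP UU mact (-1) vi) => [a x|b].
    by rewrite /im bfamC mulN1r; case: (v a x).
  by rewrite /Iev (ev_conj muP mu_gen UU)// mulN1r; case: (ev _ v).
- move=> v Av H; split => //.
  have evw (e : R) w b : inA w -> (forall a x, `|v a x - w a x| <= e%:C) ->
      `|ev (p b : spec) v - ev (p b : spec) w| <= e%:C.
    by move=> Aw vw; rewrite -(evB muP UU)//; apply: ev_bound => //; exact: inAB.
  split.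
    apply: mult_lim => //; [exact: bdd2_re|exact: bmf_Rev|move=> e e0].
    have [w [Aw [_ [wr wi]] vw]] := H e e0; exists (re w), (Rev w); split => //.
      by move=> a x; rewrite /re -ReB -lecR; exact: le_trans (Re_le_norm _) (vw a x).
    by move=> b; rewrite /Rev -ReB -lecR; exact: le_trans (Re_le_norm _) (evw e w b Aw vw).
  apply: mult_lim => //; [exact: bdd2_im|exact: bmf_Iev|move=> e e0].
  have [w [Aw [_ [wr wi]] vw]] := H e e0; exists (im w), (Iev w); split => //.
    by move=> a x; rewrite /im -ImB -lecR; exact: le_trans (Im_le_norm _) (vw a x).
  by move=> b; rewrite /Iev -ImB -lecR; exact: le_trans (Im_le_norm _) (evw e w b Aw vw).
move=> g; have Ag : inA (rnV g) by exact: inA_rn.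
split=> //; split.
  have mg := mult_rn muP mu_gen UU U_to_1 mact pint_harm pint_uniq pint_ex g.
  apply: (mult_ae (q := rho g)) (bmf_Rev Ag) _.
    by apply: fam_ext mg => // a x; rewrite /re rnVE.
  by apply: ae_imp p_rho _ => b <-; rewrite coordE.
apply: fam_ext (mult_cst muP UU nu mact 0) => [a x|b]; first by rewrite /im rnVE.
by rewrite /Iev (ev_rn muP mu_gen UU).
Qed.

(** A multiplier represents its own family, and the Poisson transform at the identity is the
    state. *)
Lemma state_represented : represents_state m.
Proof.
move=> c; have Ac := inA_qrep c.
have [/(mult_rep muP UU) mr /(mult_rep muP UU) mi] := mult_ev Ac.
rewrite /qstate (stateE muP UU) (rep_mean mact mr) (rep_mean mact mi).
rewrite (_ : (fun chi : Y => complex.Re _) =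
  fun y : Y => complex.Re (ev (y : spec) (qrep (val c)))).
  rewrite (_ : (fun chi : Y => complex.Im _) =
    fun y : Y => complex.Im (ev (y : spec) (qrep (val c)))).
    rewrite -!/(bint m _) (bint_image mp mE (bmf_Re_ev Ac)).
    by rewrite (bint_image mp mE (bmf_Im_ev Ac)).
  by apply/funext => y; rewrite ev_qrep.
by apply/funext => y; rewrite ev_qrep.
Qed.

Lemma ae_all_group (Q : G -> B -> Prop) : (forall g, {ae nu, forall b, Q g b}) ->
  {ae nu, forall b, forall g, Q g b}.
Proof.
move=> H; have [en enP] := group_enumeration countG.
apply: (@negligibleS _ _ _ nu (\bigcup_n ~` [set b | Q (en n) b])).
  move=> b /= nQ; apply: contrapT => nb; apply: nQ => g; have [n <-] := enP g.
  by apply: contrapT => nQ; apply: nb; exists n.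
by apply: negligible_bigcup => n; exact: H.
Qed.

(** Multiplied by the nonzero coordinate g^-1 of p b, the coordinate h of either side becomes rho
    (g^-1 h) b. The exceptional sets are united over the countable group. *)
Lemma boundary_map_equivariant g :
  {ae nu, forall b, p (act g b) = sact g (p b)}.
Proof.
have h1 := ae_act muP mu_gen mact pint_harm g p_rho.
have h2 := ae_all_group (fun h =>
  rho_cocycle muP mu_gen UU U_to_1 mact pint_harm pint_uniq pint_ex g h).
apply: ae_imp2 (ae_imp2 h1 p_rho (fun b x y => conj x y)) h2 _ => b [pg pb] coc.
apply: (coord_ext (muP := muP) (mu_gen := mu_gen) UU) => h.
apply: (mulIf (coord_neq0 muP mu_gen UU (p b) g^-1%g)).
by rewrite coord_act pg !pb coc.
Qed.

Let mpre A : measurable A -> measurable (p @^-1` A).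
Proof. by move=> mA; rewrite -[X in measurable X]setTI; exact: mp. Qed.

Lemma ae_measure0 (C D : set B) : measurable C -> measurable D ->
  {ae nu, forall b, C b <-> D b} -> nu C = 0%E -> nu D = 0%E.
Proof.
move=> mC mD CD C0; apply/negligibleP => //.
apply: (@negligibleS _ _ _ nu (C `|` ~` [set b | C b <-> D b])).
  move=> b Db; have [Cb|nCb] := pselect (C b); [by left|right => -[_ /(_ Db)]].
  by [].
by apply: negligibleU => //; exact/negligibleP.
Qed.

Lemma spectrum_qi : qi_space m (sact : G -> Y -> Y).
Proof.
have ms g : measurable_fun [set: Y] (sact g : Y -> Y).
  exact: continuous_borel_map (@continuous_spectrum_act _ _ _ muP mu_gen _ UU g).
split; first by split; [exact: spectrum_act_is_action|exact: ms].
move=> g A mA; have [mact' qi] := boundary_qi muP mu_gen mact pint_harm.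
have mgA : measurable ((sact g : Y -> Y) @^-1` A).
  by rewrite -[X in measurable X]setTI; exact: ms.
have mpA : measurable (act g @^-1` (p @^-1` A)).
  by rewrite -[X in measurable X]setTI; apply: mact'.2 => //; exact: mpre.
rewrite !mE//; rewrite -(qi g _ (mpre mA)).
split; apply: ae_measure0 => //; try exact: mpre;
  by apply: ae_imp (boundary_map_equivariant g) _ => b /= ->.
Qed.

Lemma boundary_map_iso : Linfty_iso nu m p.
Proof.
split; [exact: (Linfty_factor mp mE)|exact: (Linfty_factor_inj mp mE)|].
apply: (Linfty_factor_surj mp mE) => f g bf bg H; apply: pint_uniq => // x.
have bk : bmf (fun y : Y => coord x (y : spec)).
  by exact: bmf_Re_ev (inA_rn muP mu_gen (U := U) x).
have rE (k : B -> R) : bmf k -> pint k x = bint nu (fun b => coord x (p b : spec) * k b).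
  move=> bk'; rewrite (rhoP muP mu_gen mact pint_harm)//; apply: bint_ae.
  - by apply: bmfM => //; exact: bmf_rho.
  - by apply: bmfM => //; exact: (bmf_factor mp bk).
  - by apply: ae_imp p_rho _ => b ->.
by rewrite !rE//; exact: H.
Qed.

Lemma boundary_topological_model : topological_model nu act m sact.
Proof.
split.
- exact: (boundary_qi muP mu_gen mact pint_harm).
- by split; [exact: compact_spectrum|exact: metrizable_spectrum].
- by move=> g; exact: continuous_spectrum_act.
- exact: spectrum_qi.
exists p; split; last exact: boundary_map_iso.
by split => //; exact: boundary_map_equivariant.
Qed.

End boundary_model.

Theorem theoremE (R : realType) (G : groupType)
    (countG : countable [set: G])
    (mu : G -> R) (mu_prob : is_prob_mass mu) (mu_gen : generating mu)
    (U : set_system (abel_param R)) (ultraU : UltraFilter U)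
    (U_to_1 : forall e : R, 0 < e < 2^-1 ->
      U [set a : abel_param R | 1 - e < val a < 1])
    (d : measure_display) (B : measurableType d) (nu : probability B R)
    (actB : G -> B -> B) (boundaryB : poisson_boundary mu nu actB) :
  exists (chi0 : spectrum mu U)
         (act : G -> spectrum mu U -> spectrum mu U)
         (m : probability (borel (pointed_at chi0)) R),
    [/\ is_induced_action act,
        represents_state m &
        topological_model nu actB m act].
Proof.
have [_ mact [theta [P [Pe [bnd [[_ th0] PP PeP mbnd [shiftP invP actP nuE]]]]]]] := boundaryB.
have harm := pint_harmonic countG mu_prob th0 PP PeP mact mbnd shiftP actP nuE.
have uniq := pint_unique countG th0 PP PeP mact mbnd shiftP actP nuE.
have ex := poisson_representation countG mu_prob th0 PP PeP mact mbnd shiftP invP actP nuE.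
have [chi0 [p [mp p_rho]]] :=
  boundary_map_exists countG mu_prob mu_gen ultraU U_to_1 mact harm uniq ex.
have [m mE] := image_probability nu mp.
exists chi0, (spectrum_act mu_prob mu_gen ultraU), m; split.
- exact: spectrum_act_induced.
- apply: (state_represented ultraU U_to_1 uniq ex mp p_rho) => A _; exact: mE.
- apply: (boundary_topological_model countG ultraU U_to_1 uniq ex mp p_rho) => A _; exact: mE.
Qed.
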